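(* Let $0\le u_0\in L^{\infty}(\mathbb{R})$ and $m>1$. For each $p>1$ let $u_{m,p}$ be the unique solution of $$u_t+(u^m)_x=-u^p\ \text{ in }\mathbb{R}\times(0,\infty),\qquad u(x,0)=u_0(x)\ \text{ in }\mathbb{R}.$$ Then, as $p\to\infty$, $u_{m,p}$ converges in $C([t_0,T];L^1_{loc}(\mathbb{R}))$ for any $T>t_0>0$ to the solution $u_{m,\infty}$ of $$u_t+(u^m)_x=0\ \text{ in }\mathbb{R}\times(0,\infty),\qquad u(x,0)=\min(u_0(x),1)\ \text{ in }\mathbb{R}.$$
   Context: Notion of solution (Kruzkov). For $m>1$, $\varphi\in C^1([0,\infty))$ and $0\le u_0\in L^\infty(\mathbb{R})$, a function $0\le u\in L^\infty(\mathbb{R}\times(0,\infty))$ is a solution of $u_t+(u^m)_x=\varphi(u)$ in $\mathbb{R}\times(0,\infty)$, $u(x,0)=u_0(x)$ in $\mathbb{R}$, if: (i) for every $k\ge 0$ and every $0\le\eta\in C_0^\infty(\mathbb{R}\times(0,\infty))$, $$\int_0^\infty\int_{\mathbb{R}}\{|u-k|\eta_t+|u^m-k^m|\eta_x+\mathrm{sign}(u-k)\varphi(u)\eta\}\,dx\,dt\ge 0;$$ (ii) there is a null set $\mathcal{E}\subset[0,\infty)$ such that for $t\in[0,\infty)\setminus\mathcal{E}$ the function $u(\cdot,t)$ is defined a.e. in $\mathbb{R}$ and $\int_{|x|\le r}|u(x,t)-u_0(x)|\,dx\to 0$ as $t\to0$, $t\notin\mathcal{E}$, for every $r>0$. This is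 used with $\varphi(u)=-u^p$ and with $\varphi=0$. In both cases, for $m,p>1$ and $0\le u_0\in L^\infty(\mathbb{R})$, the solution is known to exist and be unique (Kruzkov), with values in $[0,\|u_0\|_{L^\infty(\mathbb{R})}]$; it is taken in its representative continuous in $t>0$ with values in $L^1_{loc}(\mathbb{R})$. *)

(* Defs.v *)
From HB Require Import structures.
From mathcomp Require Import all_boot all_order all_algebra.
From mathcomp Require Import all_classical all_reals all_analysis.

Set Implicit Arguments.
Unset Strict Implicit.
Unset Printing Implicit Defensive.

Import Order.TTheory GRing.Theory Num.Theory.
Import numFieldNormedType.Exports.

Local Open Scope classical_set_scope.
Local Open Scope ring_scope.

(* Points of the plane are written (x, t): space first, time second. *)

Definition halfplane (R : realType) : set (R * R) := [set z | 0 < z.2].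

Fixpoint Ck (R : realType) (n : nat) (f : R * R -> R) : Prop :=
  continuous f /\
  match n with
  | 0%N => True
  | k.+1 => [/\ forall z, derivable f z (1, 0), forall z, derivable f z (0, 1),
                Ck k (fun z => 'D_(1, 0) f z) & Ck k (fun z => 'D_(0, 1) f z)]
  end.

(* C_0^oo(R x (0, oo)): a test function is represented by its extension by 0
   to the whole plane. *)
Definition test_function (R : realType) (eta : R * R -> R) : Prop :=
  [/\ forall n, Ck n eta,
      compact (closure [set z | eta z != 0]) &
      closure [set z | eta z != 0] `<=` @halfplane R].

(* Distance in L^1(-r, r). *)
Definition L1dist (R : realType) (r : R) (f g : R -> R) : \bar R :=
  (\int[lebesgue_measure]_(x in [set x : R | (`|x| <= r)%R])
     (`|f x - g x|%R)%:E)%E.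

Definition nonneg_Linfty (R : realType) (f : R -> R) : Prop :=
  f \in Lfun (@lebesgue_measure R) +oo%E /\
  {ae @lebesgue_measure R, forall x, 0 <= f x}.

(* Membership in L^oo(R x (0, oo)) constrains u only for t > 0. *)
Definition nonneg_Linfty_halfplane (R : realType) (u : R * R -> R) : Prop :=
  u \_ (@halfplane R) \in
    Lfun ((@lebesgue_measure R) \x (@lebesgue_measure R))%E +oo%E /\
  {ae ((@lebesgue_measure R) \x (@lebesgue_measure R))%E,
    forall z, halfplane z -> 0 <= u z}.

Definition entropy_inequality (R : realType) (m : R) (phi : R -> R)
    (u : R * R -> R) : Prop :=
  forall (k : R) (eta : R * R -> R),
    0 <= k -> test_function eta -> (forall z, 0 <= eta z) ->
    (0 <= \int[lebesgue_measure]_(t in [set t : R | (0 < t)%R])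
            \int[lebesgue_measure]_x
      (`|u (x, t) - k| * 'D_(0, 1) eta (x, t)
       + `|u (x, t) `^ m - k `^ m| * 'D_(1, 0) eta (x, t)
       + Num.sg (u (x, t) - k) * phi (u (x, t)) * eta (x, t))%R%:E)%E.

Definition initial_trace (R : realType) (u0 : R -> R) (u : R * R -> R) : Prop :=
  exists E : set R,
    [/\ E `<=` [set t | 0 <= t], (@lebesgue_measure R).-negligible E &
        forall r : R, 0 < r ->
          L1dist r (fun x => u (x, t)) u0 @[t --> within (~` E) (0 : R)^'+]
            --> 0%E].

(* Kruzkov solution of u_t + (u^m)_x = phi(u) in R x (0, oo), u(., 0) = u0. *)
Definition kruzkov_solution (R : realType) (m : R) (phi : R -> R)
    (u0 : R -> R) (u : R * R -> R) : Prop :=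
  [/\ nonneg_Linfty_halfplane u, entropy_inequality m phi u &
      initial_trace u0 u].

(* t |-> u(., t) belongs to C((0, oo); L^1_loc(R)). *)
Definition continuous_L1loc (R : realType) (u : R * R -> R) : Prop :=
  (forall t : R, 0 < t -> locally_integrable [set: R] (fun x => u (x, t))) /\
  (forall t r : R, 0 < t -> 0 < r ->
     L1dist r (fun x => u (x, s)) (fun x => u (x, t)) @[s --> t] --> 0%E).

(* u_ p --> v in C([t0, T]; L^1_loc(R)) as the real parameter p tends to oo. *)
Definition cvg_C_L1loc (R : realType) (t0 T : R) (u_ : R -> R * R -> R)
    (v : R * R -> R) : Prop :=
  forall r : R, 0 < r ->
    ereal_sup [set L1dist r (fun x => u_ p (x, t)) (fun x => v (x, t))
                | t in [set t : R | t0 <= t <= T]] @[p --> +oo] --> 0%E.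

(* Main.v *)
From mathcomp Require Import all_boot all_order all_algebra.
From mathcomp Require Import all_classical all_reals all_analysis.
From mathcomp Require Import measurable_realfun ess_sup_inf hoelder.
From mathcomp Require Import ring lra.
Require Import Defs.

(** Of a Kruzkov solution only two one-sided consequences of its entropy
    inequality are kept, both integrated against a weight A in space and valid
    between any two positive times: [subsol] controls the growth of the
    integral of (w - k)^+ A, [supersol] that of (k - w)^+ A.  The damping -u^p
    enters the first as the loss k^(p-1) (w - k)^+, since
    v^p >= k^(p-1) (v - k) for v >= k, and the second as the source k^p.

    Comparison ([compare]) is a Gronwall estimate for the integral of
    (a - b)^+ psi, for a subsolution a and a supersolution b whose source is at
    most c at the levels taken by a.  It is proved by Kruzkov's doubling, but of
    the space variable alone: t |-> a(t), b(t) being continuous in L^1_loc, a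
    and b can be advanced alternately by short time steps.  The weight psi
    satisfies |psi'| <= psi up to a small error ([weight_exists]), so that
    (a^m - b^m)^+ |psi'| is absorbed by the integral to be estimated.

    Let v be the solution of the conservation law starting from min(u0, 1).

    Lower bound ([lower_bound]).  For lam < 1 the function
    z(x, t) = lam v(x, lam^(m-1) t) solves the conservation law as well, starts
    from lam min(u0, 1) <= u0 and takes its values in [0, lam], where the source
    is at most lam^p.  As p tends to infinity, comparison puts z below u_p up to
    a vanishing error; and z is close to v when lam is close to 1, uniformly for
    t in [t0, T], by the continuity of v in time.

    Upper bound ([upper_bound]).  Over a short initial layer [0, tau] two effects
    are combined.  The excess of u_p over a level kappa > 1 decays at the rate
    kappa^(p-1), so that it is negligible at time tau for large p
    ([excess_decay]).  And u_p(tau) exceeds u0 by an amount which is small with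
    tau uniformly in p, because the damping can only lower u_p
    ([initial_layer]).  Hence u_p(tau) is essentially below min(u0, 1), that is
    below v(tau), and comparison with v propagates this to the later times.

    The two bounds control the L^1 distance on every ball uniformly on
    [t0, T]. *)

Set Implicit Arguments.
Unset Strict Implicit.
Unset Printing Implicit Defensive.

Import Order.TTheory GRing.Theory Num.Theory.
Import numFieldNormedType.Exports.

Local Open Scope classical_set_scope.
Local Open Scope ring_scope.

(** * Smooth functions and a mollifier *)

Section smooth_functions.
Context {R : realType}.
Implicit Types f g A B : R -> R.

Fixpoint Cn (n : nat) f : Prop :=
  continuous f /\
  match n with
  | 0%N => True
  | k.+1 => (forall x, derivable f x 1) /\ Cn k (derive1 f)
  end.

Definition smooth f := forall n, Cn n f.

Lemma derive1_is_derive f g :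
  (forall x : R, is_derive x 1 f (g x)) -> (derive1 f) = g.
Proof.
move=> fg; apply/funext => x; rewrite derive1E.
by have := fg x; move=> h; rewrite derive_val.
Qed.

Lemma is_derive_continuous f g :
  (forall x : R, is_derive x 1 f (g x)) -> continuous f.
Proof.
move=> fg x; apply: differentiable_continuous; apply/derivable1_diffP.
by have := fg x; case.
Qed.

Lemma CnS n f g : (forall x : R, is_derive x 1 f (g x)) -> Cn n g -> Cn n.+1 f.
Proof.
move=> fg gn; split; first exact: (is_derive_continuous fg).
split; last by rewrite (derive1_is_derive fg).
by move=> x; have := fg x; case.
Qed.

Lemma Cn_is_derive n f : Cn n.+1 f -> forall x : R, is_derive x 1 f ((derive1 f) x).
Proof. by move=> [_ [fd _]] x; rewrite derive1E; exact: derivableP. Qed.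

Lemma CnW n f : Cn n.+1 f -> Cn n f.
Proof.
elim: n f => [|n ih] f; first by case.
by move=> [cf [df fn]]; split => //; split => //; exact: ih.
Qed.

Lemma Cn_cst n (c : R) : Cn n (cst c).
Proof.
elim: n c => [|n ih] c; first by split => // x; exact: cst_continuous.
by apply: (@CnS _ _ (cst 0)) => //= x; exact: is_derive_cst.
Qed.

Lemma CnD n f g : Cn n f -> Cn n g -> Cn n (f \+ g).
Proof.
elim: n f g => [|n ih] f g fn gn.
  by split => // x; apply: continuousD; [apply: fn.1|apply: gn.1].
have df := Cn_is_derive fn; have dg := Cn_is_derive gn.
have D (x : R) : is_derive x 1 (f \+ g) (((derive1 f) \+ (derive1 g)) x).
  by have := df x; have := dg x => ? ?; apply: is_deriveD.
by apply: (CnS D); apply: ih; [case: fn => _ []|case: gn => _ []].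
Qed.

Lemma CnM n f g : Cn n f -> Cn n g -> Cn n (f \* g).
Proof.
elim: n f g => [|n ih] f g fn gn.
  by split => // x; apply: continuousM; [apply: fn.1|apply: gn.1].
have df := Cn_is_derive fn; have dg := Cn_is_derive gn.
have D (x : R) : is_derive x 1 (f \* g) (((f \* derive1 g) \+ (g \* derive1 f)) x).
  by have := df x; have := dg x => ? ?; apply: is_deriveM.
apply: (CnS D).
have [_ [_ fn']] := fn; have [_ [_ gn']] := gn.
by apply: CnD; apply: ih => //; exact: CnW.
Qed.

Lemma Cn_comp n f g : Cn n f -> Cn n g -> Cn n (f \o g).
Proof.
elim: n f g => [|n ih] f g fn gn.
  by split => // x; apply: continuous_comp; [apply: gn.1|apply: fn.1].
have df := Cn_is_derive fn; have dg := Cn_is_derive gn.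
have D (x : R) : is_derive x 1 (f \o g) (((derive1 f \o g) \* derive1 g) x).
  by have := df (g x); have := dg x => ? ?; apply: is_derive1_comp.
apply: (CnS D); apply: CnM; last by case: gn => _ [].
by apply: ih; [case: fn => _ []|exact: CnW].
Qed.

Lemma CnV n f : (forall x, f x != 0) -> Cn n f -> Cn n (fun x => (f x)^-1).
Proof.
move=> f0; elim: n => [|n ih] fn.
  by split => // x; apply: continuousV; [exact: f0|apply: fn.1].
have df := Cn_is_derive fn.
pose V := fun x => (f x)^-1.
have Vn : Cn n V by apply: ih; exact: CnW.
have D (x : R) : is_derive x 1 V ((cst (-1) \* (V \* V \* derive1 f)) x).
  have := is_deriveV (f0 x) (df x); move/is_derive_eq; apply.
  by rewrite /V /= /GRing.scale/= expr2 invfM mulN1r mulNr.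
apply: (CnS D); apply: CnM; first exact: Cn_cst.
by apply: CnM; [exact: CnM|case: fn => _ []].
Qed.

Lemma smooth_cst c : smooth (cst c). Proof. by move=> n; exact: Cn_cst. Qed.
Lemma smooth_id : smooth (fun x => x).
Proof.
case=> [|n]; first by split => // x; exact: cvg_id.
have D (x : R) : is_derive x 1 (fun x => x) (cst 1 x) by exact: is_derive_id.
by apply: (CnS D); exact: Cn_cst.
Qed.
Lemma smoothD f g : smooth f -> smooth g -> smooth (fun x => f x + g x).
Proof. by move=> sf sg n; exact: (CnD (sf n) (sg n)). Qed.
Lemma smoothM f g : smooth f -> smooth g -> smooth (fun x => f x * g x).
Proof. by move=> sf sg n; exact: (CnM (sf n) (sg n)). Qed.
Lemma smooth_comp f g : smooth f -> smooth g -> smooth (fun x => f (g x)).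
Proof. by move=> sf sg n; exact: (Cn_comp (sf n) (sg n)). Qed.
Lemma smoothV f : (forall x, f x != 0) -> smooth f -> smooth (fun x => (f x)^-1).
Proof. by move=> f0 sf n; exact: CnV. Qed.
Lemma smooth_affine (a b : R) : smooth (fun x => a * x + b).
Proof.
apply: smoothD; last exact: smooth_cst.
by apply: smoothM; [exact: smooth_cst|exact: smooth_id].
Qed.
Lemma smooth_continuous f : smooth f -> continuous f.
Proof. by move=> /(_ 0%N)[]. Qed.
Lemma smooth_is_derive f : smooth f -> forall x : R, is_derive x 1 f ((derive1 f) x).
Proof. by move=> /(_ 1%N); exact: Cn_is_derive. Qed.
Lemma smooth_derive1 f : smooth f -> smooth (derive1 f).
Proof. by move=> sf n; have [_ []] := sf n.+1. Qed.

(** The derivative of a member of this family is a combination of two others,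
    so that all members are smooth by one induction on the order of
    differentiation. *)
Definition flat (n : nat) (x : R) : R :=
  if 0 < x then x^-1 ^+ n * expR (- x^-1) else 0.

Lemma flat_ge0 n x : 0 <= flat n x.
Proof.
rewrite /flat; case: ifPn => // x0.
by rewrite mulr_ge0// ?expR_ge0// exprn_ge0// invr_ge0 ltW.
Qed.

(** With y = 1/x: exp(y) = exp(y/(n+1))^(n+1) >= (y/(n+1))^(n+1). The linear
    bound is what the difference quotient at 0 requires. *)
Lemma flat_le n x : flat n x <= n.+1%:R ^+ n.+1 * `|x|.
Proof.
rewrite /flat; case: ifPn => [x0|_]; last by rewrite mulr_ge0// exprn_ge0.
set y := x^-1; have y0 : 0 < y by rewrite invr_gt0.
have xE : `|x| = y^-1 by rewrite invrK gtr0_norm.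
rewrite xE ler_pdivlMr// mulrAC -exprSr expRN ler_pdivrMr ?expR_gt0//.
have -> : expR y = expR (n.+1%:R * (y / n.+1%:R)).
  by rewrite mulrCA divff ?mulr1// pnatr_eq0.
rewrite expRM_natl -exprMn; apply: lerXn2r; rewrite ?nnegrE ?mulr_ge0 ?expR_ge0// ?(ltW y0)//.
rewrite -ler_pdivrMl ?ltr0n// mulrC.
by apply: le_trans (expR_ge1Dx _); rewrite lerDr.
Qed.

Lemma flat_derive n (x : R) :
  is_derive x 1 (flat n) (flat n.+2 x - n%:R * flat n.+1 x).
Proof.
have [x0|x0|->] := ltgtP x 0.
- have e0 : \forall y \near x, cst 0 y = flat n y.
    near=> y; apply/esym; rewrite /flat ifF//; apply/negbTE; rewrite -leNgt ltW//.
    by near: y; exact: lt_nbhsl.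
  have -> : flat n.+2 x - n%:R * flat n.+1 x = 0.
    by rewrite /flat ltNge ltW//= mulr0 subr0.
  exact: (near_eq_is_derive e0 (is_derive_cst 0 x 1)).
- have e1 : \forall y \near x, y^-1 ^+ n * expR (- y^-1) = flat n y.
    near=> y; rewrite /flat ifT//.
    by near: y; exact: lt_nbhsr.
  apply: (near_eq_is_derive e1).
  rewrite /flat x0.
  have dV : is_derive x 1 (fun y : R => y^-1) (- x^-2).
    by apply: (is_derive_eq (is_deriveV _ _)); rewrite ?gt_eqF//= /GRing.scale/= mulr1.
  have dVn : is_derive x 1 ((fun y : R => y^-1) ^+ n) (n%:R * x^-1 ^+ n.-1 * - x^-2).
    by apply: is_derive_eq; rewrite /GRing.scale/=.
  have dN : is_derive x 1 (fun y : R => - y^-1) (x^-2).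
    by apply: is_derive_eq; rewrite opprK.
  have dE : is_derive x 1 (expR \o (fun y : R => - y^-1)) (expR (- x^-1) * x^-2).
    exact: is_derive1_comp.
  have := is_deriveM dVn dE.
  have -> : ((fun y : R => y^-1) ^+ n : R -> R) * (expR \o (fun y : R => - y^-1)) =
     (fun y => y^-1 ^+ n * expR (- y^-1)).
    by apply/funext => y; rewrite mulrfctE exprfctE.
  move/is_derive_eq; apply.
  rewrite exprfctE /GRing.scale/= -exprVn.
  by case: n {e1 dVn} => [|n]; rewrite /= ?mul0r ?mulr0 ?subr0 ?addr0 !exprS; ring.
- have -> : flat n.+2 0 - n%:R * flat n.+1 0 = 0 by rewrite /flat ltxx mulr0 subr0.
  have f00 : flat n 0 = 0 by rewrite /flat ltxx.
  suff H : h^-1 *: (flat n (h *: 1 + 0) - flat n 0) @[h --> 0^'] --> (0:R).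
    by split; [apply/cvg_ex; exists 0|apply/cvg_lim].
  apply/cvgr0Pnorm_le => e e0.
  pose C : R := n.+2%:R ^+ n.+2.
  have C0 : 0 < C by rewrite exprn_gt0.
  near=> h.
  rewrite f00 subr0 addr0 /GRing.scale/= mulr1.
  have -> : h^-1 * flat n h = flat n.+1 h.
    by rewrite /flat; case: ifP => // _; rewrite ?mulr0// exprS mulrA.
  rewrite ger0_norm ?flat_ge0//; apply: le_trans (flat_le _ _) _.
  rewrite -/C -ler_pdivlMl//.
  near: h; apply: dnbhs0_le; by rewrite mulr_gt0// invr_gt0.
Unshelve. all: by end_near.
Qed.

Lemma smooth_flat n : smooth (flat n).
Proof.
move=> k; elim: k n => [|k ih] n.
  by split => // x; exact: (is_derive_continuous (flat_derive n)).
apply: (CnS (flat_derive n)).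
have -> : (fun x => flat n.+2 x - n%:R * flat n.+1 x) =
    flat n.+2 \+ (cst (- n%:R) \* flat n.+1).
  by apply/funext => x /=; rewrite mulNr.
by apply: CnD; [exact: ih|apply: CnM; [exact: Cn_cst|exact: ih]].
Qed.

Definition step_den (x : R) := flat 0 x + flat 0 (1 - x).

Lemma step_den_gt0 x : 0 < step_den x.
Proof.
rewrite /step_den; have [x0|x0] := ltP 0 x.
  by rewrite ltr_pwDl// ?flat_ge0// /flat x0 mul1r expR_gt0.
rewrite ltr_wpDl ?flat_ge0// /flat ifT ?mul1r ?expR_gt0//; lra.
Qed.

Definition step (x : R) := flat 0 x / step_den x.

Lemma smooth_step : smooth step.
Proof.
have s1 : smooth (fun x : R => flat 0 (1 - x)).
  apply: smooth_comp; first exact: smooth_flat.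
  have := smooth_affine (-1) 1; congr smooth.
  by apply/funext => x; ring.
apply: smoothM; first exact: smooth_flat.
apply: smoothV => [x|]; first by rewrite gt_eqF// step_den_gt0.
by apply: smoothD => //; exact: smooth_flat.
Qed.

Lemma step_ge0 x : 0 <= step x.
Proof. by rewrite divr_ge0 ?flat_ge0// ltW// step_den_gt0. Qed.

Lemma step_le1 x : step x <= 1.
Proof. by rewrite ler_pdivrMr ?step_den_gt0// mul1r lerDl flat_ge0. Qed.

Lemma step0 x : x <= 0 -> step x = 0.
Proof. by move=> x0; rewrite /step /flat ltNge x0 mul0r. Qed.

Lemma step1 x : 1 <= x -> step x = 1.
Proof.
move=> x1; rewrite /step /step_den {3}/flat ifF ?addr0 ?divff//.
  by rewrite gt_eqF// /flat ifT ?mul1r ?expR_gt0//; lra.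
by apply/negbTE; rewrite -leNgt; lra.
Qed.

(** The derivative of [step] in closed form, from which its sign and its
    support can be read off. Its integral is the increment of [step]. *)
Definition mollifier (x : R) :=
  (flat 2 x * flat 0 (1 - x) + flat 0 x * flat 2 (1 - x)) / step_den x ^+ 2.

Lemma mollifier_ge0 x : 0 <= mollifier x.
Proof.
by rewrite divr_ge0 ?sqr_ge0// addr_ge0// mulr_ge0 ?flat_ge0.
Qed.

Lemma mollifier_out x : (x <= 0) || (1 <= x) -> mollifier x = 0.
Proof.
rewrite /mollifier /flat => /orP[x0|x1].
  by rewrite ltNge x0 /= !mul0r addr0 mul0r.
by rewrite (@ltNge _ _ 0 (1 - x)) subr_le0 x1 /= !mulr0 addr0 mul0r.
Qed.

Lemma step_derive (x : R) : is_derive x 1 step (mollifier x).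
Proof.
have d0 := flat_derive 0 x.
have d1 : is_derive x 1 (flat 0 \o (fun y => 1 - y))
    ((flat 2 (1 - x) - 0%:R * flat 1 (1 - x)) * -1).
  have h1 := flat_derive 0 (1 - x).
  have h2 : is_derive x 1 (fun y : R => 1 - y) (-1).
    have := is_deriveB (is_derive_cst (1:R) x 1) (is_derive_id x 1).
    by move/is_derive_eq; apply; rewrite sub0r.
  exact: is_derive1_comp.
have dd := is_deriveD d0 d1.
have n0 : (flat 0 + (flat 0 \o (fun y => 1 - y))) x != 0.
  by rewrite gt_eqF//; exact: step_den_gt0.
have dV := is_deriveV n0 dd.
have := is_deriveM d0 dV.
move/is_derive_eq; apply.
have := step_den_gt0 x; rewrite /step_den => /lt0r_neq0 den0.
rewrite /mollifier /step_den /GRing.scale/= !fctE/=.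
by field.
Qed.

End smooth_functions.

(** * Test functions *)

Section test_functions.
Context {R : realType}.
Implicit Types f g A B : R -> R.

Definition test1 A := smooth A /\ exists L : R, forall x, L < `|x| -> A x = 0.

Lemma continuous_vanishing_bounded A L :
  continuous A -> (forall x, L < `|x| -> A x = 0) ->
  exists2 M : R, 0 <= M & forall x, `|A x| <= M.
Proof.
move=> cA AL.
have L0 : - `|L| <= `|L| by rewrite lerNl (le_trans _ (normr_ge0 _))// oppr_le0.
have cnA : {within `[- `|L|, `|L|], continuous (fun x => `|A x|)}.
  apply: continuous_subspaceT => x.
  by apply: (@continuous_comp _ _ _ A); [exact: cA|exact: norm_continuous].
have [c _ cM] := EVT_max L0 cnA.
exists `|A c| => // x.
have [Lx|xL] := ltP L `|x|; first by rewrite AL ?normr0.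
apply: cM; rewrite in_itv/= -ler_norml (le_trans xL)//; exact: ler_norm.
Qed.

Lemma derive1_vanishing A L : smooth A -> (forall x, L < `|x| -> A x = 0) ->
  forall x, L < `|x| -> derive1 A x = 0.
Proof.
move=> sA AL x Lx; rewrite derive1E.
have e0 : \forall y \near x, cst 0 y = A y.
  have : \forall y \near x, L < `|y|.
    exact: (cvgr_gt _ (@norm_continuous _ R x)).
  by apply: filterS => y Ly; rewrite AL.
by have := near_eq_is_derive e0 (is_derive_cst 0 x 1) => ?; rewrite derive_val.
Qed.

Lemma test1_derive1 A : test1 A -> test1 (derive1 A).
Proof.
move=> [sA [L AL]]; split; first exact: smooth_derive1.
by exists L; exact: derive1_vanishing.
Qed.

Lemma test1_bounded A : test1 A -> exists2 M : R, 0 <= M & forall x, `|A x| <= M.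
Proof.
move=> [sA [L AL]]; apply: (continuous_vanishing_bounded _ AL).
exact: smooth_continuous.
Qed.

Lemma test1Ml f A : smooth f -> test1 A -> test1 (fun x => f x * A x).
Proof.
move=> sf [sA [L AL]]; split; first exact: smoothM.
by exists L => x Lx; rewrite AL// mulr0.
Qed.

Lemma test1_mollifier : test1 (mollifier : R -> R).
Proof.
split.
  rewrite -(derive1_is_derive (@step_derive R)).
  exact/smooth_derive1/smooth_step.
exists 1 => x; rewrite lter_normr => /orP[x1|x1]; apply: mollifier_out; apply/orP.
  by right; exact: ltW.
by left; lra.
Qed.

Lemma derive1_affine_comp f (a b : R) (x : R) : smooth f ->
  is_derive x 1 (fun y => f (a * y + b)) (a * derive1 f (a * x + b)).
Proof.
move=> sf; rewrite mulrC.
have d1 : is_derive x 1 (fun y => a * y + b) a.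
  have := is_deriveD (is_deriveM (is_derive_cst a x 1) (is_derive_id x 1))
    (is_derive_cst b x 1).
  by move/is_derive_eq; apply; rewrite /GRing.scale/= !mulr1 mulr0 !addr0.
have d2 := smooth_is_derive sf (a * x + b).
exact: (@is_derive1_comp _ f (fun y => a * y + b)).
Qed.

Lemma continuous_tensor (f g : R -> R) : continuous f -> continuous g ->
  continuous (fun z : R * R => f z.1 * g z.2).
Proof.
move=> cf cg z; apply: (@continuousM _ _ (f \o fst) (g \o snd)).
- by apply: continuous_comp; [exact: cvg_fst|exact: cf].
- by apply: continuous_comp; [exact: cvg_snd|exact: cg].
Qed.

Lemma is_derive_tensor1 A B (z : R * R) (df : R) :
  is_derive z.1 1 A df ->
  is_derive z ((1, 0) : R * R) (fun z => A z.1 * B z.2) (df * B z.2).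
Proof.
move=> [dA <-].
have H : h^-1 *: ((fun z : R * R => A z.1 * B z.2) (h *: ((1, 0) : R * R) + z) - A z.1 * B z.2)
    @[h --> (0:R)^'] --> 'D_1 A z.1 * B z.2.
  have -> : (fun h : R => h^-1 *:
      ((fun z : R * R => A z.1 * B z.2) (h *: ((1, 0) : R * R) + z) - A z.1 * B z.2))
    = (fun h : R => (h^-1 *: (A (h *: 1 + z.1) - A z.1)) * B z.2).
    apply/funext => h /=.
    by rewrite /GRing.scale/= /GRing.scale/= mulr0 add0r -mulrA mulrBl.
  by apply: cvgM; [exact: dA|exact: cvg_cst].
by split; [apply/cvg_ex; eexists; exact: H|apply/cvg_lim => //; exact: H].
Qed.

Lemma is_derive_tensor2 A B (z : R * R) (df : R) :
  is_derive z.2 1 B df ->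
  is_derive z ((0, 1) : R * R) (fun z => A z.1 * B z.2) (A z.1 * df).
Proof.
move=> [dB <-].
have H : h^-1 *: ((fun z : R * R => A z.1 * B z.2) (h *: ((0, 1) : R * R) + z) - A z.1 * B z.2)
    @[h --> (0:R)^'] --> A z.1 * 'D_1 B z.2.
  have -> : (fun h : R => h^-1 *:
      ((fun z : R * R => A z.1 * B z.2) (h *: ((0, 1) : R * R) + z) - A z.1 * B z.2))
    = (fun h : R => A z.1 * (h^-1 *: (B (h *: 1 + z.2) - B z.2))).
    apply/funext => h /=.
    by rewrite /GRing.scale/= /GRing.scale/= mulr0 add0r mulrCA -mulrBr.
  by apply: cvgM; [exact: cvg_cst|exact: dB].
by split; [apply/cvg_ex; eexists; exact: H|apply/cvg_lim => //; exact: H].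
Qed.

Lemma derive_tensor1 A B : smooth A ->
  (fun z => 'D_((1, 0) : R * R) (fun z : R * R => A z.1 * B z.2) z) =
  (fun z => derive1 A z.1 * B z.2).
Proof.
move=> sA; apply/funext => z.
by have := @is_derive_tensor1 A B z _ (smooth_is_derive sA z.1) => ?; rewrite derive_val.
Qed.

Lemma derive_tensor2 A B : smooth B ->
  (fun z => 'D_((0, 1) : R * R) (fun z : R * R => A z.1 * B z.2) z) =
  (fun z => A z.1 * derive1 B z.2).
Proof.
move=> sA; apply/funext => z.
by have := @is_derive_tensor2 A B z _ (smooth_is_derive sA z.2) => ?; rewrite derive_val.
Qed.

Lemma Ck_tensor n A B : smooth A -> smooth B -> Ck n (fun z => A z.1 * B z.2).
Proof.
elim: n A B => [|n ih] A B sA sB.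
  by split => //; apply: continuous_tensor; exact: smooth_continuous.
split; first by apply: continuous_tensor; exact: smooth_continuous.
split.
- by move=> z; have := @is_derive_tensor1 A B z _ (smooth_is_derive sA z.1); case.
- by move=> z; have := @is_derive_tensor2 A B z _ (smooth_is_derive sB z.2); case.
- by rewrite derive_tensor1//; apply: ih => //; exact: smooth_derive1.
- by rewrite derive_tensor2//; apply: ih => //; exact: smooth_derive1.
Qed.

(** Products of a weight in space and a cutoff in time are the only test
    functions for which the entropy inequality will be used. *)
Lemma test_function_tensor A B a : test1 A -> test1 B -> 0 < a ->
  (forall t, t < a -> B t = 0) -> test_function (fun z => A z.1 * B z.2).
Proof.
move=> [sA [L AL]] [sB [L' BL]] a0 Ba.
have Kc : compact (`[- L, L] `*` `[a, L']).
  by apply: compact_setX; exact: segment_compact.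
have Kcl : closed (`[- L, L] `*` `[a, L'] : set (R * R)).
  apply: compact_closed => //; exact: norm_hausdorff.
have sub : closure [set z : R * R | A z.1 * B z.2 != 0] `<=` (`[- L, L] `*` `[a, L']).
  rewrite closureE => z; apply; split => // -[x t] /= nz; split => /=.
    rewrite in_itv/= -ler_norml leNgt; apply/negP => /AL Ax.
    by rewrite Ax mul0r eqxx in nz.
  rewrite in_itv/= !leNgt; apply/andP; split; apply/negP.
    by move=> /Ba Bt; rewrite Bt mulr0 eqxx in nz.
  move=> L't; have Bt : B t = 0 by apply: BL; rewrite (lt_le_trans L't)// ler_norm.
  by rewrite Bt mulr0 eqxx in nz.
split.
- by move=> n; exact: Ck_tensor.
- by apply: subclosed_compact Kc sub; exact: closed_closure.
- move=> z /sub [_]; rewrite /= in_itv/= => /andP[az _].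
  exact: lt_le_trans az.
Qed.

End test_functions.

(** * Weights dominating their derivatives *)

Section weights.
Context {R : realType}.

Let qw (x : R) := (1 + x ^+ 2)^-1.
Let cutoff (L x : R) : R := step (2 - x / L) * step (2 + x / L).

Let den_gt0 (x : R) : 0 < 1 + x ^+ 2.
Proof. by rewrite ltr_pwDl// sqr_ge0. Qed.

Let qw_ge0 x : 0 <= qw x. Proof. by rewrite invr_ge0 ltW. Qed.

Let qw_smooth : smooth qw.
Proof.
apply: smoothV => [x|]; first by rewrite gt_eqF.
apply: smoothD; first exact: smooth_cst.
by apply: smoothM; exact: smooth_id.
Qed.

Let cutoff_smooth L : smooth (cutoff L).
Proof.
apply: smoothM.
  have := smooth_comp (@smooth_step R) (smooth_affine (- L^-1) 2).
  by congr smooth; apply/funext => x; congr step; ring.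
have := smooth_comp (@smooth_step R) (smooth_affine (L^-1) 2).
by congr smooth; apply/funext => x; congr step; ring.
Qed.

Let qw_derive (x : R) : is_derive x 1 qw (- (qw x * qw x) * (2 * x)).
Proof.
have d1 := is_deriveD (is_derive_cst (1:R) x 1)
  (is_deriveM (is_derive_id x 1) (is_derive_id x 1)).
have n0 : (cst (1:R) + (id * id : R -> R)) x != 0.
  by rewrite !fctE/= -expr2 gt_eqF.
have := is_deriveV n0 d1; move/is_derive_eq; apply.
rewrite !fctE/= /GRing.scale/= /qw -!expr2.
have := den_gt0 x => /lt0r_neq0 ?; field; by [].
Qed.

Let cutoff_derive L (x : R) : is_derive x 1 (cutoff L)
  (step (2 - x / L) * (L^-1 * mollifier (2 + x / L)) +
   step (2 + x / L) * (- L^-1 * mollifier (2 - x / L))).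
Proof.
have E := derive1_is_derive (@step_derive R).
have d1 : is_derive x 1 (fun y => step (2 - y / L)) (- L^-1 * mollifier (2 - x / L)).
  have := derive1_affine_comp (- L^-1) 2 x (@smooth_step R); rewrite E.
  congr is_derive; last by congr (_ * mollifier _); ring.
  by apply/funext => y; congr step; ring.
have d2 : is_derive x 1 (fun y => step (2 + y / L)) (L^-1 * mollifier (2 + x / L)).
  have := derive1_affine_comp (L^-1) 2 x (@smooth_step R); rewrite E.
  congr is_derive; last by congr (_ * mollifier _); ring.
  by apply/funext => y; congr step; ring.
exact: (is_deriveM d1 d2).
Qed.

(** The product of q(x) = 1/(1 + x^2), for which |q'| <= q, and of a cutoff at
    scale L. The slope of the cutoff is of order 1/L and is met only where q
    <= 1/L^2, so that the defect in |psi'| <= psi is as small as e/L: its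
    integral over the support is of order e. A nonzero smooth function of
    compact support cannot satisfy |psi'| <= psi without defect. *)
Lemma weight_exists (e r : R) : 0 < e -> exists (psi : R -> R) (L : R),
  [/\ 0 < L /\ test1 psi,
      forall x, 0 <= psi x <= 1,
      forall x, `|x| <= r -> (1 + r ^+ 2)^-1 <= psi x,
      forall x, L < `|x| -> psi x = 0 &
      forall x, `|derive1 psi x| <= psi x + e / L].
Proof.
move=> e0; have [C C0 hC] := test1_bounded (@test1_mollifier R).
(* beyond L the slope of the cutoff is at most 2 C / L, and q <= L^-2 *)
pose L : R := Num.max 1 (Num.max r (4 * C / e)).
have L1 : 1 <= L by rewrite le_max lexx.
have rL : r <= L by rewrite !le_max lexx orbT.
have CL : 4 * C <= e * L by rewrite [leRHS]mulrC -ler_pdivrMr// !le_max lexx !orbT.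
clearbody L; have L0 : 0 < L by exact: lt_le_trans L1.
have cL x : `|x| <= L -> cutoff L x = 1 /\ derive1 (cutoff L) x = 0.
  rewrite ler_norml => /andP[x1 x2].
  have y1 : 1 <= 2 - x / L by rewrite lerBrDr addrC -lerBrDr ler_pdivrMr//; lra.
  have y2 : 1 <= 2 + x / L by rewrite -lerBlDl ler_pdivlMr//; lra.
  split; first by rewrite /cutoff !step1// mulr1.
  rewrite derive1E; have := cutoff_derive L x => ?; rewrite derive_val.
  by rewrite !mollifier_out ?y1 ?y2 ?orbT// !mulr0 addr0.
have cut0 x : 2 * L < `|x| -> cutoff L x = 0.
  rewrite lter_normr /cutoff => /orP[x1|x1].
    by rewrite (@step0 _ (2 - x / L)) ?mul0r// subr_le0 ler_pdivlMr// ltW.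
  rewrite (@step0 _ (2 + x / L)) ?mulr0// -lerBrDl sub0r ler_pdivrMr//; lra.
have c01 x : 0 <= cutoff L x <= 1.
  rewrite /cutoff mulr_ge0 ?step_ge0//=.
  by rewrite (le_trans (ler_wpM2r _ (step_le1 _))) ?step_ge0// mul1r step_le1.
have dc x : `|derive1 (cutoff L) x| <= 2 * C / L.
  rewrite derive1E; have := cutoff_derive L x => ?; rewrite derive_val.
  rewrite (le_trans (ler_normD _ _))//.
  have n1 (a b c : R) : `|a * (b * c)| = `|a| * (`|b| * `|c|) by rewrite !normrM.
  rewrite !n1 normrN.
  rewrite (ger0_norm (step_ge0 _)).
  rewrite (ger0_norm (step_ge0 _)) (ger0_norm (ltW _)) ?invr_gt0//.
  have i0 : 0 <= L^-1 by rewrite invr_ge0 ltW.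
  have b1 : step (2 - x / L) * (L^-1 * `|mollifier (2 + x / L)|) <= 1 * (L^-1 * C).
    by rewrite ler_pM ?step_ge0 ?step_le1 ?mulr_ge0// ler_wpM2l.
  have b2 : step (2 + x / L) * (L^-1 * `|mollifier (2 - x / L)|) <= 1 * (L^-1 * C).
    by rewrite ler_pM ?step_ge0 ?step_le1 ?mulr_ge0// ler_wpM2l.
  by apply: le_trans (lerD b1 b2) _; rewrite le_eqVlt; apply/orP; left; apply/eqP; ring.
have q1 x : qw x <= 1.
  by rewrite /qw invf_le1 ?lerDl ?sqr_ge0.
have dq x : `|derive1 qw x| <= qw x.
  rewrite derive1E; have := qw_derive x => ?; rewrite derive_val.
  rewrite mulNr normrN -mulrA normrM (ger0_norm (qw_ge0 x)).
  rewrite ler_piMr// normrM (ger0_norm (qw_ge0 x)) /qw ler_pdivrMl// mulr1.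
  have := sqr_ge0 (x - 1); have := sqr_ge0 (x + 1).
  by rewrite ler_norml => ? ?; apply/andP; split; nra.
have dpsi x : derive1 (fun y => qw y * cutoff L y) x =
    qw x * derive1 (cutoff L) x + cutoff L x * derive1 qw x.
  rewrite derive1E; have dq1 := smooth_is_derive qw_smooth x.
  have dc1 := smooth_is_derive (cutoff_smooth L) x.
  by have := is_deriveM dq1 dc1 => ?; rewrite derive_val.
exists (fun x => qw x * cutoff L x), (2 * L); split.
- split; first by rewrite mulr_gt0.
  split; first exact: smoothM.
  by exists (2 * L) => x /cut0 ->; rewrite mulr0.
- move=> x; have /andP[c0 c1] := c01 x; rewrite mulr_ge0//=.
  by rewrite (le_trans (ler_wpM2r c0 (q1 x)))// mul1r.
- move=> x xr; rewrite (cL x _).1 ?(le_trans xr)// mulr1 /qw lef_pV2 ?posrE//.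
  rewrite lerD2l -(real_normK (num_real x)).
  by apply: lerXn2r; rewrite ?nnegrE// (le_trans _ xr).
- by move=> x /cut0 ->; rewrite mulr0.
move=> x; rewrite dpsi.
have /andP[c0 c1] := c01 x.
have [xL|Lx] := leP `|x| L.
  rewrite (cL x _).2// mulr0 add0r normrM (ger0_norm c0).
  apply: (@le_trans _ _ (cutoff L x * qw x)); first by rewrite ler_wpM2l.
  by rewrite mulrC lerDl divr_ge0// ?mulr_ge0// ltW.
rewrite (le_trans (ler_normD _ _))// addrC lerD//.
  by rewrite normrM (ger0_norm c0) mulrC ler_wpM2r.
rewrite normrM (ger0_norm (qw_ge0 x)).
have qL : qw x <= (L ^+ 2)^-1.
  rewrite /qw lef_pV2 ?posrE ?exprn_gt0//.
  rewrite -(real_normK (num_real x)) ler_wpDl//.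
  by apply: lerXn2r; rewrite ?nnegrE// ltW.
apply: (@le_trans _ _ ((L ^+ 2)^-1 * (2 * C / L))).
  by rewrite ler_pM.
rewrite ler_pdivrMl ?exprn_gt0//.
have -> : L ^+ 2 * (e / (2 * L)) = (e * L ^+ 2 / 2) / L.
  by have := lt0r_neq0 L0 => ?; field.
rewrite ler_wpM2r ?invr_ge0 ?(ltW L0)//.
have : e * L <= e * L ^+ 2 by rewrite ler_wpM2l ?(ltW e0)// expr2 ler_peMr// ltW.
lra.
Qed.

End weights.

(** * Bounded functions of compact support and their integrals *)

Section bounded_measurable.
Context {d} {T : measurableType d} {R : realType}.
Implicit Types f g : T -> R.

(** Bounded and measurable. *)
Definition bm f := measurable_fun setT f /\ exists M : R, forall x, `|f x| <= M.

Lemma bm_cst (c : R) : bm (fun=> c).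
Proof. by split; [exact: measurable_cst|exists `|c|]. Qed.

Lemma bmD f g : bm f -> bm g -> bm (fun x => f x + g x).
Proof.
move=> [mf [M fM]] [mg [N gN]]; split; first exact: measurable_funD.
by exists (M + N) => x; rewrite (le_trans (ler_normD _ _))// lerD.
Qed.

Lemma bmM f g : bm f -> bm g -> bm (fun x => f x * g x).
Proof.
move=> [mf [M fM]] [mg [N gN]]; split; first exact: measurable_funM.
by exists (M * N) => x; rewrite normrM ler_pM.
Qed.

Lemma bmN f : bm f -> bm (fun x => - f x).
Proof.
move=> [mf [M fM]]; split; first exact: measurable_funN.
by exists M => x; rewrite normrN.
Qed.

Lemma bmB f g : bm f -> bm g -> bm (fun x => f x - g x).
Proof. by move=> bf bg; apply: bmD => //; exact: bmN. Qed.

Lemma bm_norm f : bm f -> bm (fun x => `|f x|).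
Proof.
move=> [mf [M fM]]; split; first exact: measurableT_comp.
by exists M => x; rewrite normr_id.
Qed.

Lemma bm_max f g : bm f -> bm g -> bm (fun x => Num.max (f x) (g x)).
Proof.
move=> [mf [M fM]] [mg [N gN]]; split; first exact: measurable_maxr.
exists (Num.max M N) => x; rewrite le_max; case: (leP (f x) (g x)) => _.
  by rewrite gN orbT.
by rewrite fM.
Qed.

Lemma bm_min f g : bm f -> bm g -> bm (fun x => Num.min (f x) (g x)).
Proof.
move=> [mf [M fM]] [mg [N gN]]; split; first exact: measurable_minr.
exists (Num.max M N) => x; rewrite le_max; case: (leP (f x) (g x)) => _.
  by rewrite fM.
by rewrite gN orbT.
Qed.

Lemma bm_powR f (m : R) : 0 <= m -> (forall x, 0 <= f x) -> bm f ->
  bm (fun x => f x `^ m).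
Proof.
move=> m0 f0 [mf [M fM]]; split.
  by apply: (measurableT_comp (measurable_powR m)).
exists (M `^ m) => x; rewrite ger0_norm ?powR_ge0//.
have M0 : 0 <= M by exact: le_trans (normr_ge0 _) (fM x).
have fMx : f x <= M by exact: le_trans (ler_norm _) (fM x).
by apply: ge0_ler_powR => //; rewrite nnegrE.
Qed.

Lemma bm_indic (A : set T) : measurable A -> bm (\1_A : T -> R).
Proof.
move=> mA; split; first exact: measurable_indic.
by exists 1 => x; rewrite indicE; case: (_ \in _); rewrite ?normr1// normr0.
Qed.

End bounded_measurable.

Lemma bm_comp d d' (T : measurableType d) (U : measurableType d') (R : realType)
  (f : U -> R) (g : T -> U) : measurable_fun setT g -> bm f -> bm (fun x => f (g x)).
Proof.
move=> mg [mf [M fM]]; split; first exact: measurableT_comp.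
by exists M.
Qed.

Definition pos {R : realType} (x : R) : R := Num.max x 0.

Section pos_lemmas.
Context {R : realType}.
Implicit Types x y z : R.

Lemma pos_ge0 x : 0 <= pos x. Proof. by rewrite le_max lexx orbT. Qed.
Lemma ler_pos x : x <= pos x. Proof. by rewrite le_max lexx. Qed.
Lemma pos_id x : 0 <= x -> pos x = x. Proof. by move=> x0; exact: max_l. Qed.
Lemma pos_eq0 x : x <= 0 -> pos x = 0. Proof. by move=> x0; exact: max_r. Qed.
Lemma pos_le x y : 0 <= y -> x <= y -> pos x <= y.
Proof. by move=> y0 xy; rewrite ge_max xy. Qed.
Lemma le_pos x y : x <= y -> pos x <= pos y.
Proof. by move=> xy; rewrite pos_le ?pos_ge0// (le_trans xy) ?ler_pos. Qed.
Lemma pos_norm x : pos x <= `|x|.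
Proof. by rewrite pos_le// ler_norm. Qed.
Lemma posD_le x y : pos (x + y) <= pos x + pos y.
Proof. by rewrite pos_le ?addr_ge0 ?pos_ge0// lerD ?ler_pos. Qed.
Lemma posB_norm x y : `|pos x - pos y| <= `|x - y|.
Proof.
wlog yx : x y / y <= x.
  by move=> H; have [/H//|/ltW/H] := leP y x; rewrite distrC (distrC y).
rewrite !ger0_norm ?subr_ge0 ?le_pos// lerBlDr -{1}(subrK y x).
by rewrite (le_trans (posD_le _ _))// pos_id ?subr_ge0.
Qed.
Lemma norm_pos x : `|x| = pos x + pos (- x).
Proof.
have [x0|x0] := leP 0 x.
  by rewrite ger0_norm// pos_id// pos_eq0 ?addr0// oppr_le0.
by rewrite ltr0_norm// pos_eq0 ?ltW// pos_id ?add0r// oppr_ge0 ltW.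
Qed.
Lemma pos2 x : pos x *+ 2 = `|x| + x.
Proof.
have [x0|x0] := leP 0 x; first by rewrite ger0_norm// pos_id// mulr2n.
by rewrite ltr0_norm// pos_eq0 ?ltW// addNr mul0rn.
Qed.
Lemma posMl c x : 0 <= c -> pos (c * x) = c * pos x.
Proof. by move=> c0; rewrite /pos maxr_pMr// mulr0. Qed.
End pos_lemmas.

Lemma bm_pos d (T : measurableType d) (R : realType) (f : T -> R) :
  bm f -> bm (fun x => pos (f x)).
Proof. by move=> bf; apply: bm_max => //; exact: bm_cst. Qed.

Section integral_compact_support.
Context {R : realType}.
Local Notation mu := (@lebesgue_measure R).
Implicit Types f g A : R -> R.

Definition vanish (L : R) f := forall x, L < `|x| -> f x = 0.
(** Bounded, measurable and of compact support: on this class the integral [I]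
    is finite, linear and monotone, and Fubini's theorem holds in the plane.
    *)
Definition bcs f := bm f /\ exists L, vanish L f.

Definition I f : R := \int[mu]_x f x.

Lemma vanishW L L' f : L <= L' -> vanish L f -> vanish L' f.
Proof. by move=> LL' fL x xL; apply: fL; exact: le_lt_trans xL. Qed.

Lemma bcs_vanish f : bcs f -> exists2 L : R, 0 <= L & vanish L f.
Proof.
move=> [_ [L fL]]; exists `|L| => //; apply: vanishW fL; exact: ler_norm.
Qed.

Lemma bcsMl f A : bm f -> bcs A -> bcs (fun x => f x * A x).
Proof.
move=> bf [bA [L AL]]; split; first exact: bmM.
by exists L => x /AL ->; rewrite mulr0.
Qed.

Lemma bcsD f g : bcs f -> bcs g -> bcs (fun x => f x + g x).
Proof.
move=> [bf [L fL]] [bg [L' gL]]; split; first exact: bmD.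
exists (Num.max L L') => x; rewrite gt_max => /andP[xL xL'].
by rewrite fL// gL// addr0.
Qed.

Lemma bcsN f : bcs f -> bcs (fun x => - f x).
Proof.
move=> [bf [L fL]]; split; first exact: bmN.
by exists L => x xL; rewrite fL// oppr0.
Qed.

Lemma bcsB f g : bcs f -> bcs g -> bcs (fun x => f x - g x).
Proof. by move=> bf bg; apply: bcsD => //; exact: bcsN. Qed.

Lemma bcs_norm f : bcs f -> bcs (fun x => `|f x|).
Proof.
move=> [bf [L fL]]; split; first exact: bm_norm.
by exists L => x xL; rewrite fL// normr0.
Qed.

Lemma bcs_pos f : bcs f -> bcs (fun x => pos (f x)).
Proof.
move=> [bf [L fL]]; split; first exact: bm_pos.
by exists L => x xL; rewrite fL// /pos maxxx.
Qed.

Lemma bcsZ c f : bcs f -> bcs (fun x => c * f x).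
Proof. by move=> bf; apply: bcsMl => //; exact: bm_cst. Qed.

Definition window (r : R) : R -> R := \1_(`[- r, r]%classic : set R).

Lemma windowE r x : window r x = if `|x| <= r then 1 else 0.
Proof. by rewrite /window indicE mem_setE in_itv/= ler_norml; case: (_ && _). Qed.

Lemma window_ge0 r x : 0 <= window r x. Proof. by rewrite windowE; case: ifP. Qed.

Lemma bcs_window r : bcs (window r).
Proof.
split; first exact: bm_indic.
by exists r => x; rewrite windowE ltNge => /negbTE ->.
Qed.

Lemma bcs_integrable f : bcs f -> mu.-integrable setT (EFin \o f).
Proof.
move=> [[mf [M fM]] [L fL]].
have -> : f = f \_ `[- L, L].
  apply/funext => x; rewrite patchE; case: ifPn => //.
  rewrite notin_setE/= in_itv/= -ler_norml => /negP; rewrite -ltNge; exact: fL.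
rewrite -restrict_EFin; apply/integrable_restrict => //; rewrite setTI.
apply: measurable_bounded_integrable => //.
- rewrite /= lebesgue_measure_itv/=; case: ifPn => // _; rewrite -EFinB; exact: ltry.
- exact: measurable_funTS.
- exists M; split; first by rewrite num_real.
  by move=> y My x _ /=; rewrite (le_trans (fM x))// ltW.
Qed.
Local Hint Resolve bcs_integrable : core.

Lemma I_EFin f : bcs f -> (\int[mu]_x (f x)%:E)%E = (I f)%:E.
Proof.
move=> bf; rewrite /I /Rintegral fineK//.
by apply: integrable_fin_num => //; exact: bcs_integrable.
Qed.

Lemma ID f g : bcs f -> bcs g -> I (fun x => f x + g x) = I f + I g.
Proof. by move=> bf bg; rewrite /I RintegralD//; exact: bcs_integrable. Qed.

Lemma IB f g : bcs f -> bcs g -> I (fun x => f x - g x) = I f - I g.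
Proof. by move=> bf bg; rewrite /I RintegralB//; exact: bcs_integrable. Qed.

Lemma IZ c f : bcs f -> I (fun x => c * f x) = c * I f.
Proof. by move=> bf; rewrite /I RintegralZl//; exact: bcs_integrable. Qed.

Lemma I0 : I (fun=> 0) = 0.
Proof. by rewrite /I Rintegral_cst// mul0r. Qed.

Lemma I_le f g : bcs f -> bcs g -> (forall x, f x <= g x) -> I f <= I g.
Proof. by move=> bf bg fg; rewrite /I le_Rintegral//; exact: bcs_integrable. Qed.

Lemma I_ge0 f : (forall x, 0 <= f x) -> 0 <= I f.
Proof. by move=> f0; exact: Rintegral_ge0. Qed.

Lemma I_norm f : bcs f -> `|I f| <= I (fun x => `|f x|).
Proof. by move=> bf; rewrite /I le_normr_Rintegral//; exact: bcs_integrable. Qed.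

Lemma I_window r : 0 <= r -> I (window r) = 2 * r.
Proof.
move=> r0; rewrite /I /Rintegral integral_indic// setIT/= lebesgue_measure_itv/=.
rewrite lte_fin; case: ltP => /= H; first by ring.
by have -> : r = 0; [lra|rewrite mulr0].
Qed.

Lemma I_le_bound f M L : bcs f -> 0 <= L -> (forall x, f x <= M) -> vanish L f ->
  I f <= M * (2 * L).
Proof.
move=> bf L0 fM fL; rewrite -I_window// -IZ; last exact: bcs_window.
apply: I_le => //; first exact/bcsZ/bcs_window.
move=> x; rewrite windowE; have [xL|xL] := leP `|x| L; first by rewrite mulr1.
by rewrite mulr0 fL.
Qed.

Lemma continuous_bcs f L : continuous f -> vanish L f -> bcs f.
Proof.
move=> cf fL; split; last by exists L.
split; first exact: continuous_measurable_fun.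
by have [M M0 fM] := continuous_vanishing_bounded cf fL; exists M.
Qed.

Lemma test1_bcs A : test1 A -> bcs A.
Proof.
by move=> [sA [L AL]]; apply: (continuous_bcs _ AL); exact: smooth_continuous.
Qed.

Lemma I_derive f L : 0 < L -> smooth f -> vanish L (derive1 f) ->
  I (derive1 f) = f L - f (- L).
Proof.
move=> L0 sf fL.
have -> : I (derive1 f) = \int[mu]_(x in `[- L, L]) derive1 f x.
  rewrite Rintegral_mkcond; congr Rintegral; apply/funext => x.
  rewrite patchE; case: ifPn => //.
  rewrite notin_setE/= in_itv/= -ler_norml => /negP; rewrite -ltNge; exact: fL.
have cf := smooth_continuous sf.
rewrite /Rintegral (@continuous_FTC2 _ _ f) //.
- by rewrite gtrN.
- by apply: continuous_subspaceT; apply: smooth_continuous; exact: smooth_derive1.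
- split.
  + by move=> x _; have [] := sf 1%N => _ [].
  + exact: cvg_at_right_filter (cf _).
  + exact: cvg_at_left_filter (cf _).
Qed.

Lemma I_derive_test1 A : test1 A -> I (derive1 A) = 0.
Proof.
move=> tA; have [_ [L0 AL0]] := tA; have [sA _] := tA.
pose L := `|L0| + 1.
have LL0 : L0 < L by rewrite ltr_pwDr// ler_norm.
have L_gt0 : 0 < L by rewrite ltr_pwDr.
rewrite (I_derive L_gt0) //; last first.
  by apply: (vanishW (ltW LL0)); exact: derive1_vanishing.
by rewrite !AL0 ?subr0// ?normrN gtr0_norm.
Qed.

End integral_compact_support.

Section fubini.
Context {R : realType}.
Local Notation mu := (@lebesgue_measure R).

Definition bcs2 (f : R * R -> R) :=
  bm f /\ exists L : R, forall z, L < `|z.1| \/ L < `|z.2| -> f z = 0.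

Variable f : R * R -> R.
Hypothesis f2 : bcs2 f.

Lemma bcs2_section1 x : bcs (fun y => f (x, y)).
Proof.
have [bf [L fL]] := f2; split; last by exists L => y yL; rewrite fL//; right.
by apply: (bm_comp _ bf); exact: measurable_pair1.
Qed.

Lemma bcs2_section2 y : bcs (fun x => f (x, y)).
Proof.
have [bf [L fL]] := f2; split; last by exists L => x xL; rewrite fL//; left.
by apply: (bm_comp _ bf); exact: measurable_pair2.
Qed.

(* |f| is dominated by a multiple of the indicator function of a square *)
Let int2 : (mu \x mu)%E.-integrable setT (EFin \o f).
Proof.
have [[mf [M fM]] [L0 fL0]] := f2.
pose L := `|L0|.
have L00 : L0 <= L by exact: ler_norm.
have L_ge0 : 0 <= L by exact: normr_ge0.
pose F1 (z : R * R) := `|(f z)%:E|%E.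
have mF1 : measurable_fun setT F1.
  by apply: measurableT_comp => //; exact/measurable_EFinP.
have F10 z : (0 <= F1 z)%E by exact: abse_ge0.
pose F2 (z : R * R) := (`|M| * window L z.1 * window L z.2)%:E.
have mF2 : measurable_fun setT F2.
  have [[mw _] _] := bcs_window L.
  apply/measurable_EFinP; apply: measurable_funM.
    apply: measurable_funM => //.
    exact: (measurableT_comp mw measurable_fst).
  exact: (measurableT_comp mw measurable_snd).
have F20 z : (0 <= F2 z)%E by rewrite lee_fin !mulr_ge0 ?window_ge0.
apply/integrable12ltyP; first exact/measurable_EFinP.
apply: (@le_lt_trans _ _ (\int[mu]_x \int[mu]_y (`|M| * window L x * window L y)%:E)%E).
  apply: ge0_le_integral => //=.
  - by move=> x _; exact: integral_ge0.
  - exact: (measurable_fun_fubini_tonelli_F (m2 := mu) _ mF1 F10).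
  - exact: (measurable_fun_fubini_tonelli_F (m2 := mu) _ mF2 F20).
  move=> x _; apply: ge0_le_integral => //=.
  - by apply/measurable_EFinP; have [[]] := bcs_norm (bcs2_section1 x).
  - by apply/measurable_EFinP; have [[]] := bcsZ (`|M| * window L x) (bcs_window L).
  move=> y _; rewrite lee_fin !windowE.
  have [xL|xL] := leP `|x| L; last first.
    by rewrite mulr0 mul0r fL0 ?normr0//=; left; exact: le_lt_trans xL.
  have [yL|yL] := leP `|y| L; last first.
    by rewrite mulr0 fL0 ?normr0//=; right; exact: le_lt_trans yL.
  by rewrite !mulr1 (le_trans (fM _))// ler_norm.
have E : (\int[mu]_x \int[mu]_y (`|M| * window L x * window L y)%:E)%E =
    (I (fun x => `|M| * (2 * L) * window L x))%:E.
  rewrite -I_EFin; last exact/bcsZ/bcs_window.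
  apply: eq_integral => t _.
  rewrite (I_EFin (bcsZ _ (bcs_window L))) IZ ?I_window//; last exact: bcs_window.
  by congr EFin; ring.
by rewrite E ltry.
Qed.

Lemma bcs2_I1 : bcs (fun x => I (fun y => f (x, y))).
Proof.
have [[mf [M fM]] [L0 fL0]] := f2.
pose L := `|L0|.
have L00 : L0 <= L by exact: ler_norm.
have L_ge0 : 0 <= L by exact: normr_ge0.
split; last first.
  exists L => x xL; rewrite (_ : (fun y => _) = (fun=> 0)) ?I0//.
  by apply/funext => y; rewrite fL0//=; left; exact: le_lt_trans xL.
split.
  exact: (measurableT_comp (fine_measurable measurableT) (measurable_fubini_F int2)).
exists (M * (2 * L)) => x.
have b1 := bcs2_section1 x.
apply: (le_trans (I_norm b1)); apply: I_le_bound => //; first exact: bcs_norm.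
by move=> y yL; rewrite fL0 ?normr0//=; right; exact: le_lt_trans yL.
Qed.

Lemma bcs2_I2 : bcs (fun y => I (fun x => f (x, y))).
Proof.
have [[mf [M fM]] [L0 fL0]] := f2.
pose L := `|L0|.
have L00 : L0 <= L by exact: ler_norm.
have L_ge0 : 0 <= L by exact: normr_ge0.
split; last first.
  exists L => x xL; rewrite (_ : (fun y => _) = (fun=> 0)) ?I0//.
  by apply/funext => y; rewrite fL0//=; right; exact: le_lt_trans xL.
split.
  exact: (measurableT_comp (fine_measurable measurableT) (measurable_fubini_G int2)).
exists (M * (2 * L)) => x.
have b1 := bcs2_section2 x.
apply: (le_trans (I_norm b1)); apply: I_le_bound => //; first exact: bcs_norm.
by move=> y yL; rewrite fL0 ?normr0//=; left; exact: le_lt_trans yL.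
Qed.

Lemma I_swap : I (fun x => I (fun y => f (x, y))) = I (fun y => I (fun x => f (x, y))).
Proof.
have := Fubini int2.
under eq_integral do rewrite /= (I_EFin (bcs2_section1 _)).
under [RHS]eq_integral do rewrite /= (I_EFin (bcs2_section2 _)).
by rewrite (I_EFin bcs2_I1) (I_EFin bcs2_I2) => -[].
Qed.

End fubini.

(** * Mollifying kernels *)

(* From here on integrals are handled through the lemmas above only. *)
Opaque I.

Section kernels.
Context {R : realType}.

(** One-sided: in x it is concentrated on [y, y + h]. Used in the time
    variable, it averages over later times only, which are positive. *)
Definition kern (h x y : R) : R := h^-1 * mollifier ((x - y) / h).

Lemma kern_ge0 h x y : 0 < h -> 0 <= kern h x y.
Proof. by move=> h0; rewrite mulr_ge0 ?mollifier_ge0// invr_ge0 ltW. Qed.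

Lemma kern_out h x y : 0 < h -> (x <= y) || (y + h <= x) -> kern h x y = 0.
Proof.
move=> h0 /orP H; rewrite /kern mollifier_out ?mulr0//; apply/orP.
case: H => H; [left|right].
  by rewrite pmulr_lle0 ?invr_gt0// subr_le0.
by rewrite ler_pdivlMr// mul1r; lra.
Qed.

Lemma kern_far h x y : 0 < h -> h <= `|x - y| -> kern h x y = 0.
Proof.
move=> h0; rewrite lter_normr => /orP[H|H]; apply: kern_out => //; apply/orP.
  by right; lra.
by left; lra.
Qed.

Lemma step_affine_derive (a b : R) (x : R) :
  is_derive x 1 (fun y => step (a * y + b)) (a * mollifier (a * x + b)).
Proof.
have := derive1_affine_comp a b x (@smooth_step R).
by rewrite (derive1_is_derive (@step_derive R)).
Qed.

Lemma test1_affine (A : R -> R) (a b : R) : a != 0 -> test1 A ->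
  test1 (fun x => A (a * x + b)).
Proof.
move=> a0 [sA [L AL]]; split.
  by apply: smooth_comp => //; exact: smooth_affine.
exists ((`|L| + `|b|) / `|a|) => x; rewrite ltr_pdivrMr ?normr_gt0// => H.
apply: AL; apply: (le_lt_trans (ler_norm L)).
have : `|x * a| <= `|a * x + b| + `|b|.
  by rewrite (le_trans _ (ler_normB _ _))// addrK mulrC.
rewrite normrM; lra.
Qed.

Lemma kernE1 h y : (fun x => kern h x y) = (fun x => h^-1 * mollifier (h^-1 * x + (- y / h))).
Proof. by apply/funext => x; congr (_ * mollifier _); ring. Qed.

Lemma kernE2 h x : kern h x = (fun y => h^-1 * mollifier (- h^-1 * y + (x / h))).
Proof. by apply/funext => y; congr (_ * mollifier _); ring. Qed.

Lemma test1_kern1 h y : 0 < h -> test1 (fun x => kern h x y).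
Proof.
move=> h0; rewrite kernE1; apply: test1Ml; first exact: smooth_cst.
by apply: test1_affine; [rewrite invr_eq0 gt_eqF|exact: test1_mollifier].
Qed.

Lemma test1_kern2 h x : 0 < h -> test1 (kern h x).
Proof.
move=> h0; rewrite kernE2; apply: test1Ml; first exact: smooth_cst.
by apply: test1_affine; [rewrite oppr_eq0 invr_eq0 gt_eqF|exact: test1_mollifier].
Qed.

Definition kern' (h x y : R) : R := h^-1 * (h^-1 * derive1 (mollifier : R -> R) ((x - y) / h)).

Lemma kern_derive1 h (x y : R) : is_derive x 1 (fun x => kern h x y) (kern' h x y).
Proof.
have sm := (@test1_mollifier R).1.
have d := derive1_affine_comp h^-1 (- y / h) x sm.
have := is_deriveM (is_derive_cst (h^-1) x 1) d; rewrite kernE1.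
move/is_derive_eq; apply.
rewrite /GRing.scale/= mulr0 addr0 /kern'; congr (_ * (_ * derive1 (mollifier : R -> R) _)); ring.
Qed.

Lemma kern_derive2 h (x y : R) : is_derive y 1 (kern h x) (- kern' h x y).
Proof.
have sm := (@test1_mollifier R).1.
have d := derive1_affine_comp (- h^-1) (x / h) y sm.
have := is_deriveM (is_derive_cst (h^-1) y 1) d; rewrite kernE2.
move/is_derive_eq; apply.
rewrite /GRing.scale/= mulr0 addr0 /kern' mulNr mulrN.
congr (- (_ * (_ * derive1 (mollifier : R -> R) _))); ring.
Qed.

Lemma kern'_bounded h : 0 < h -> exists2 C : R, 0 <= C & forall x y, `|kern' h x y| <= C.
Proof.
move=> h0; have [C C0 mC] := test1_bounded (test1_derive1 (@test1_mollifier R)).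
exists (h^-1 * (h^-1 * C)); first by rewrite !mulr_ge0 ?invr_ge0 ?(ltW h0).
move=> x y; rewrite /kern' !normrM ger0_norm ?invr_ge0 ?(ltW h0)//.
by do 2 (rewrite ler_wpM2l ?invr_ge0 ?(ltW h0)//).
Qed.

Lemma kern'_far h x y : 0 < h -> h < `|x - y| -> kern' h x y = 0.
Proof.
move=> h0 H; rewrite /kern' (@derive1_vanishing _ _ 1 (@test1_mollifier R).1) ?mulr0//.
  move=> z; rewrite lter_normr => /orP[x1|x1]; apply: mollifier_out; apply/orP.
    by right; exact: ltW.
  by left; lra.
by rewrite normrM (@gtr0_norm _ h^-1) ?invr_gt0// ltr_pdivlMr// mul1r.
Qed.

Lemma kern_bounded h : 0 < h -> exists2 C : R, 0 <= C & forall x y, kern h x y <= C.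
Proof.
move=> h0; have [C C0 mC] := test1_bounded (@test1_mollifier R).
exists (h^-1 * C); first by rewrite mulr_ge0 ?invr_ge0 ?(ltW h0).
move=> x y; rewrite /kern ler_wpM2l ?invr_ge0 ?(ltW h0)//.
by rewrite (le_trans _ (mC ((x - y) / h)))// ler_norm.
Qed.

Lemma I_mollifier_affine (a b : R) : a != 0 ->
  I (fun x => `|a| * mollifier (a * x + b)) = 1.
Proof.
move=> a0.
have D := @step_affine_derive a b.
have sS : smooth (fun y => step (a * y + b)).
  by apply: smooth_comp; [exact: smooth_step|exact: smooth_affine].
have [_ [L0 mL0]] : test1 (fun x => a * mollifier (a * x + b)).
  by apply: test1Ml; [exact: smooth_cst|apply: test1_affine => //; exact: test1_mollifier].
pose L : R := Num.max (`|L0| + 1) ((1 + `|b|) / `|a|).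
have L_gt0 : 0 < L by rewrite lt_max ltr_pwDr.
have bL : 1 + `|b| <= `|a| * L by rewrite mulrC -ler_pdivrMr ?normr_gt0// le_max lexx orbT.
have L0L : L0 <= L by rewrite le_max (le_trans (ler_norm L0)) ?lerDl.
clearbody L.
have mL : vanish L (derive1 (fun y => step (a * y + b))).
  by rewrite (derive1_is_derive D); exact: vanishW mL0.
have := I_derive L_gt0 sS mL; rewrite (derive1_is_derive D).
have nb := ler_norm b; have nb' := ler_norm (- b); rewrite normrN in nb'.
have [a_gt0|a_le0] := ltP 0 a.
  rewrite (gtr0_norm a_gt0) in bL *.
  by rewrite step1 ?(@step0 _ (a * - L + b)) ?subr0//; lra.
rewrite (ler0_norm a_le0) in bL *.
rewrite (@step0 _ (a * L + b)) ?step1; [|lra|lra].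
have tm : test1 (fun x : R => a * mollifier (a * x + b)).
  by apply: test1Ml; [exact: smooth_cst|apply: test1_affine => //; exact: test1_mollifier].
move=> E; rewrite (_ : (fun x => _) = (fun x => -1 * (a * mollifier (a * x + b)))).
  by rewrite IZ ?E; [ring|exact: test1_bcs].
by apply/funext => x; rewrite mulN1r mulNr.
Qed.

Lemma I_kern1 h y : 0 < h -> I (fun x => kern h x y) = 1.
Proof.
move=> h0; rewrite kernE1 -(@I_mollifier_affine h^-1 (- y / h)) ?invr_eq0 ?gt_eqF//.
by rewrite gtr0_norm ?invr_gt0.
Qed.

Lemma I_kern2 h x : 0 < h -> I (kern h x) = 1.
Proof.
move=> h0; rewrite kernE2 -(@I_mollifier_affine (- h^-1) (x / h)) ?oppr_eq0 ?invr_eq0 ?gt_eqF//.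
by rewrite normrN gtr0_norm ?invr_gt0.
Qed.

Lemma I_average_le (F k : R -> R) (c : R) : bm F -> bcs k -> (forall x, 0 <= k x) ->
  I k = 1 -> (forall x, k x != 0 -> F x <= c) -> I (fun x => F x * k x) <= c.
Proof.
move=> bF bk k0 k1 Fc.
have -> : c = I (fun x => c * k x) by rewrite IZ// k1 mulr1.
apply: I_le; [exact: bcsMl|exact: bcsZ|].
move=> x; have [->|kx] := eqVneq (k x) 0; first by rewrite !mulr0.
by rewrite ler_wpM2r// Fc.
Qed.

Lemma I_average_ge (F k : R -> R) (c : R) : bm F -> bcs k -> (forall x, 0 <= k x) ->
  I k = 1 -> (forall x, k x != 0 -> c <= F x) -> c <= I (fun x => F x * k x).
Proof.
move=> bF bk k0 k1 Fc.
have -> : c = I (fun x => c * k x) by rewrite IZ// k1 mulr1.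
apply: I_le; [exact: bcsZ|exact: bcsMl|].
move=> x; have [->|kx] := eqVneq (k x) 0; first by rewrite !mulr0.
by rewrite ler_wpM2r// Fc.
Qed.

End kernels.

Lemma ler_distl_bounds (R : realType) (x y e : R) :
  `|x - y| <= e -> x <= y + e /\ y - e <= x.
Proof. by rewrite ler_distl => /andP[]; split. Qed.

(* Integrals enter these linear inequalities as opaque numbers. *)
Ltac lra_only :=
  clear; repeat (match goal with |- context[@I ?R ?f] => generalize (@I R f) end);
  intros; lra.

(** * Differential inequalities in integrated form *)

Section time.
Context {R : realType}.
Implicit Types F G B : R -> R.

Lemma continuous_right_le F (t e : R) : 0 < e -> {for t, continuous F} ->
  exists2 d : R, 0 < d & forall s, t <= s <= t + d -> `|F s - F t| <= e.
Proof.
move=> e0 /cvgrPdist_le/(_ _ e0)/nbhs_ballP[d/= d0 H].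
exists (d / 2); first by rewrite divr_gt0.
move=> s /andP[ts sd]; rewrite distrC; apply: H.
by rewrite /ball/= ler0_norm ?subr_le0//; lra.
Qed.

(** The hypothesis on the functions B says that F' <= G in the sense of
    distributions. It is tested with a smoothed indicator function of [t1,
    t2], whose derivative is a difference of two kernels, so that the integral
    of F B' is close to F t1 - F t2 by the continuity of F. *)
Lemma time_increment F G (c t1 t2 : R) : bm F -> bm G ->
  (forall t, 0 < t -> {for t, continuous F}) ->
  (forall t, 0 < t -> {for t, continuous G}) ->
  (forall B a, test1 B -> 0 < a -> (forall t, t < a -> B t = 0) ->
     (forall t, 0 <= B t) -> 0 <= I (fun t => F t * derive1 B t + G t * B t)) ->
  0 < t1 -> t1 <= t2 -> (forall t, t1 <= t <= t2 -> G t <= c) ->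
  F t2 - F t1 <= (t2 - t1) * c.
Proof.
move=> bF bG cF cG H t1_gt0; rewrite le_eqVlt => /predU1P[<- _|t12 Gc].
  by rewrite !subrr mul0r.
have t2_gt0 : 0 < t2 by exact: lt_trans t12.
apply/ler_addgt0Pr => e0 e0_gt0.
pose Q := (t2 - t1) + `|c| + 3.
have Q0 : 0 < Q by rewrite /Q; have := normr_ge0 c; lra.
pose e := Num.min 1 (e0 / Q).
have e_gt0 : 0 < e by rewrite lt_min ltr01 divr_gt0.
have e1 : e <= 1 by rewrite ge_min lexx.
have eQ : e * Q <= e0 by rewrite -ler_pdivlMr// ge_min lexx orbT.
clearbody e.
have [d1 d1_gt0 F1] := continuous_right_le e_gt0 (cF _ t1_gt0).
have [d2 d2_gt0 F2] := continuous_right_le e_gt0 (cF _ t2_gt0).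
have [d3 d3_gt0 G3] := continuous_right_le e_gt0 (cG _ t2_gt0).
pose d := Num.min (Num.min d1 d2) (Num.min d3 (Num.min e (t2 - t1))).
have d_gt0 : 0 < d by rewrite !lt_min d1_gt0 d2_gt0 d3_gt0 e_gt0 subr_gt0.
have dd1 : d <= d1 by rewrite !ge_min lexx.
have dd2 : d <= d2 by rewrite !ge_min lexx !orbT.
have dd3 : d <= d3 by rewrite !ge_min lexx !orbT.
have de : d <= e by rewrite !ge_min lexx !orbT.
have dt : d <= t2 - t1 by rewrite !ge_min lexx !orbT.
clearbody d.
pose S s (t : R) := step (d^-1 * t + (- s / d)).
have SE s t : S s t = step ((t - s) / d) by congr step; ring.
have dS s (t : R) : is_derive t 1 (S s) (kern d t s).
  have := step_affine_derive d^-1 (- s / d) t; rewrite -[X in is_derive _ _ _ X]/((fun x => _) t).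
  by rewrite -kernE1.
have sS s : smooth (S s) by apply: smooth_comp; [exact: smooth_step|exact: smooth_affine].
have S0 s t : t <= s -> S s t = 0.
  by move=> ts; rewrite SE step0// pmulr_lle0 ?invr_gt0// subr_le0.
have S1 s t : s + d <= t -> S s t = 1.
  by move=> ts; rewrite SE step1// ler_pdivlMr// mul1r; lra.
pose B t := S t1 t - S t2 t.
have dB (t : R) : is_derive t 1 B (kern d t t1 - kern d t t2).
  by have := is_deriveB (dS t1 t) (dS t2 t).
have dBE : derive1 B = (fun t => kern d t t1 - kern d t t2) by exact: derive1_is_derive.
have B0 t : 0 <= B t.
  rewrite /B; have [tt|tt] := leP t t2.
    by rewrite (S0 t2)// subr0 SE step_ge0.
  by rewrite (S1 t1) ?subr_ge0 ?SE ?step_le1//; lra.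
have Bout t : t <= t1 \/ t2 + d <= t -> B t = 0.
  rewrite /B => -[tt|tt]; first by rewrite !S0 ?subrr//; lra.
  by rewrite !S1 ?subrr//; lra.
have tB : test1 B.
  split.
    have -> : B = (fun t => S t1 t + (-1) * S t2 t) by apply/funext => t; rewrite mulN1r.
    by apply: smoothD => //; apply: smoothM => //; exact: smooth_cst.
  exists (t2 + d) => t; rewrite lter_normr => /orP[tt|tt]; apply: Bout; [right|left]; lra.
have bk s : bcs (fun t => kern d t s) by exact/test1_bcs/test1_kern1.
have ksup s t : kern d t s != 0 -> s <= t <= s + d.
  move=> k0; apply/andP; split; rewrite leNgt; apply: contra k0 => tt;
    by rewrite kern_out// (ltW tt) ?orbT.
have k1 s : I (fun t => kern d t s) = 1 by exact: I_kern1.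
have k0 s t : 0 <= kern d t s by exact: kern_ge0.
have bB : bcs B by exact: test1_bcs.
have := H B t1 tB t1_gt0 _ B0; rewrite dBE.
have -> : (fun t => F t * (kern d t t1 - kern d t t2) + G t * B t) =
   (fun t => F t * kern d t t1 - F t * kern d t t2 + G t * B t).
  by apply/funext => t; ring.
rewrite ID; [|by apply: bcsB; exact: bcsMl|exact: bcsMl].
rewrite IB; [|exact: bcsMl|exact: bcsMl].
move=> /(_ _)/wrap[t tt1|H0]; first by rewrite Bout//; left; exact: ltW.
have I1 : I (fun t => F t * kern d t t1) <= F t1 + e.
  apply: I_average_le => // t /ksup /andP[tt1 tt2].
  apply: (ler_distl_bounds (F1 t _)).1; rewrite tt1 (le_trans tt2)//.
  by rewrite lerD2l.
have I2 : F t2 - e <= I (fun t => F t * kern d t t2).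
  apply: I_average_ge => // t /ksup /andP[tt1 tt2].
  apply: (ler_distl_bounds (F2 t _)).2; rewrite tt1 (le_trans tt2)//.
  by rewrite lerD2l.
have GB : I (fun t => G t * B t) <= (c + e) * I B.
  rewrite -IZ//; apply: I_le; [exact: bcsMl|exact: bcsZ|] => t.
  have [tt1|tt1] := leP t t1; first by rewrite Bout ?mulr0//; left.
  have [tt2|tt2] := leP (t2 + d) t; first by rewrite Bout ?mulr0//; right.
  rewrite ler_wpM2r//; have [tt|tt] := leP t t2.
    by rewrite (le_trans (Gc t _)) ?tt ?(ltW tt1)// lerDl ltW.
  have [] := ler_distl_bounds (G3 t _).
    by rewrite (ltW tt) (le_trans (ltW tt2))// lerD2l.
  move=> Gt _; apply: (le_trans Gt); rewrite lerD2r.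
  by apply: Gc; rewrite lexx (ltW t12).
(* integration by parts evaluates the total mass of B *)
have IBE : I B = I (fun t => t * kern d t t2) - I (fun t => t * kern d t t1).
  have tk s : test1 (fun t => t * kern d t s).
    by apply: test1Ml; [exact: smooth_id|exact: test1_kern1].
  have tBt : test1 (fun t => t * B t) by apply: test1Ml => //; exact: smooth_id.
  have := I_derive_test1 tBt.
  have -> : derive1 (fun t => t * B t) = (fun t => (t * kern d t t1 - t * kern d t t2) + B t).
    apply: derive1_is_derive => t.
    have := is_deriveM (is_derive_id t 1) (dB t); move/is_derive_eq; apply.
    by rewrite /GRing.scale/= mulr1; ring.
  rewrite ID//; last by apply: bcsB; exact: test1_bcs.
  rewrite IB; [|exact: test1_bcs|exact: test1_bcs].
  by move=> /eqP; rewrite addrC addr_eq0 opprB => /eqP.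
have near_norm s t : s <= t -> t <= s + d -> `|t| <= `|s| + d.
  move=> tt1 tt2; rewrite -(subrK s t) (le_trans (ler_normD _ _))// addrC lerD2l.
  by rewrite ger0_norm ?subr_ge0// lerBlDl.
have idk s : s <= I (fun t => t * kern d t s) <= s + d.
  pose w t := t * window (`|s| + d) t.
  have bw : bm w.
    rewrite /w; have [bw _] : bcs w; last exact: bw.
    split; last by exists (`|s| + d) => t; rewrite /w windowE ltNge => /negbTE ->; rewrite mulr0.
    split; first by apply: measurable_funM => //; have [[]] := @bcs_window R (`|s| + d).
    exists (`|s| + d) => t; rewrite /w windowE; case: ifP => tt; rewrite ?mulr1// mulr0 normr0.
    by rewrite addr_ge0// ltW.
  have wE : (fun t => t * kern d t s) = (fun t => w t * kern d t s).
    apply/funext => t; have [->|/ksup/andP[tt1 tt2]] := eqVneq (kern d t s) 0.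
      by rewrite !mulr0.
    rewrite /w windowE ifT ?mulr1//.
    exact: near_norm.
  have wk t : kern d t s != 0 -> w t = t.
    move/ksup/andP => [tt1 tt2]; rewrite /w windowE ifT ?mulr1//.
    exact: near_norm.
  rewrite wE; apply/andP; split.
    by apply: I_average_ge => // t kt; rewrite wk//; have /andP[] := ksup _ _ kt.
  by apply: I_average_le => // t kt; rewrite wk//; have /andP[] := ksup _ _ kt.
have /andP[i1 i2] := idk t1; have /andP[i3 i4] := idk t2.
have cIB : (c + e) * I B <= (c + e) * (t2 - t1) + (`|c| + 1) * d.
  rewrite -lerBlDl -mulrBr.
  have b : `|I B - (t2 - t1)| <= d.
    rewrite IBE ler_norml; apply/andP.
    by split; move: i1 i2 i3 i4; lra_only.
  apply: (le_trans (ler_norm _)); rewrite normrM ler_pM//.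
  by rewrite (le_trans (ler_normD _ _))// lerD2l gtr0_norm.
have : (`|c| + 1) * d <= (`|c| + 1) * e by rewrite ler_wpM2l// addr_ge0.
rewrite /Q in eQ; move: H0 I1 I2 GB cIB eQ; lra_only.
Qed.

(** D is only assumed to satisfy the differential inequality D' <= K D + c
    over short steps and up to an arbitrarily small error: the proof runs the
    explicit Euler scheme. When K is very negative, as under strong damping,
    the initial value is contracted while the source is merely not amplified;
    hence the two different rates. *)
Lemma gronwall (D : R -> R) (a b K c : R) : a <= b -> 0 <= c -> (forall t, 0 <= D t) ->
  (forall e, 0 < e -> exists2 d : R, 0 < d & forall t t', a <= t -> t <= t' -> t' <= b ->
     t' - t < d -> D t' - D t <= (t' - t) * (K * D t + c + e)) ->
  D b <= expR (K * (b - a)) * D a + expR (Num.max K 0 * (b - a)) * ((b - a) * c).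
Proof.
move=> ab c0 D0 H.
pose E := expR (Num.max K 0 * (b - a)).
apply/ler_addgt0Pr => e0 e0_gt0.
pose e := e0 / (E * (b - a) + 1).
have den : 0 < E * (b - a) + 1 by rewrite ltr_wpDl// mulr_ge0 ?expR_ge0 ?subr_ge0.
have e_gt0 : 0 < e by rewrite divr_gt0.
have eE : E * ((b - a) * e) <= e0.
  have : e * (E * (b - a) + 1) = e0 by rewrite /e divfK// gt_eqF.
  by move: e_gt0; clearbody e E; nra.
have [d d_gt0 Hd] := H e e_gt0.
have bad0 : 0 <= (b - a) / d by rewrite divr_ge0 ?subr_ge0 ?(ltW d_gt0).
pose N := (Num.bound ((b - a) / d)).
have NP : (b - a) / d < N%:R by exact: archi_boundP.
have N0 : 0 < N%:R :> R by exact: le_lt_trans NP.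
pose s := (b - a) / N%:R.
have s0 : 0 <= s by rewrite divr_ge0 ?subr_ge0 ?(ltW N0).
have sd : s < d by rewrite /s ltr_pdivrMr// mulrC -ltr_pdivrMr.
have Ns : N%:R * s = b - a by rewrite /s mulrC divfK// gt_eqF.
have step_i (i : nat) : (i <= N)%N ->
    D (a + i%:R * s) <= expR (K * (i%:R * s)) * D a +
      expR (Num.max K 0 * (i%:R * s)) * (i%:R * s * (c + e)).
  elim: i => [_|i ih iN]; first by rewrite !mul0r !mulr0 expR0 mul1r !addr0.
  have {}ih := ih (ltnW iN).
  have iNs : i.+1%:R * s <= b - a by rewrite -Ns ler_wpM2r// ler_nat.
  have is0 : 0 <= i%:R * s by rewrite mulr_ge0.
  have iS : i.+1%:R * s = i%:R * s + s by rewrite -natr1; ring.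
  have := Hd (a + i%:R * s) (a + i.+1%:R * s).
  rewrite iS in iNs *.
  have -> : a + (i%:R * s + s) - (a + i%:R * s) = s by ring.
  move=> /(_ _ _ _ sd)/wrap[|||Di].
  - by rewrite lerDl.
  - by rewrite lerD2l lerDl.
  - by rewrite -lerBrDl.
  set X := i%:R * s in ih Di is0 *.
  have K1 : 1 + K * s <= expR (K * s) by exact: expR_ge1Dx.
  have D1 : D (a + (X + s)) <= expR (K * s) * D (a + X) + s * (c + e).
    by have := ler_wpM2r (D0 (a + X)) K1; move: Di; lra_only.
  apply: (le_trans D1).
  have M1 := ler_wpM2l (expR_ge0 (K * s)) ih.
  have -> : expR (K * (X + s)) = expR (K * s) * expR (K * X) by rewrite -expRD; congr expR; ring.
  rewrite -mulrA; apply: (le_trans (lerD M1 (lexx _))).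
  rewrite mulrDr -addrA lerD2l.
  have -> : expR (Num.max K 0 * (X + s)) = expR (Num.max K 0 * s) * expR (Num.max K 0 * X).
    by rewrite -expRD; congr expR; ring.
  have KM : expR (K * s) <= expR (Num.max K 0 * s).
    by rewrite ler_expR ler_wpM2r// le_max lexx.
  have E1 : 1 <= expR (Num.max K 0 * s).
    by rewrite (le_trans _ (expR_ge1Dx _))// lerDl mulr_ge0// le_max lexx orbT.
  have E2 : 1 <= expR (Num.max K 0 * X).
    by rewrite (le_trans _ (expR_ge1Dx _))// lerDl mulr_ge0// le_max lexx orbT.
  have ce0 : 0 <= c + e by rewrite addr_ge0// ltW.
  rewrite (_ : (X + s) * (c + e) = X * (c + e) + s * (c + e)); last by ring.
  rewrite [leRHS]mulrDr lerD//.
    rewrite [leLHS]mulrA; apply: ler_wpM2r; first exact: mulr_ge0.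
    by apply: ler_wpM2r; [exact: expR_ge0|].
  apply: ler_peMl; first exact: mulr_ge0.
  by apply: (le_trans E1); apply: ler_peMr => //; exact: expR_ge0.
have := step_i N (leqnn N); rewrite Ns.
have -> : a + (b - a) = b by ring.
move/le_trans; apply; rewrite -addrA lerD2l -/E mulrDr mulrDr lerD2l.
exact: eE.
Qed.

End time.

(** * Lipschitz bounds for powers *)

Section power_lipschitz.
Context {R : realType}.
Variables (m M : R).
Hypothesis m1 : 1 < m.

(** The Lipschitz constant of v |-> v^m on [0, M]. *)
Definition lip : R := m * M `^ (m - 1).

Lemma lip_ge0 : 0 <= lip.
Proof. by rewrite mulr_ge0 ?powR_ge0// (le_trans _ (ltW m1)). Qed.

Lemma powR_lip x y : 0 <= y -> y <= x -> x <= M -> x `^ m - y `^ m <= lip * (x - y).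
Proof.
move=> y0 yx xM.
have m10 : 0 <= m - 1 by rewrite subr_ge0 ltW.
have m0 : 0 < m by rewrite (lt_trans _ m1).
have bnd (c : R) : 0 <= c -> c <= M -> c `^ (m - 1) <= M `^ (m - 1).
  by move=> c0 cM; apply: ge0_ler_powR => //; rewrite nnegrE// (le_trans c0).
have [y00|y_gt0] := leP y 0.
  have -> : y = 0 by apply/eqP; rewrite eq_le y00 y0.
  rewrite powR0 ?gt_eqF// !subr0 -(mulr_powRB1 (le_trans y0 yx) m0).
  rewrite mulrC ler_wpM2r ?(le_trans y0 yx)//.
  rewrite (le_trans (bnd _ (le_trans y0 yx) xM))// ler_peMl ?powR_ge0//.
  exact: ltW.
move: yx; rewrite le_eqVlt => /predU1P[->|yx]; first by rewrite !subrr mulr0.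
have D (z : R) : z \in `]y, x[ -> is_derive z 1 (fun t => t `^ m) (m * z `^ (m - 1)).
  rewrite in_itv/= => /andP[yz zx].
  have z0 : 0 < z by exact: lt_trans yz.
  exact: is_derive1_powR.
have C : {within `[y, x], continuous (fun t => t `^ m)}.
  apply: derivable_within_continuous => z; rewrite in_itv/= => /andP[yz zx].
  have z0 : 0 < z by exact: lt_le_trans yz.
  by have := is_derive1_powR m z0; case.
have [c] := MVT yx D C; rewrite in_itv/= => /andP[yc cx] ->.
rewrite ler_wpM2r ?subr_ge0 ?(ltW yx)// ler_wpM2l ?(ltW m0)// bnd//.
  by rewrite (le_trans y0)// ltW.
by rewrite (le_trans (ltW cx)).
Qed.

Lemma powR_lip_pos x y : 0 <= x <= M -> 0 <= y <= M ->
  pos (x `^ m - y `^ m) <= lip * pos (x - y).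
Proof.
move=> /andP[x0 xM] /andP[y0 yM].
have [yx|xy] := leP y x.
  apply: pos_le; first by rewrite mulr_ge0 ?lip_ge0 ?pos_ge0.
  by rewrite (pos_id (x := x - y)) ?subr_ge0//; exact: powR_lip.
rewrite (@pos_eq0 _ (x `^ m - y `^ m)); first by rewrite mulr_ge0 ?lip_ge0 ?pos_ge0.
rewrite subr_le0.
by apply: ge0_ler_powR => //; rewrite ?nnegrE ?(ltW xy)// ltW// (lt_trans _ m1).
Qed.

Lemma powR_lip_norm x y : 0 <= x <= M -> 0 <= y <= M ->
  `|x `^ m - y `^ m| <= lip * `|x - y|.
Proof.
move=> Hx Hy; rewrite !norm_pos !opprB mulrDr.
by rewrite lerD ?powR_lip_pos.
Qed.

End power_lipschitz.

(** * Uniform continuity and the local L1 distance *)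

Section heine.
Context {R : realType}.

(** Stated for a function d of two times that satisfies a triangle inequality,
    so as to cover both real functions and curves t |-> w t with the L^1
    distance on a ball. *)
Lemma heine (d : R -> R -> R) (a b e : R) :
  (forall s t z, d s t <= d s z + d t z) -> 0 < e ->
  (forall t e, a <= t <= b -> 0 < e ->
    exists2 r : R, 0 < r & forall s, `|s - t| < r -> d s t <= e) ->
  exists2 r : R, 0 < r & forall s t, a <= s <= b -> `|t - s| < r -> d s t <= e.
Proof.
move=> tri e0 loc.
have := @segment_compact R a b => /compact_near_coveringP.
move=> /(_ _ (0:R)^'+ (fun r s => forall t, `|t - s| < r -> d s t <= e) _) H.
have {}H : \forall r \near (0:R)^'+, `[a, b]%classic `<=`
    [set s | forall t, `|t - s| < r -> d s t <= e].
  apply: H => t; rewrite /= in_itv/= => tab.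
  have e2 : 0 < e / 2 by rewrite divr_gt0.
  have [r r0 Hr] := loc t _ tab e2.
  have r2 : 0 < r / 2 by rewrite divr_gt0.
  exists (ball t (r / 2), [set q : R | q <= r / 2]) => /=.
    split; first exact: nbhsx_ballx.
    exact: nbhs_right_le.
  move=> [s q] /= [ts qr] z zs.
  rewrite /ball/= in ts.
  apply: (le_trans (tri s z t)); rewrite [e]splitr lerD//; apply: Hr.
    by rewrite distrC (lt_trans ts)// [ltRHS]splitr ltrDl.
  rewrite -(subrK s z) -addrA (le_lt_trans (ler_normD _ _))//.
  by rewrite [r]splitr ltrD// ?(lt_le_trans zs)// distrC.
near (0:R)^'+ => r; exists r => //.
have Hr := near H r => s t sab ts.
have {}Hr : `[a, b]%classic `<=` [set s | forall t, `|t - s| < r -> d s t <= e].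
  by apply: Hr.
by apply: (Hr s) => //=; rewrite in_itv.
Unshelve. all: by end_near.
Qed.

Lemma heine_continuous (g : R -> R) (a b e : R) : continuous g -> 0 < e ->
  exists2 r : R, 0 < r & forall s t, a <= s <= b -> `|t - s| < r -> `|g s - g t| <= e.
Proof.
move=> cg e0; apply: (heine (d := fun s t => `|g s - g t|)) => //.
  by move=> s t z; rewrite (distrC (g t)); exact: ler_distD.
move=> t e' _ e'0; have /cvgrPdist_le/(_ _ e'0)/nbhs_ballP[r/= r0 H] := cg t.
by exists r => // s st; rewrite distrC; apply: H; rewrite /ball/= distrC.
Qed.

End heine.

Section L1_distance.
Context {R : realType}.
Implicit Types f g h : R -> R.

Definition l1 r f g : R := I (fun x => `|f x - g x| * window r x).

Lemma bcs_l1 r f g : bm f -> bm g -> bcs (fun x => `|f x - g x| * window r x).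
Proof.
by move=> bf bg; apply: bcsMl; [apply: bm_norm; exact: bmB|exact: bcs_window].
Qed.

Lemma l1C r f g : l1 r f g = l1 r g f.
Proof. by congr I; apply/funext => x; rewrite distrC. Qed.

Lemma l1xx r f : l1 r f f = 0.
Proof.
rewrite /l1 (_ : (fun x => _) = (fun=> 0)) ?I0//.
by apply/funext => x; rewrite subrr normr0 mul0r.
Qed.

Lemma l1_triangle r f g h : bm f -> bm g -> bm h ->
  l1 r f g <= l1 r f h + l1 r h g.
Proof.
move=> bf bg bh; rewrite /l1 -ID; [|exact: bcs_l1..].
apply: I_le; [exact: bcs_l1|by apply: bcsD; exact: bcs_l1|] => x.
by rewrite -mulrDl ler_wpM2r ?window_ge0// ler_distD.
Qed.

Lemma le_window (r r' x : R) : r <= r' -> window r x <= window r' x.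
Proof.
move=> rr'; rewrite !windowE; case: ifPn => xr; last by case: ifP.
by rewrite ifT// (le_trans xr).
Qed.

Lemma l1_le_radius r r' f g : bm f -> bm g -> r <= r' -> l1 r f g <= l1 r' f g.
Proof.
move=> bf bg rr'; apply: I_le; [exact: bcs_l1..|] => x.
by rewrite ler_wpM2l// le_window.
Qed.

Lemma I_weight_le (f g w z : R -> R) (C r : R) : bm f -> bm g -> bcs w -> bm z ->
  vanish r w -> (forall x, `|w x| <= C) ->
  (forall x, z x <= `|f x - g x|) -> (forall x, 0 <= z x) ->
  I (fun x => z x * w x) <= C * l1 r f g.
Proof.
move=> bf bg bw bz wr wC zfg z0; rewrite -IZ; last exact: bcs_l1.
apply: I_le; [exact: bcsMl|by apply: bcsZ; exact: bcs_l1|] => x.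
have C0 : 0 <= C by exact: le_trans (normr_ge0 _) (wC x).
rewrite windowE; case: ifPn => xr.
  rewrite mulr1 [leRHS]mulrC (@le_trans _ _ (z x * `|w x|))//.
    by rewrite ler_wpM2l// ler_norm.
  by rewrite ler_pM.
by rewrite wr ?ltNge// !mulr0.
Qed.

End L1_distance.

(** * Double integrals *)

Section double_integral.
Context {R : realType}.
Implicit Types f g : R * R -> R.

Definition II f : R := I (fun y => I (fun x => f (x, y))).

Lemma IIE f : bcs2 f -> II f = I (fun x => I (fun y => f (x, y))).
Proof. by move=> bf; rewrite (I_swap bf). Qed.

Lemma bcs2Ml f g : bm f -> bcs2 g -> bcs2 (fun z => f z * g z).
Proof.
move=> bf [bg [L gL]]; split; first exact: bmM.
by exists L => z /gL ->; rewrite mulr0.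
Qed.

Lemma bcs2D f g : bcs2 f -> bcs2 g -> bcs2 (fun z => f z + g z).
Proof.
move=> [bf [L fL]] [bg [L' gL']]; split; first exact: bmD.
exists (Num.max L L') => z; rewrite !gt_max => zL.
have H : (L < `|z.1| \/ L < `|z.2|) /\ (L' < `|z.1| \/ L' < `|z.2|).
  by case: zL => /andP[? ?]; split; [left|left|right|right].
by rewrite fL ?gL' ?addr0//; [exact: H.2|exact: H.1].
Qed.

Lemma bcs2Z c f : bcs2 f -> bcs2 (fun z => c * f z).
Proof. by move=> bf; apply: bcs2Ml => //; exact: bm_cst. Qed.

Lemma bcs2B f g : bcs2 f -> bcs2 g -> bcs2 (fun z => f z - g z).
Proof.
move=> bf bg; have -> : (fun z => f z - g z) = (fun z => f z + (-1) * g z).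
  by apply/funext => z; rewrite mulN1r.
by apply: bcs2D => //; exact: bcs2Z.
Qed.

Lemma IID f g : bcs2 f -> bcs2 g -> II (fun z => f z + g z) = II f + II g.
Proof.
move=> bf bg; rewrite /II -ID; [|exact: bcs2_I2..].
by congr I; apply/funext => y; rewrite ID//; exact: bcs2_section2.
Qed.

Lemma IIZ c f : bcs2 f -> II (fun z => c * f z) = c * II f.
Proof.
move=> bf; rewrite /II -IZ; [|exact: bcs2_I2].
by congr I; apply/funext => y; rewrite IZ//; exact: bcs2_section2.
Qed.

Lemma IIB f g : bcs2 f -> bcs2 g -> II (fun z => f z - g z) = II f - II g.
Proof.
move=> bf bg; rewrite /II -IB; [|exact: bcs2_I2..].
by congr I; apply/funext => y; rewrite IB//; exact: bcs2_section2.
Qed.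

Lemma II_le f g : bcs2 f -> bcs2 g -> (forall z, f z <= g z) -> II f <= II g.
Proof.
move=> bf bg fg; apply: I_le; [exact: bcs2_I2..|] => y.
by apply: I_le => //; exact: bcs2_section2.
Qed.

Lemma II_ge0 f : (forall z, 0 <= f z) -> 0 <= II f.
Proof. by move=> f0; apply: I_ge0 => y; exact: I_ge0. Qed.

Lemma bm_fst (f : R -> R) : bm f -> bm (fun z : R * R => f z.1).
Proof. by apply: bm_comp; exact: measurable_fst. Qed.

Lemma bm_snd (f : R -> R) : bm f -> bm (fun z : R * R => f z.2).
Proof. by apply: bm_comp; exact: measurable_snd. Qed.

Lemma bcs2_tensor (f g : R -> R) : bcs f -> bcs g -> bcs2 (fun z => f z.1 * g z.2).
Proof.
move=> [bf [L fL]] [bg [L' gL']]; split.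
  by apply: bmM; [exact: bm_fst|exact: bm_snd].
exists (Num.max L L') => z; rewrite !gt_max => -[] /andP[zL zL'].
  by rewrite fL// mul0r.
by rewrite gL'// mulr0.
Qed.

Lemma II_tensor (f g : R -> R) : bcs f -> bcs g ->
  II (fun z => f z.1 * g z.2) = I f * I g.
Proof.
move=> bf bg; rewrite /II -IZ//; congr I; apply/funext => y /=.
rewrite -[RHS]mulrC -IZ//; congr I; apply/funext => x; exact: mulrC.
Qed.

End double_integral.

(** * Continuity of translations in the mean *)

Section mollification.
Context {R : realType}.
Local Notation mu := (@lebesgue_measure R).

(** A continuous approximation in L^1 need not be bounded; projecting its
    values onto [-M, M] bounds it and brings it closer to f. *)
Lemma l1_approx_continuous (f : R -> R) (r e : R) : bm f -> 0 < e ->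
  exists g : R -> R, [/\ continuous g, bm g & l1 r f g <= e].
Proof.
move=> bf e0; have [mf [M fM]] := bf.
pose E : set R := `[- r, r]%classic.
have mE : measurable E by exact: measurable_itv.
have finE : (mu E < +oo)%E.
  by rewrite /= lebesgue_measure_itv/=; case: ifPn => // _; rewrite -EFinB ltry.
have intf : mu.-integrable E (EFin \o f).
  apply: measurable_bounded_integrable => //; first exact: measurable_funTS.
  exists M; split; first by rewrite num_real.
  by move=> y My x _ /=; rewrite (le_trans (fM x))// ltW.
have [g_ [cg intg gf]] := approximation_continuous_integrable
  mE finE intf.
have /fine_cvgP[fing /cvgrPdist_le/(_ _ e0) ge] := gf.
near \oo => n.
have ffin : (\int[mu]_(z in E) `|(f z - g_ n z)%:E|)%E \is a fin_num.
  by near: n.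
have le : fine (\int[mu]_(z in E) `|(f z - g_ n z)%:E|)%E <= e.
  have : `|0 - fine (\int[mu]_(z in E) `|(f z - g_ n z)%:E|)%E| <= e by near: n.
  by rewrite sub0r normrN; apply: le_trans; rewrite ler_norm.
pose g x := Num.max (- M) (Num.min M (g_ n x)).
have M0 : 0 <= M by exact: le_trans (normr_ge0 _) (fM 0).
have cmg : continuous g.
  move=> x; apply: (@continuous_max _ _ (cst (- M)) (cst M \min g_ n)).
    exact: cvg_cst.
  by apply: continuous_min; [exact: cvg_cst|exact: cg].
have gM x : `|g x| <= M.
  by rewrite ler_norml le_max lexx/= ge_max ge_min lexx/= andbT (le_trans _ M0)// oppr_le0.
have bg : bm g by split; [exact: continuous_measurable_fun|exists M].
exists g; split => //.
rewrite -lee_fin -(I_EFin (bcs_l1 r bf bg)).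
have : (\int[mu]_(z in E) `|(f z - g_ n z)%:E| <= e%:E)%E.
  by rewrite -(fineK ffin) lee_fin.
apply: le_trans; rewrite [leRHS]integral_mkcond; apply: ge0_le_integral => //=.
- by move=> x _; rewrite lee_fin mulr_ge0 ?window_ge0.
- by apply/measurable_EFinP; have [[]] := bcs_l1 r bf bg.
- apply/(measurable_restrictT _ _).1 => //.
  apply/measurable_funTS/measurable_EFinP.
  apply: (measurableT_comp (f := fun x : R => `|x|)) => //.
  by apply: measurable_funB => //; exact: continuous_measurable_fun.
move=> x _; rewrite patchE windowE; case: ifPn => xr.
  rewrite ifT ?mulr1; last by rewrite /E mem_setE in_itv/= -ler_norml.
  rewrite /= lee_fin /g.
  have := fM x; rewrite ler_norml => /andP[f1 f2].
  case: (leP M (g_ n x)) => gM1.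
    rewrite max_r; last by rewrite lerNl (le_trans _ M0)// oppr_le0.
    by rewrite !ler0_norm ?subr_le0// ?(le_trans f2)// !opprB lerD2r.
  case: (leP (- M) (g_ n x)) => gM2 //.
  rewrite !ger0_norm ?subr_ge0//; first by rewrite lerD2l lerNl opprK ltW.
  by rewrite (le_trans (ltW gM2)).
by rewrite mulr0; case: ifP => //= _; rewrite lee_fin.
Unshelve. all: by end_near.
Qed.

(** A factor supported near the diagonal transfers the compact support in the
    first variable to the second one. *)
Lemma bcs2_near_diagonal (A : R -> R) (k : R * R -> R) (h L : R) :
  bm A -> vanish L A -> bm k -> (forall z, h < `|z.1 - z.2| -> k z = 0) ->
  bcs2 (fun z => A z.1 * k z) /\ (forall z, L + h < `|z.2| -> A z.1 * k z = 0).
Proof.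
move=> bA AL bk kh.
have far z : L + h < `|z.2| -> A z.1 * k z = 0.
  move=> zL; have [z1|z1] := leP `|z.1| L; last by rewrite AL// mul0r.
  rewrite kh ?mulr0//; move: zL.
  rewrite -{1}(subrK z.1 z.2) => /lt_le_trans/(_ (ler_normD _ _)).
  by rewrite distrC; lra.
split => //; split; first by apply: bmM => //; exact: bm_fst.
exists (Num.max L (L + h)) => z; rewrite !gt_max => -[] /andP[zL zL'].
  by rewrite AL// mul0r.
exact: far.
Qed.

Lemma bm_kern (h : R) : 0 < h -> bm (fun z : R * R => kern h z.1 z.2).
Proof.
move=> h0; have [C C0 kC] := @kern_bounded R h h0; split; last first.
  by exists C => z; rewrite ger0_norm ?kern_ge0.
apply: measurable_funM => //.
apply: measurableT_comp.
  apply: continuous_measurable_fun; apply: smooth_continuous.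
  exact: (@test1_mollifier R).1.
by apply: measurable_funM => //; apply: measurable_funB.
Qed.

Lemma bm_kern' (h : R) : 0 < h -> bm (fun z : R * R => kern' h z.1 z.2).
Proof.
move=> h0; have [C C0 kC] := @kern'_bounded R h h0; split; last by exists C.
apply: measurable_funM => //; apply: measurable_funM => //.
apply: (measurableT_comp (f := derive1 (mollifier : R -> R))).
  apply: continuous_measurable_fun; apply: smooth_continuous.
  exact: smooth_derive1 (@test1_mollifier R).1.
by apply: measurable_funM => //; apply: measurable_funB.
Qed.

(** For continuous f this is uniform continuity on the support of psi; the
    general case follows by density, the kernel having mass 1 in each of its
    variables. *)
Lemma mollify_cvg (f psi : R -> R) (L e : R) : bm f -> bcs psi -> 0 <= L ->
  vanish L psi -> (forall x, 0 <= psi x <= 1) -> 0 < e ->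
  exists2 h0 : R, 0 < h0 & forall h, 0 < h -> h < h0 ->
    II (fun z => `|f z.2 - f z.1| * (psi z.1 * kern h z.1 z.2)) <= e.
Proof.
move=> bf bpsi L0 psiL psi01 e0.
pose e' := e / (2 * L + 2).
have den0 : 0 < 2 * L + 2 by rewrite ltr_wpDl// mulr_ge0.
have e'0 : 0 < e' by rewrite divr_gt0.
have eE : e' + e' * (2 * L) + e' = e.
  have : e' * (2 * L + 2) = e by rewrite /e' divfK// gt_eqF.
  by move=> <-; ring.
have [g [cg bg fg]] := l1_approx_continuous (L + 1) bf e'0.
have [r r0 gr] := heine_continuous (- L) L cg e'0.
exists (Num.min 1 r); first by rewrite lt_min ltr01.
move=> h h0; rewrite lt_min => /andP[h1 hr].
have psi0 x : 0 <= psi x by have /andP[] := psi01 x.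
have bk := bm_kern h0.
have kfar (z : R * R) : h < `|z.1 - z.2| -> kern h z.1 z.2 = 0.
  by move=> hz; rewrite kern_far// ltW.
have [bP Pfar] := bcs2_near_diagonal bpsi.1 psiL bk kfar.
have k0 x y : 0 <= kern h x y by exact: kern_ge0.
have P0 z : 0 <= psi z.1 * kern h z.1 z.2 by rewrite mulr_ge0.
pose F1 (z : R * R) := (`|f z.2 - g z.2| * window (L + 1) z.2) * (psi z.1 * kern h z.1 z.2).
pose F2 (z : R * R) := `|g z.2 - g z.1| * (psi z.1 * kern h z.1 z.2).
pose F3 (z : R * R) := `|g z.1 - f z.1| * (psi z.1 * kern h z.1 z.2).
have bfg : bm (fun x => `|f x - g x|) by apply: bm_norm; exact: bmB.
have bgf : bm (fun x => `|g x - f x|) by apply: bm_norm; exact: bmB.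
have b1 : bcs2 F1.
  apply: bcs2Ml => //; apply: (bm_snd (f := fun x => `|f x - g x| * window (L + 1) x)).
  by have [] := bcs_l1 (L + 1) bf bg.
have b2 : bcs2 F2.
  by apply: bcs2Ml => //; apply: bm_norm; apply: bmB; [exact: bm_snd|exact: bm_fst].
have b3 : bcs2 F3 by apply: bcs2Ml => //; exact: (bm_fst bgf).
have b0 : bcs2 (fun z => `|f z.2 - f z.1| * (psi z.1 * kern h z.1 z.2)).
  by apply: bcs2Ml => //; apply: bm_norm; apply: bmB; [exact: bm_snd|exact: bm_fst].
apply: (@le_trans _ _ (II (fun z => F1 z + F2 z + F3 z))).
  apply: II_le => //; first by apply: bcs2D => //; exact: bcs2D.
  move=> z; rewrite /F1 /F2 /F3.
  have [zL|zL] := leP `|z.2| (L + 1); last first.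
    by rewrite Pfar ?mulr0 ?addr0// (lt_trans _ zL)// ltrD2l.
  rewrite windowE zL mulr1 -!mulrDl ler_wpM2r//.
  rewrite (le_trans (ler_distD (g z.1) _ _))// lerD2r.
  exact: ler_distD.
rewrite IID ?IID//; last exact: bcs2D.
rewrite -eE !lerD//.
- apply: le_trans fg; apply: I_le.
  + exact: bcs2_I2.
  + exact: bcs_l1.
  move=> y; rewrite /F1/= IZ; last exact: (bcs2_section2 bP).
  rewrite ler_piMr ?mulr_ge0 ?window_ge0// -(I_kern1 y h0).
  apply: I_le; [exact: (bcs2_section2 bP)|exact/test1_bcs/test1_kern1|] => x.
  by rewrite ler_piMl//; have /andP[] := psi01 x.
- apply: (@le_trans _ _ (II (fun z => e' * (psi z.1 * kern h z.1 z.2)))).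
    apply: II_le => //; first exact: bcs2Z.
    move=> z; rewrite /F2.
    have [zL|zL] := leP `|z.1| L; last by rewrite psiL// mul0r !mulr0.
    have [zh|zh] := ltP `|z.2 - z.1| h; last by rewrite kern_far ?mulr0// distrC.
    rewrite ler_wpM2r// distrC; apply: gr; first by rewrite -ler_norml.
    exact: lt_trans hr.
  rewrite IIZ// ler_wpM2l ?(ltW e'0)// IIE//.
  rewrite (_ : (fun x => _) = psi); last first.
    by apply/funext => x /=; rewrite IZ ?I_kern2 ?mulr1//; exact/test1_bcs/test1_kern2.
  rewrite -[leRHS]mul1r; apply: I_le_bound => // x; by have /andP[] := psi01 x.
- rewrite IIE//; apply: (@le_trans _ _ (I (fun x => `|g x - f x| * psi x))).
    apply: I_le; [exact: bcs2_I1|exact: bcsMl|] => x /=.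
    rewrite /F3/= IZ; last exact: (bcs2_section1 bP).
    by rewrite IZ ?I_kern2 ?mulr1//; exact/test1_bcs/test1_kern2.
  apply: le_trans fg.
  apply: (le_trans (I_weight_le (f := f) (g := g) (C := 1) (r := L + 1) _ _ _ _ _ _ _ _)) => //.
  + by apply: vanishW psiL; rewrite lerDl.
  + by move=> x; rewrite ger0_norm//; have /andP[] := psi01 x.
  + by move=> x; rewrite distrC.
  + by rewrite mul1r.
Qed.

End mollification.

(** * Entropy subsolutions and supersolutions *)

Section semi_solutions.
Context {R : realType}.
Implicit Types (w : R -> R -> R) (A : R -> R).

(** The differential inequality d/dt I((w - k)^+ A) <= I((w^m - k^m)^+ A') -
    beta(k) I((w - k)^+ A), between two times. Instead of the time integral of
    the right-hand side there is a bound c for it on [t, t']; as that side is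
    continuous in time, this loses nothing over short steps. *)
Definition subsol (m : R) (beta : R -> R) w :=
  forall (k : R) A (t t' c : R), 0 <= k -> test1 A -> (forall x, 0 <= A x) ->
  0 < t -> t <= t' ->
  (forall s, t <= s <= t' ->
     I (fun x => pos (w s x `^ m - k `^ m) * derive1 A x)
     - beta k * I (fun x => pos (w s x - k) * A x) <= c) ->
  I (fun x => pos (w t' x - k) * A x) - I (fun x => pos (w t x - k) * A x)
    <= (t' - t) * c.

(** The companion of [subsol] for (k - w)^+. The source gamma(k) bounds the
    damping at the values of w below k, and is charged to the whole mass of A.
    *)
Definition supersol (m : R) (gamma : R -> R) w :=
  forall (k : R) A (t t' c : R), 0 <= k -> test1 A -> (forall x, 0 <= A x) ->
  0 < t -> t <= t' ->
  (forall s, t <= s <= t' ->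
     I (fun x => pos (k `^ m - w s x `^ m) * derive1 A x) + gamma k * I A <= c) ->
  I (fun x => pos (k - w t' x) * A x) - I (fun x => pos (k - w t x) * A x)
    <= (t' - t) * c.

Definition l1cont w := forall t r e : R, 0 < t -> 0 < e ->
  exists2 d : R, 0 < d & forall s, `|s - t| < d -> l1 r (w s) (w t) <= e.

Definition flow (M : R) w :=
  [/\ forall t, bm (w t), forall t x, 0 <= w t x <= M & l1cont w].

Lemma flow_uniform M w (a b r e : R) : flow M w -> 0 < a -> 0 < e ->
  exists2 d : R, 0 < d & forall s t, a <= s <= b -> `|t - s| < d ->
    l1 r (w s) (w t) <= e.
Proof.
move=> [bw _ cw] a0 e0.
apply: (heine (d := fun s t => l1 r (w s) (w t))) => //.
  by move=> s t z; rewrite (l1C r (w t)); exact: l1_triangle.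
move=> t e' /andP[at_ _] e'0; apply: cw => //; exact: lt_le_trans at_.
Qed.

End semi_solutions.

(** * Doubling the space variable *)

Section doubling.
Context {R : realType}.
Variables (m M : R) (psi : R -> R) (L h : R).
Hypotheses (m1 : 1 < m) (L0 : 0 <= L) (h0 : 0 < h).
Hypotheses (tpsi : test1 psi) (psi01 : forall x, 0 <= psi x <= 1).
Hypothesis psiL : vanish L psi.

Let K := lip m M.
Let K0 : 0 <= K. Proof. exact: lip_ge0. Qed.
Let m0 : 0 <= m. Proof. by rewrite ltW// (lt_trans _ m1). Qed.

Let psi0 x : 0 <= psi x. Proof. by have /andP[] := psi01 x. Qed.

(** The doubled weight psi(x) k(x - y); [Phi_x] and [Phi_y] are its partial
    derivatives. Since the kernel depends on x - y only, the derivatives of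
    the kernel, of order h^-2, cancel in their sum psi'(x) k(x - y). *)
Definition Phi (z : R * R) := psi z.1 * kern h z.1 z.2.
Definition Phi_y (z : R * R) := - (psi z.1 * kern' h z.1 z.2).
Definition Phi_x (z : R * R) := derive1 psi z.1 * kern h z.1 z.2 - Phi_y z.

Lemma Phi_ge0 z : 0 <= Phi z.
Proof. by rewrite mulr_ge0// kern_ge0. Qed.

Let dpsiL : vanish L (derive1 psi).
Proof. by apply: derive1_vanishing => //; exact: tpsi.1. Qed.

Let kfar (z : R * R) : h < `|z.1 - z.2| -> kern h z.1 z.2 = 0.
Proof. by move=> hz; rewrite kern_far// ltW. Qed.

Let k'far (z : R * R) : h < `|z.1 - z.2| -> kern' h z.1 z.2 = 0.
Proof. by move=> hz; rewrite kern'_far. Qed.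

Lemma bcs2_Phi : bcs2 Phi.
Proof. exact: (bcs2_near_diagonal (test1_bcs tpsi).1 psiL (bm_kern h0) kfar).1. Qed.

Lemma bcs2_Phi_y : bcs2 Phi_y.
Proof.
have [b _] := bcs2_near_diagonal (test1_bcs tpsi).1 psiL (bm_kern' h0) k'far.
have := bcs2Z (-1) b; congr bcs2; apply/funext => z; exact: mulN1r.
Qed.

Lemma bcs2_dpsi : bcs2 (fun z => derive1 psi z.1 * kern h z.1 z.2).
Proof.
exact: (bcs2_near_diagonal (test1_bcs (test1_derive1 tpsi)).1 dpsiL (bm_kern h0) kfar).1.
Qed.

Lemma bcs2_Phi_x : bcs2 Phi_x.
Proof. by apply: bcs2B; [exact: bcs2_dpsi|exact: bcs2_Phi_y]. Qed.

Lemma Phi_y_far z : L < `|z.1| \/ L + h < `|z.2| -> Phi_y z = 0.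
Proof.
move=> [zL|zL]; first by rewrite /Phi_y psiL// mul0r oppr0.
rewrite /Phi_y.
by rewrite (bcs2_near_diagonal (test1_bcs tpsi).1 psiL (bm_kern' h0) k'far).2// oppr0.
Qed.

Lemma Phi_x_far z : L < `|z.1| \/ L + h < `|z.2| -> Phi_x z = 0.
Proof.
move=> H; rewrite /Phi_x Phi_y_far// subr0; case: H => zL; first by rewrite dpsiL// mul0r.
exact: (bcs2_near_diagonal (test1_bcs (test1_derive1 tpsi)).1 dpsiL (bm_kern h0) kfar).2.
Qed.

Lemma test1_Phi1 y : test1 (fun x => Phi (x, y)).
Proof. by apply: test1Ml; [exact: tpsi.1|exact: test1_kern1]. Qed.

Lemma test1_Phi2 x : test1 (fun y => Phi (x, y)).
Proof. by apply: (test1Ml (smooth_cst (psi x))); exact: test1_kern2. Qed.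

Lemma derive1_Phi1 y : derive1 (fun x => Phi (x, y)) = (fun x => Phi_x (x, y)).
Proof.
apply: derive1_is_derive => x.
have := is_deriveM (smooth_is_derive tpsi.1 x) (kern_derive1 h x y).
move/is_derive_eq; apply; rewrite /Phi_x /Phi_y /GRing.scale/=; ring.
Qed.

Lemma derive1_Phi2 x : derive1 (fun y => Phi (x, y)) = (fun y => Phi_y (x, y)).
Proof.
apply: derive1_is_derive => y.
have := is_deriveM (is_derive_cst (psi x) y 1) (kern_derive2 h x y).
move/is_derive_eq; apply; rewrite /Phi_y /GRing.scale/=; ring.
Qed.

Lemma Phi_bound : exists2 C : R, 0 <= C &
  forall z, `|Phi_x z| <= C /\ `|Phi_y z| <= C.
Proof.
have [[_ [C1 H1]] _] := bcs2_Phi_x; have [[_ [C2 H2]] _] := bcs2_Phi_y.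
have C10 : 0 <= C1 by exact: le_trans (normr_ge0 _) (H1 (0, 0)).
have C20 : 0 <= C2 by exact: le_trans (normr_ge0 _) (H2 (0, 0)).
exists (C1 + C2); first exact: addr_ge0.
move=> z; split; [apply: le_trans (H1 z) _|apply: le_trans (H2 z) _].
  by rewrite lerDl.
by rewrite lerDr.
Qed.

(** The approximation at scale h of the integral of (f - g)^+ psi. *)
Definition gap (f g : R -> R) := II (fun z => pos (f z.1 - g z.2) * Phi z).
Definition flux (f g : R -> R) (F : R * R -> R) :=
  II (fun z => pos (f z.1 `^ m - g z.2 `^ m) * F z).

Let bm_gap (f g : R -> R) : bm f -> bm g -> bm (fun z : R * R => pos (f z.1 - g z.2)).
Proof. by move=> bf bg; apply: bm_pos; apply: bmB; [exact: bm_fst|exact: bm_snd]. Qed.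

Let bm_flux (f g : R -> R) : bm f -> bm g -> (forall x, 0 <= f x) -> (forall x, 0 <= g x) ->
  bm (fun z : R * R => pos (f z.1 `^ m - g z.2 `^ m)).
Proof.
move=> bf bg f0 g0; apply: bm_pos; apply: bmB; apply: bm_powR => //.
  exact: bm_fst.
exact: bm_snd.
Qed.

(** Over a short time step this allows the flux to be frozen at the initial
    time, at the price of the oscillation of the solution in L^1. *)
Lemma flux_lip (f g : R -> R) (w : R -> R) (C r eta : R) (k : R) :
  bm f -> bm g -> (forall x, 0 <= f x <= M) -> (forall x, 0 <= g x <= M) ->
  bcs w -> vanish r w -> (forall x, `|w x| <= C) -> l1 r f g <= eta ->
  I (fun x => pos (f x `^ m - k) * w x) <=
    I (fun x => pos (g x `^ m - k) * w x) + C * K * eta /\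
  I (fun x => pos (k - f x `^ m) * w x) <=
    I (fun x => pos (k - g x `^ m) * w x) + C * K * eta.
Proof.
move=> bf bg fM gM bw wr wC fg.
have f0 x : 0 <= f x by have /andP[] := fM x.
have g0 x : 0 <= g x by have /andP[] := gM x.
have C0 : 0 <= C by exact: le_trans (normr_ge0 _) (wC 0).
have bfm : bm (fun x => f x `^ m) by exact: bm_powR.
have bgm : bm (fun x => g x `^ m) by exact: bm_powR.
have bk : bm (fun _ : R => k) by exact: bm_cst.
have gen (p q : R -> R) : bm p -> bm q -> (forall x, `|p x - q x| <= K * `|f x - g x|) ->
  I (fun x => p x * w x) <= I (fun x => q x * w x) + C * K * eta.
  move=> bp bq pq; rewrite -lerBlDl -IB; [|exact: bcsMl..].
  apply: (@le_trans _ _ (I (fun x => C * K * (`|f x - g x| * window r x)))).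
    apply: I_le; [by apply: bcsB; exact: bcsMl|by apply: bcsZ; exact: bcs_l1|] => x.
    rewrite -mulrBl; apply: (le_trans (ler_norm _)); rewrite normrM windowE.
    case: ifPn => xr; last by rewrite wr ?normr0 ?mulr0// ltNge.
    by rewrite mulr1 (mulrC C) mulrAC ler_pM.
  by rewrite IZ; [rewrite ler_wpM2l// mulr_ge0|exact: bcs_l1].
split; apply: gen => //; try by apply: bm_pos; exact: bmB.
  move=> x; apply: (le_trans (posB_norm _ _)).
  by rewrite opprB addrA subrK powR_lip_norm.
move=> x; apply: (le_trans (posB_norm _ _)).
rewrite opprB addrC addrA subrK distrC powR_lip_norm//.
Qed.

(** For fixed y the number g(y) is a constant level, and the subsolution
    property for it is integrated in y. *)
Lemma gap_sub (a : R -> R -> R) (g : R -> R) (beta : R -> R) (C t t' eta : R) :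
  flow M a -> subsol m beta a -> (forall k, 0 <= k -> 0 <= beta k) ->
  bm g -> (forall x, 0 <= g x) -> (forall z, `|Phi_x z| <= C) ->
  0 < t -> t <= t' -> (forall s, t <= s <= t' -> l1 L (a s) (a t) <= eta) ->
  gap (a t') g - gap (a t) g <=
    (t' - t) * (flux (a t) g Phi_x + C * K * eta * (2 * (L + h))).
Proof.
move=> [ba aM ca] suba beta0 bg g0 PC t0 tt' eta_a.
have a0 s x : 0 <= a s x by have /andP[] := aM s x.
have C0 : 0 <= C by exact: le_trans (normr_ge0 _) (PC (0, 0)).
have Lh : 0 <= L + h by rewrite addr_ge0// ltW.
have bE s : bcs2 (fun z => pos (a s z.1 - g z.2) * Phi z).
  by apply: bcs2Ml; [exact: bm_gap|exact: bcs2_Phi].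
have bF : bcs2 (fun z => pos (a t z.1 `^ m - g z.2 `^ m) * Phi_x z).
  by apply: bcs2Ml; [apply: bm_flux|exact: bcs2_Phi_x].
have main y : I (fun x => pos (a t' x - g y) * Phi (x, y)) -
    I (fun x => pos (a t x - g y) * Phi (x, y)) <= (t' - t) *
    (I (fun x => pos (a t x `^ m - g y `^ m) * Phi_x (x, y)) + C * K * eta * window (L + h) y).
  apply: (suba (g y) (fun x => Phi (x, y))) => //; first exact: test1_Phi1.
    by move=> x; exact: Phi_ge0.
  move=> s ts; rewrite derive1_Phi1.
  rewrite lerBlDr ler_wpDr//.
    rewrite mulr_ge0 ?beta0//; apply: I_ge0 => x.
    by rewrite mulr_ge0 ?pos_ge0 ?Phi_ge0.
  rewrite windowE; case: ifPn => yL.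
    have vw : vanish L (fun x => Phi_x (x, y)) by move=> x xL; rewrite Phi_x_far//; left.
    rewrite mulr1; exact: (flux_lip _ (ba s) (ba t) (aM s) (aM t)
      (bcs2_section2 bcs2_Phi_x y) vw (fun x => PC (x, y)) (eta_a _ ts)).1.
  rewrite mulr0 addr0 le_eqVlt; apply/orP; left; apply/eqP; congr I; apply/funext => x.
  by rewrite Phi_x_far ?mulr0//; right; rewrite ltNge.
rewrite /gap /flux -IIB//.
rewrite -(I_window Lh) -IZ; last exact: bcs_window.
rewrite /II -ID; [|exact: (bcs2_I2 bF)|exact/bcsZ/bcs_window].
rewrite -IZ; last by apply: bcsD; [exact: (bcs2_I2 bF)|exact/bcsZ/bcs_window].
apply: I_le.
- exact: (bcs2_I2 (bcs2B (bE t') (bE t))).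
- by apply: bcsZ; apply: bcsD; [exact: (bcs2_I2 bF)|exact/bcsZ/bcs_window].
move=> y; rewrite IB; [exact: main|exact: (bcs2_section2 (bE _))..].
Qed.

(** Symmetric to [gap_sub], with the levels f(x). The weight has mass psi(x)
    <= 1 in y, so that the source contributes at most c for every x in the
    support. *)
Lemma gap_super (b : R -> R -> R) (f : R -> R) (gamma : R -> R) (C c kappa t t' eta : R) :
  flow M b -> supersol m gamma b -> 0 <= c ->
  (forall k, 0 <= k <= kappa -> gamma k <= c) ->
  bm f -> (forall x, 0 <= f x <= kappa) -> (forall z, `|Phi_y z| <= C) ->
  0 < t -> t <= t' -> (forall s, t <= s <= t' -> l1 (L + h) (b s) (b t) <= eta) ->
  gap f (b t') - gap f (b t) <=
    (t' - t) * (flux f (b t) Phi_y + (C * K * eta + c) * (2 * L)).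
Proof.
move=> [bb bM cb] superb c0 gammac bf fk PC t0 tt' eta_b.
have f0 x : 0 <= f x by have /andP[] := fk x.
have b0 s x : 0 <= b s x by have /andP[] := bM s x.
have C0 : 0 <= C by exact: le_trans (normr_ge0 _) (PC (0, 0)).
have bE s : bcs2 (fun z => pos (f z.1 - b s z.2) * Phi z).
  by apply: bcs2Ml; [exact: bm_gap|exact: bcs2_Phi].
have bF : bcs2 (fun z => pos (f z.1 `^ m - b t z.2 `^ m) * Phi_y z).
  by apply: bcs2Ml; [apply: bm_flux|exact: bcs2_Phi_y].
have main x : I (fun y => pos (f x - b t' y) * Phi (x, y)) -
    I (fun y => pos (f x - b t y) * Phi (x, y)) <= (t' - t) *
    (I (fun y => pos (f x `^ m - b t y `^ m) * Phi_y (x, y)) + (C * K * eta + c) * window L x).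
  apply: (superb (f x) (fun y => Phi (x, y))) => //; first exact: test1_Phi2.
    by move=> y; exact: Phi_ge0.
  move=> s ts; rewrite derive1_Phi2.
  rewrite windowE; case: ifPn => xL.
    rewrite mulr1 addrA; apply: lerD.
      have vw : vanish (L + h) (fun y => Phi_y (x, y)).
        by move=> y yL; rewrite Phi_y_far//; right.
      exact: (flux_lip _ (bb s) (bb t) (bM s) (bM t)
        (bcs2_section1 bcs2_Phi_y x) vw (fun y => PC (x, y)) (eta_b _ ts)).2.
    have -> : I (fun y => Phi (x, y)) = psi x.
      by rewrite /Phi/= IZ ?I_kern2 ?mulr1//; exact/test1_bcs/test1_kern2.
    rewrite (le_trans (ler_wpM2r _ (gammac _ (fk x))))//.
    by rewrite ler_piMr//; have /andP[] := psi01 x.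
  have xL' : L < `|x| by rewrite ltNge.
  have -> : (fun y => Phi (x, y)) = (fun=> 0).
    by apply/funext => y; rewrite /Phi psiL// mul0r.
  rewrite I0 !mulr0 !addr0.
  rewrite le_eqVlt; apply/orP; left; apply/eqP; congr I; apply/funext => y.
  by rewrite Phi_y_far ?mulr0//; left.
rewrite /gap /flux -IIB//.
rewrite -(I_window L0) -IZ; last exact: bcs_window.
rewrite !IIE//; last exact: bcs2B.
rewrite -ID; [|exact: (bcs2_I1 bF)|exact/bcsZ/bcs_window].
rewrite -IZ; last by apply: bcsD; [exact: (bcs2_I1 bF)|exact/bcsZ/bcs_window].
apply: I_le.
- exact: (bcs2_I1 (bcs2B (bE t') (bE t))).
- by apply: bcsZ; apply: bcsD; [exact: (bcs2_I1 bF)|exact/bcsZ/bcs_window].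
move=> x; rewrite IB; [exact: main|exact: (bcs2_section1 (bE _))..].
Qed.

(** The two fluxes are the same function of (x, y), so that only Phi_x + Phi_y
    remains, free of the derivatives of the kernel. *)
Lemma flux_sum (f g : R -> R) (e : R) : bm f -> bm g ->
  (forall x, 0 <= f x <= M) -> (forall x, 0 <= g x <= M) -> 0 <= e ->
  (forall x, `|derive1 psi x| <= psi x + e) ->
  flux f g Phi_x + flux f g Phi_y <= K * gap f g + K * M * e * (2 * L).
Proof.
move=> bf bg fM gM e0 dpsi.
have f0 x : 0 <= f x by have /andP[] := fM x.
have g0 x : 0 <= g x by have /andP[] := gM x.
have M0 : 0 <= M by have /andP[f0M fM0] := fM 0; exact: le_trans fM0.
have bfl := bm_flux bf bg f0 g0.
have bx := bcs2Ml bfl bcs2_Phi_x; have by_ := bcs2Ml bfl bcs2_Phi_y.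
have bE := bcs2Ml (bm_gap bf bg) bcs2_Phi.
have bwk : bcs2 (fun z => window L z.1 * kern h z.1 z.2).
  apply: (bcs2_near_diagonal (L := L) (h := h) _ _ (bm_kern h0) kfar).1.
    by have [] := @bcs_window R L.
  by move=> x xL; rewrite windowE ifF//; apply/negbTE; rewrite -ltNge.
rewrite /flux /gap -IID//.
have -> : K * M * e * (2 * L) = II (fun z => K * M * e * (window L z.1 * kern h z.1 z.2)).
  rewrite IIZ// IIE// -I_window//; congr (_ * _); congr I; apply/funext => x /=.
  by rewrite IZ ?I_kern2 ?mulr1//; exact/test1_bcs/test1_kern2.
rewrite -IIZ// -IID; [|exact: bcs2Z..].
apply: II_le; [exact: bcs2D|by apply: bcs2D; exact: bcs2Z|] => z.
rewrite -mulrDr /Phi_x subrK.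
set p := pos _; have p0 : 0 <= p by exact: pos_ge0.
have k0 : 0 <= kern h z.1 z.2 by exact: kern_ge0.
have pK : p <= K * pos (f z.1 - g z.2) by exact: powR_lip_pos.
have q0 : 0 <= pos (f z.1 - g z.2) by exact: pos_ge0.
have qM : pos (f z.1 - g z.2) <= M.
  have /andP[_ fzM] := fM z.1; have gz := g0 z.2.
  by rewrite pos_le// (le_trans _ fzM)// gerDl oppr_le0.
rewrite windowE; case: ifPn => zL; last first.
  rewrite dpsiL ?ltNge// !(mul0r, mulr0) addr0.
  by do 2 (apply: mulr_ge0 => //); exact: Phi_ge0.
rewrite mul1r /Phi; move: (kern h z.1 z.2) k0 => k k0.
rewrite !mulrA -mulrDl ler_wpM2r//.
apply: (@le_trans _ _ (p * (psi z.1 + e))).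
  by rewrite ler_wpM2l// (le_trans _ (dpsi _))// ler_norm.
rewrite mulrDr lerD//; first by rewrite ler_wpM2r.
by rewrite ler_wpM2r// (le_trans pK)// ler_wpM2l.
Qed.

End doubling.

(** * Comparison *)

(** Collects the errors of one time step in [gap_gronwall]. *)
Lemma doubling_budget (R : realType) (F1 F2 F3 X g N c L h e : R) :
  F1 <= F2 + X * (2 * L) -> F2 + F3 <= g + N * (2 * L) ->
  X * (2 * (L + h)) + X * (2 * L) + X * (2 * L) <= e ->
  F1 + X * (2 * (L + h)) + (F3 + (X + c) * (2 * L)) <= g + (N + c) * (2 * L) + e.
Proof. move=> *; lra. Qed.

(** Collects the errors in [initial_layer]. *)
Lemma layer_budget (R : realType) (X g g0 g1 d e : R) :
  d <= e / 4 -> g0 <= g1 + e / 4 -> g1 <= e / 4 -> g - g0 <= X -> X <= e / 4 ->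
  g + d <= e.
Proof. move=> *; lra. Qed.

Section comparison.
Context {R : realType}.
Variables (m M : R) (psi : R -> R) (L : R).
Hypotheses (m1 : 1 < m) (L0 : 0 <= L).
Hypotheses (tpsi : test1 psi) (psi01 : forall x, 0 <= psi x <= 1).
Hypothesis psiL : vanish L psi.

Let K := lip m M.
Let K0 : 0 <= K. Proof. exact: lip_ge0. Qed.
Let psi0 x : 0 <= psi x. Proof. by have /andP[] := psi01 x. Qed.

(** The two arguments of the gap are advanced one after the other, so that the
    flux in x is met with b already at the new time. *)
Lemma flux_lip_snd (h C eta : R) (f g g' : R -> R) : 0 < h ->
  bm f -> bm g -> bm g' -> (forall x, 0 <= f x) -> (forall x, 0 <= g x <= M) ->
  (forall x, 0 <= g' x <= M) -> (forall z, `|Phi_x psi h z| <= C) ->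
  l1 (L + h) g' g <= eta ->
  flux m f g' (Phi_x psi h) <= flux m f g (Phi_x psi h) + C * K * eta * (2 * L).
Proof.
move=> h0 bf bg bg' f0 gM g'M PC gg.
have m0 : 0 <= m by rewrite ltW// (lt_trans _ m1).
have g0 x : 0 <= g x by have /andP[] := gM x.
have g'0 x : 0 <= g' x by have /andP[] := g'M x.
have bP := bcs2_Phi_x h0 tpsi psiL.
have bfl (q : R -> R) : bm q -> (forall x, 0 <= q x) ->
    bcs2 (fun z => pos (f z.1 `^ m - q z.2 `^ m) * Phi_x psi h z).
  move=> bq q0; apply: bcs2Ml => //; apply: bm_pos; apply: bmB; apply: bm_powR => //.
    exact: bm_fst.
  exact: bm_snd.
have b1 := bfl _ bg g0; have b2 := bfl _ bg' g'0.
rewrite /flux -(I_window L0) -IZ; last exact: bcs_window.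
rewrite !IIE// -ID; [|exact: (bcs2_I1 b1)|exact/bcsZ/bcs_window].
apply: I_le; [exact: (bcs2_I1 b2)|apply: bcsD; [exact: (bcs2_I1 b1)|exact/bcsZ/bcs_window]|].
move=> x /=; rewrite windowE; case: ifPn => xL.
  have vw : vanish (L + h) (fun y => Phi_x psi h (x, y)).
    by move=> y yL; rewrite (Phi_x_far h0 tpsi psiL)//; right.
  rewrite mulr1; exact: (flux_lip m1 _ bg' bg g'M gM
    (bcs2_section1 bP x) vw (fun y => PC (x, y)) gg).2.
rewrite mulr0 addr0 le_eqVlt; apply/orP; left; apply/eqP; congr I; apply/funext => y.
by rewrite (Phi_x_far h0 tpsi psiL) ?mulr0//; left; rewrite ltNge.
Qed.

Lemma II_Phi_fst (h : R) (p : R -> R) : 0 < h -> bm p ->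
  II (fun z => p z.1 * Phi psi h z) = I (fun x => p x * psi x).
Proof.
move=> h0 bp; have bP := bcs2_Phi h0 tpsi psiL.
have b2 : bcs2 (fun z => p z.1 * Phi psi h z) by apply: bcs2Ml => //; exact: bm_fst.
rewrite IIE//; congr I; apply/funext => x /=.
rewrite IZ; last exact: (bcs2_section1 bP).
by rewrite /Phi/= IZ ?I_kern2 ?mulr1//; exact/test1_bcs/test1_kern2.
Qed.

(** Replacing g(y) by g(x) costs the mean oscillation of g at scale h. *)
Lemma gap_approx (h : R) (f g : R -> R) : 0 < h -> bm f -> bm g ->
  gap psi h f g <= I (fun x => pos (f x - g x) * psi x) +
    II (fun z => `|g z.2 - g z.1| * Phi psi h z) /\
  I (fun x => pos (f x - g x) * psi x) <= gap psi h f g +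
    II (fun z => `|g z.2 - g z.1| * Phi psi h z).
Proof.
move=> h0 bf bg.
have bP := bcs2_Phi h0 tpsi psiL.
have bd : bcs2 (fun z => `|g z.2 - g z.1| * Phi psi h z).
  by apply: bcs2Ml => //; apply: bm_norm; apply: bmB; [exact: bm_snd|exact: bm_fst].
have b1 : bm (fun x => pos (f x - g x)) by apply: bm_pos; exact: bmB.
have b2 : bcs2 (fun z => pos (f z.1 - g z.2) * Phi psi h z).
  by apply: bcs2Ml => //; apply: bm_pos; apply: bmB; [exact: bm_fst|exact: bm_snd].
have b3 : bcs2 (fun z => pos (f z.1 - g z.1) * Phi psi h z).
  by apply: bcs2Ml => //; exact: (bm_fst b1).
rewrite -(II_Phi_fst h0 b1) /gap -(IID b3 bd) -(IID b2 bd).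
have P0 z : 0 <= Phi psi h z by exact: Phi_ge0.
have d (z : R * R) : pos (f z.1 - g z.2) <= pos (f z.1 - g z.1) + `|g z.2 - g z.1|.
  rewrite (_ : f z.1 - g z.2 = (f z.1 - g z.1) + (g z.1 - g z.2)); last by ring.
  by rewrite (le_trans (posD_le _ _))// lerD2l distrC pos_norm.
have d' (z : R * R) : pos (f z.1 - g z.1) <= pos (f z.1 - g z.2) + `|g z.2 - g z.1|.
  rewrite (_ : f z.1 - g z.1 = (f z.1 - g z.2) + (g z.2 - g z.1)); last by ring.
  by rewrite (le_trans (posD_le _ _))// lerD2l pos_norm.
by split; apply: II_le => //; try exact: bcs2D; move=> z;
  rewrite -mulrDl ler_wpM2r.
Qed.

(** A time step is split into one of a with b fixed and one of b with a fixed.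
    The oscillation of a and b during the step is multiplied by a bound for
    Phi_x and Phi_y, large but independent of the step: it is made negligible
    by shortening the step. *)
Lemma gap_gronwall (h : R) (a b : R -> R -> R) (beta gamma : R -> R) (c kappa e s t : R) :
  0 < h -> flow M a -> flow M b ->
  subsol m beta a -> (forall k, 0 <= k -> 0 <= beta k) ->
  supersol m gamma b -> 0 <= c -> (forall k, 0 <= k <= kappa -> gamma k <= c) ->
  (forall s x, a s x <= kappa) ->
  0 <= e -> (forall x, `|derive1 psi x| <= psi x + e) ->
  0 < s -> s <= t ->
  gap psi h (a t) (b t) <= expR (K * (t - s)) * (gap psi h (a s) (b s) +
    (t - s) * ((K * M * e + c) * (2 * L))).
Proof.
move=> h0 fa fb suba beta0 superb c0 gammac ak e0 dpsi s0 st.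
have [ba aM ca] := fa; have [bb bM cb] := fb.
have a0 r x : 0 <= a r x by have /andP[] := aM r x.
have b0 r x : 0 <= b r x by have /andP[] := bM r x.
have M0 : 0 <= M by have /andP[x1 x2] := aM 0 0; exact: le_trans x2.
have [C C0 PC] := Phi_bound h0 tpsi psiL.
pose D r := gap psi h (a r) (b r).
have D0 r : 0 <= D r.
  by apply: II_ge0 => z; rewrite mulr_ge0 ?pos_ge0 ?Phi_ge0.
have cc0 : 0 <= (K * M * e + c) * (2 * L).
  apply: mulr_ge0; last exact: mulr_ge0.
  by apply: addr_ge0 => //; do 2 (apply: mulr_ge0 => //).
have Lh : 0 < L + h by rewrite ltr_wpDl.
have := @gronwall R D s t K _ st cc0 D0.
rewrite (max_l K0) -(mulrDr (expR _)) => G; apply: G => e1 e1_gt0.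
pose eta := e1 / (C * K * (6 * (L + h)) + 1).
have den : 0 < C * K * (6 * (L + h)) + 1.
  by apply: ltr_wpDl => //; apply: mulr_ge0; apply: mulr_ge0 => //; exact: ltW.
have eta0 : 0 < eta by rewrite divr_gt0.
have etaE : C * K * eta * (2 * (L + h)) + C * K * eta * (2 * L) + C * K * eta * (2 * L) <= e1.
  have E1 : eta * (C * K * (6 * (L + h)) + 1) = e1 by rewrite /eta divfK// gt_eqF.
  have CKh : 0 <= C * K * eta * h.
    exact: mulr_ge0 (mulr_ge0 (mulr_ge0 C0 K0) (ltW eta0)) (ltW h0).
  rewrite -[leRHS]E1 -subr_ge0.
  rewrite (_ : _ - _ = 4 * (C * K * eta * h) + eta); last by ring.
  by apply: addr_ge0; [exact: mulr_ge0|exact: ltW].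
have [d1 d1_gt0 H1] := flow_uniform t L fa s0 eta0.
have [d2 d2_gt0 H2] := flow_uniform t (L + h) fb s0 eta0.
exists (Num.min d1 d2); first by rewrite lt_min d1_gt0.
move=> r r' sr rr' r't; rewrite lt_min => /andP[rd1 rd2].
have r0 : 0 < r by exact: lt_le_trans sr.
have near_a q : r <= q <= r' -> l1 L (a q) (a r) <= eta.
  move=> /andP[rq qr']; rewrite l1C; apply: H1.
    by rewrite sr (le_trans rr').
  by rewrite ger0_norm ?subr_ge0// (le_lt_trans _ rd1)// lerD2r.
have near_b q : r <= q <= r' -> l1 (L + h) (b q) (b r) <= eta.
  move=> /andP[rq qr']; rewrite l1C; apply: H2.
    by rewrite sr (le_trans rr').
  by rewrite ger0_norm ?subr_ge0// (le_lt_trans _ rd2)// lerD2r.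
have ra : forall x, 0 <= a r x <= kappa by move=> x; rewrite a0 ak.
have S1 := gap_sub m1 L0 h0 tpsi psi01 psiL fa suba beta0 (bb r') (b0 r')
  (fun z => (PC z).1) r0 rr' near_a.
have S2 := gap_super m1 L0 h0 tpsi psi01 psiL fb superb c0 gammac (ba r) ra
  (fun z => (PC z).2) r0 rr' near_b.
have r'r : r <= r' <= r' by rewrite rr' lexx.
have S3 := flux_lip_snd h0 (ba r) (bb r) (bb r') (a0 r) (bM r) (bM r')
  (fun z => (PC z).1) (near_b _ r'r).
have S4 := flux_sum m1 L0 h0 tpsi psi01 psiL (ba r) (bb r) (aM r) (bM r) e0 dpsi.
have chain (y x z : R) : x - z = (x - y) + (y - z) by ring.
rewrite /D (chain (gap psi h (a r) (b r'))).
apply: (le_trans (lerD S1 S2)); rewrite -mulrDr ler_wpM2l ?subr_ge0//.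
rewrite -/K in S3 S4 *.
exact: doubling_budget S3 S4 etaE.
Qed.

(** The limit h -> 0 of [gap_gronwall], whose constants do not depend on h.
    The oscillation of b at scale h has to be controlled at the two end times
    only. *)
Lemma compare (a b : R -> R -> R) (beta gamma : R -> R) (c kappa e s t : R) :
  flow M a -> flow M b ->
  subsol m beta a -> (forall k, 0 <= k -> 0 <= beta k) ->
  supersol m gamma b -> 0 <= c -> (forall k, 0 <= k <= kappa -> gamma k <= c) ->
  (forall s x, a s x <= kappa) ->
  0 <= e -> (forall x, `|derive1 psi x| <= psi x + e) ->
  0 < s -> s <= t ->
  I (fun x => pos (a t x - b t x) * psi x) <=
    expR (K * (t - s)) * (I (fun x => pos (a s x - b s x) * psi x) +
      (t - s) * ((K * M * e + c) * (2 * L))).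
Proof.
move=> fa fb suba beta0 superb c0 gammac ak e0 dpsi s0 st.
have [ba aM ca] := fa; have [bb bM cb] := fb.
apply/ler_addgt0Pr => e2 e2_gt0.
pose E := expR (K * (t - s)).
have E0 : 0 < E by exact: expR_gt0.
pose e1 := e2 / (E + 1).
have e1_gt0 : 0 < e1 by rewrite divr_gt0// ltr_wpDl// ltW.
have e1E : E * e1 + e1 = e2.
  have : e1 * (E + 1) = e2 by rewrite /e1 divfK// gt_eqF// ltr_wpDl// ltW.
  by move=> <-; ring.
have bpsi := test1_bcs tpsi.
have [h1 h1_gt0 H1] := mollify_cvg (bb s) bpsi L0 psiL psi01 e1_gt0.
have [h2 h2_gt0 H2] := mollify_cvg (bb t) bpsi L0 psiL psi01 e1_gt0.
pose h := Num.min h1 h2 / 2.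
have h12 : 0 < Num.min h1 h2 by rewrite lt_min h1_gt0.
have h0 : 0 < h by rewrite divr_gt0.
have hlt : h < Num.min h1 h2 by rewrite [ltRHS]splitr ltrDl.
move: hlt; rewrite lt_min => /andP[hh1 hh2].
have G := gap_gronwall h0 fa fb suba beta0 superb c0 gammac ak e0 dpsi s0 st.
have A1 := (gap_approx h0 (ba s) (bb s)).1.
have A2 := (gap_approx h0 (ba t) (bb t)).2.
have B1 := H1 _ h0 hh1; have B2 := H2 _ h0 hh2.
rewrite -/E in G *.
apply: (le_trans A2); rewrite -e1E addrA lerD//; apply: (le_trans G).
rewrite -mulrDr ler_wpM2l ?(ltW E0)// addrAC lerD2r.
exact: le_trans A1 (lerD (lexx _) B1).
Qed.

Definition initial_value (w : R -> R -> R) (f : R -> R) :=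
  forall r e : R, 0 < e ->
    exists2 d : R, 0 < d & forall t, 0 < t < d -> l1 r (w t) f <= e.

(** The time tau0 depends neither on a nor on beta, of which only the sign
    counts. The function u0, constant in time, takes the place of the
    supersolution: h is fixed first, according to the oscillation of u0, and
    then the gap grows at most linearly in time, with a rate that depends on M
    and h alone. *)
Lemma initial_layer (u0 : R -> R) (e : R) : bm u0 -> (forall x, 0 <= u0 x <= M) ->
  0 < e -> exists2 tau0 : R, 0 < tau0 & forall a beta tau,
    flow M a -> subsol m beta a -> (forall k, 0 <= k -> 0 <= beta k) ->
    initial_value a u0 -> 0 < tau < tau0 ->
    I (fun x => pos (a tau x - u0 x) * psi x) <= e.
Proof.
move=> bu0 u0M e_gt0.
have e4 : 0 < e / 4 by rewrite divr_gt0.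
have u00 x : 0 <= u0 x by have /andP[] := u0M x.
have M0 : 0 <= M by have /andP[x1 x2] := u0M 0; exact: le_trans x2.
have bpsi := test1_bcs tpsi.
have [h1 h1_gt0 H1] := mollify_cvg bu0 bpsi L0 psiL psi01 e4.
pose h := h1 / 2.
have h0 : 0 < h by rewrite divr_gt0.
have hlt : h < h1 by rewrite [ltRHS]splitr ltrDl.
have {}H1 := H1 _ h0 hlt.
have [C C0 PC] := Phi_bound h0 tpsi psiL.
have bP := bcs2_Phi h0 tpsi psiL.
have bPx := bcs2_Phi_x h0 tpsi psiL.
have P0 z : 0 <= Phi psi h z by exact: Phi_ge0.
have Lh : 0 <= L + h by rewrite addr_ge0// ltW.
pose Q := M `^ m * C * (2 * L * (2 * (L + h))) + C * K * (M * (2 * L)) * (2 * (L + h)).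
have L20 : 0 <= 2 * L by exact: mulr_ge0.
have Lh20 : 0 <= 2 * (L + h) by exact: mulr_ge0.
have Mm0 : 0 <= M `^ m by exact: powR_ge0.
have Q0 : 0 <= Q.
  apply: addr_ge0; apply: mulr_ge0 => //; apply: mulr_ge0 => //; exact: mulr_ge0.
exists (e / 4 / (Q + 1)); first by rewrite divr_gt0// ltr_wpDl.
move=> a beta tau fa suba beta0 inia /andP[tau_gt0 tau_lt].
have [ba aM ca] := fa.
have a0 r x : 0 <= a r x by have /andP[] := aM r x.
have [d d0 Hd] := inia L _ e4.
pose s := Num.min d tau / 2.
have dt : 0 < Num.min d tau by rewrite lt_min d0.
have s0 : 0 < s by rewrite divr_gt0.
have : s < Num.min d tau by rewrite [ltRHS]splitr ltrDl.
rewrite lt_min => /andP[sd stau].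
have {}Hd : l1 L (a s) u0 <= e / 4 by apply: Hd; rewrite s0.
have eta_a q : s <= q <= tau -> l1 L (a q) (a s) <= M * (2 * L).
  move=> _; rewrite -I_window// -IZ; last exact: bcs_window.
  apply: I_le; [exact: bcs_l1|exact/bcsZ/bcs_window|] => x.
  rewrite ler_wpM2r ?window_ge0// ler_norml.
  have /andP[q1 q2] := aM q x; have /andP[q3 q4] := aM s x.
  by apply/andP; split; lra.
have S1 := gap_sub m1 L0 h0 tpsi psi01 psiL fa suba beta0 bu0 u00
  (fun z => (PC z).1) s0 (ltW stau) eta_a.
have m0 : 0 <= m by rewrite ltW// (lt_trans _ m1).
have F1 : flux m (a s) u0 (Phi_x psi h) <= M `^ m * C * (2 * L * (2 * (L + h))).
  rewrite -(I_window L0) -(I_window Lh) -II_tensor; [|exact: bcs_window..].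
  have bw := bcs2_tensor (@bcs_window R L) (@bcs_window R (L + h)).
  rewrite -IIZ//; apply: II_le.
  - apply: bcs2Ml => //; apply: bm_pos; apply: bmB; apply: bm_powR => //.
      exact: bm_fst.
    exact: bm_snd.
  - exact: bcs2Z.
  move=> z.
  have [z1|z1] := leP `|z.1| L; last first.
    by rewrite (Phi_x_far h0 tpsi psiL) ?mulr0 ?mulr_ge0 ?powR_ge0 ?window_ge0//; left.
  have [z2|z2] := leP `|z.2| (L + h); last first.
    by rewrite (Phi_x_far h0 tpsi psiL) ?mulr0 ?mulr_ge0 ?powR_ge0 ?window_ge0//; right.
  rewrite !windowE z1 z2 !mulr1.
  apply: (@le_trans _ _ (pos (a s z.1 `^ m - u0 z.2 `^ m) * C)).
    by rewrite ler_wpM2l ?pos_ge0// (le_trans _ (PC z).1)// ler_norm.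
  rewrite ler_wpM2r// pos_le ?powR_ge0//.
  rewrite (@le_trans _ _ (a s z.1 `^ m))// ?gerBl ?powR_ge0//.
  by apply: ge0_ler_powR => //; rewrite ?nnegrE//; have /andP[] := aM s z.1.
have G1 : gap psi h (a s) u0 <= gap psi h u0 u0 + e / 4.
  apply: (@le_trans _ _ (gap psi h u0 u0 + l1 L (a s) u0)); last by rewrite lerD2l.
  have bd : bm (fun x => `|a s x - u0 x|) by apply: bm_norm; exact: bmB.
  have b2 (q : R -> R) : bm q -> bcs2 (fun z => pos (q z.1 - u0 z.2) * Phi psi h z).
    by move=> bq; apply: bcs2Ml => //; apply: bm_pos; apply: bmB; [exact: bm_fst|exact: bm_snd].
  have b3 : bcs2 (fun z => `|a s z.1 - u0 z.1| * Phi psi h z).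
    by apply: bcs2Ml => //; exact: (bm_fst bd).
  apply: (@le_trans _ _ (gap psi h u0 u0 + II (fun z => `|a s z.1 - u0 z.1| * Phi psi h z))).
    rewrite /gap -IID//; last exact: b2.
    apply: II_le; [exact: b2|by apply: bcs2D => //; exact: b2|] => z.
    rewrite -mulrDl ler_wpM2r//.
    rewrite (_ : a s z.1 - u0 z.2 = (u0 z.1 - u0 z.2) + (a s z.1 - u0 z.1)); last by ring.
    by rewrite (le_trans (posD_le _ _))// lerD2l pos_norm.
  rewrite lerD2l (II_Phi_fst h0 bd) -[leRHS]mul1r.
  apply: I_weight_le => //.
  by move=> x; rewrite ger0_norm//; have /andP[] := psi01 x.
have G2 : gap psi h u0 u0 <= e / 4.
  have := (gap_approx h0 bu0 bu0).1.
  rewrite (_ : (fun x => pos (u0 x - u0 x) * psi x) = (fun=> 0)); last first.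
    by apply/funext => x; rewrite subrr pos_id ?mul0r.
  by rewrite I0 add0r => /le_trans; apply.
have G3 := (gap_approx h0 (ba tau) bu0).2.
have T : (tau - s) * (flux m (a s) u0 (Phi_x psi h) +
    C * lip m M * (M * (2 * L)) * (2 * (L + h))) <= e / 4.
  apply: (@le_trans _ _ ((tau - s) * Q)).
    by rewrite ler_wpM2l ?subr_ge0 ?(ltW stau)// lerD2r.
  apply: (@le_trans _ _ (tau * (Q + 1))); last first.
    by rewrite -ler_pdivlMr ?(ltW tau_lt)// ltr_wpDl.
  by rewrite ler_pM ?subr_ge0 ?(ltW stau)// ?gerBl ?(ltW s0)// lerDl.
apply: (le_trans G3); move: H1 G1 G2 S1 T.
exact: layer_budget.
Qed.

End comparison.

(** * Null sets and local distances *)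

Section almost_everywhere.
Context {R : realType}.
Local Notation mu := (@lebesgue_measure R).

Lemma Linfty_bound d (T : measurableType d) (nu : {measure set T -> \bar R}) (f : T -> R) :
  f \in Lfun nu +oo%E ->
  measurable_fun setT f /\ exists2 M : R, 0 <= M & {ae nu, forall x, `|f x| <= M}.
Proof.
move=> /andP[]; rewrite !inE/= => mf fin; split => //.
move: fin; rewrite /finite_norm unlock /=; case: ifPn => [nu0 fin|nu0 _].
  have e0 : (0 <= ess_sup nu (abse \o (EFin \o f)))%E.
    by apply: ess_sup_gee => //; apply: nearW => x /=; rewrite lee_fin.
  exists (fine (ess_sup nu (abse \o (EFin \o f)))); first exact: fine_ge0.
  have := ess_sup_ge nu (abse \o (EFin \o f)); apply: filterS => x /=.
  rewrite -lee_fin fineK//; last by rewrite ge0_fin_numE.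
exists 0 => //.
have nuT : nu setT = 0 by apply/eqP; rewrite eq_le measure_ge0 andbT leNgt.
by exists setT; split.
Qed.

(** Tonelli's theorem for the indicator function of a null set. *)
Lemma ae_section2 (P : R * R -> Prop) :
  {ae (mu \x mu)%E, forall z, P z} -> {ae mu, forall t, {ae mu, forall x, P (x, t)}}.
Proof.
move=> [N [mN N0 PN]].
pose f (z : R * R) : \bar R := (\1_N z)%:E.
have mf : measurable_fun setT f by apply/measurable_EFinP; exact: measurable_indic.
have f0 z : (0 <= f z)%E by rewrite lee_fin.
have E : (\int[mu]_y fubini_G mu f y)%E = 0%E.
  rewrite -(fubini_tonelli2 (m1 := mu) (m2 := mu) _ mf f0).
  by rewrite /f integral_indic// setIT.
have mG := measurable_fun_fubini_tonelli_G (m1 := mu) _ mf f0.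
have G0 y : (0 <= fubini_G mu f y)%E by apply: integral_ge0 => x _; exact: f0.
have /(ae_eq_integral_abs mu measurableT mG) : (\int[mu]_y `|fubini_G mu f y|)%E = 0%E.
  by rewrite -[RHS]E; apply: eq_integral => y _; rewrite gee0_abs.
apply: filterS => t /(_ Logic.I) /= Gt.
exists (ysection N t); split.
- exact: measurable_ysection.
- have : (\int[mu]_x (\1_(ysection N t) x)%:E = 0)%E.
    rewrite -[RHS]Gt /fubini_G; apply: eq_integral => x _; rewrite /f !indicE.
    by rewrite mem_ysection.
  by rewrite integral_indic ?setIT//; exact: measurable_ysection.
- by move=> x /= Px; apply/set_mem; rewrite mem_ysection; apply/mem_set; exact: PN.
Qed.

Lemma ae_imp (P Q : R -> Prop) : (forall x, P x -> Q x) ->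
  {ae mu, forall x, P x} -> {ae mu, forall x, Q x}.
Proof.
move=> PQ [N [mN N0 PN]]; exists N; split => //.
by apply: subset_trans PN => x /= nQ /PQ.
Qed.

Lemma ae_and (P Q : R -> Prop) : {ae mu, forall x, P x} ->
  {ae mu, forall x, Q x} -> {ae mu, forall x, P x /\ Q x}.
Proof.
move=> hP hQ; have := negligibleU hP hQ; apply: negligibleS => x /= nPQ.
by apply: contrapT => /not_orP[nP nQ]; apply: nPQ; split; exact: contrapT.
Qed.

Lemma ae_exists_near (P : R -> Prop) (a b : R) : a < b ->
  {ae mu, forall t, P t} -> exists2 t, a < t < b & P t.
Proof.
move=> ab [N [mN N0 PN]].
apply: contrapT => H.
have sub : `]a, b[%classic `<=` N.
  move=> t /=; rewrite in_itv/= => tab; apply: PN => /= Pt; apply: H.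
  by exists t.
have : (mu `]a, b[%classic <= mu N)%E by apply: le_measure => //; rewrite inE.
rewrite N0 /= lebesgue_measure_itv/= lte_fin ab -EFinB lee_fin subr_le0.
by rewrite leNgt ab.
Qed.

End almost_everywhere.

Section L1dist_lemmas.
Context {R : realType}.
Local Notation mu := (@lebesgue_measure R).
Implicit Types f g h : R -> R.

Let B (r : R) : set R := [set x : R | (`|x| <= r)%R].

Let BE r : B r = `[- r, r]%classic.
Proof. by apply/seteqP; split => x; rewrite /B/= in_itv/= ler_norml. Qed.

Let mB r : measurable (B r). Proof. by rewrite BE; exact: measurable_itv. Qed.

Let md r f g : measurable_fun setT f -> measurable_fun setT g ->
  measurable_fun (B r) (fun x => (`|f x - g x|)%:E).
Proof.
move=> mf mg; apply/measurable_EFinP/measurable_funTS.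
by apply: (measurableT_comp (f := fun x : R => `|x|)) => //; exact: measurable_funB.
Qed.

Lemma L1dist_ge0 r f g : (0 <= L1dist r f g)%E.
Proof. by apply: integral_ge0 => x _; rewrite lee_fin. Qed.

Lemma L1distC r f g : L1dist r f g = L1dist r g f.
Proof. by apply: eq_integral => x _; rewrite distrC. Qed.

Lemma L1dist_triangle r f g h : measurable_fun setT f -> measurable_fun setT g ->
  measurable_fun setT h -> (L1dist r f g <= L1dist r f h + L1dist r h g)%E.
Proof.
move=> mf mg mh; rewrite /L1dist -ge0_integralD//; [|exact: mB|exact: md|exact: md].
apply: ge0_le_integral => //.
- exact: mB.
- exact: md.
- by apply: emeasurable_funD; exact: md.
by move=> x _; rewrite -EFinD lee_fin ler_distD.
Qed.

Lemma L1dist_contract r f g f' g' : measurable_fun setT f -> measurable_fun setT g ->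
  measurable_fun setT f' -> measurable_fun setT g' ->
  (forall x, `|f' x - g' x| <= `|f x - g x|) -> (L1dist r f' g' <= L1dist r f g)%E.
Proof.
move=> mf mg mf' mg' H; apply: ge0_le_integral => //; [exact: mB|exact: md|exact: md|].
by move=> x _; rewrite lee_fin.
Qed.

Lemma L1dist_ae0 r f g : measurable_fun setT f -> measurable_fun setT g ->
  {ae mu, forall x, f x = g x} -> L1dist r f g = 0%E.
Proof.
move=> mf mg fg.
have fg0 : {ae mu, forall x, B r x -> (`|f x - g x|)%:E = cst 0%E x}.
  by move: fg; apply: ae_imp => x -> _; rewrite subrr normr0.
rewrite /L1dist (@ae_eq_integral _ _ _ mu _ (cst 0%E)) ?integral0//.
- exact: mB.
- exact: md.
Qed.

Lemma L1dist_eq0 f g : measurable_fun setT f -> measurable_fun setT g ->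
  (forall r, 0 < r -> L1dist r f g = 0%E) -> {ae mu, forall x, f x = g x}.
Proof.
move=> mf mg H.
have Hn (n : nat) : {ae mu, forall x, B n.+1%:R x -> f x = g x}.
  have /(ae_eq_integral_abs mu (mB n.+1%:R) (md mf mg)) :
      (\int[mu]_(x in B n.+1%:R) `|(`|f x - g x|)%:E|)%E = 0%E.
    rewrite -[RHS](H n.+1%:R)//; apply: eq_integral => x _.
    by rewrite gee0_abs// lee_fin.
  apply: ae_imp => x H' Bx; have := H' Bx; move=> /= [] /eqP.
  by rewrite normr_eq0 subr_eq0 => /eqP.
have : {ae mu, forall x (n : nat), B n.+1%:R x -> f x = g x} by exact/ae_foralln.
apply: ae_imp => x Hx.
apply: (Hx (Num.bound `|x|)); rewrite /B/= (le_trans (ltW (archi_boundP _)))//.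
by rewrite ler_nat.
Qed.

Lemma L1distE r f g : bm f -> bm g -> L1dist r f g = (l1 r f g)%:E.
Proof.
move=> bf bg; rewrite /L1dist /l1 -I_EFin; last exact: bcs_l1.
rewrite integral_mkcond; apply: eq_integral => x _.
rewrite patchE windowE; case: ifPn => xr.
  by rewrite ifT ?mulr1//; move: xr; rewrite inE.
rewrite ifF ?mulr0//; apply/negbTE; move: xr; apply: contra => xr.
by rewrite inE.
Qed.

Lemma I_ae_eq f g : bcs f -> bcs g -> {ae mu, forall x, f x = g x} -> I f = I g.
Proof.
move=> bf bg fg; apply: EFin_inj; rewrite -!I_EFin//.
have fg0 : {ae mu, forall x, [set: R] x -> (f x)%:E = (g x)%:E}.
  by move: fg; apply: ae_imp => x ->.
apply: ae_eq_integral => //.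
- by apply/measurable_EFinP; have [[]] := bf.
- by apply/measurable_EFinP; have [[]] := bg.
Qed.

End L1dist_lemmas.

(** * Representatives continuous in time *)

Section representative.
Context {R : realType}.
Local Notation mu := (@lebesgue_measure R).

Lemma cvge0_near_le (T : Type) (F : set_system T) (f : T -> \bar R) (e : R) :
  f @ F --> 0%E -> 0 < e -> F [set t | (f t <= e%:E)%E].
Proof.
move=> fF e0.
have N : nbhs (0%E : \bar R) [set x | (x <= e%:E)%E].
  apply: (@filterS _ _ _ [set x : \bar R | (x < e%:E)%E]).
    by move=> x /=; exact: ltW.
  apply: open_nbhs_nbhs; split; last by rewrite /= lte_fin.
  exact: open_ereal_lt_ereal.
exact: (fF _ N).
Qed.

Variables (u : R * R -> R) (u0 : R -> R).
Hypotheses (uL : nonneg_Linfty_halfplane u) (uc : continuous_L1loc u)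
  (ut : initial_trace u0 u) (mu0 : measurable_fun setT u0).

Let mut t : 0 < t -> measurable_fun setT (fun x => u (x, t)).
Proof. by move=> t0; have [] := uc.1 t t0. Qed.

Let ucont (t r e : R) : 0 < t -> 0 < r -> 0 < e -> exists2 d : R, 0 < d &
  forall s, `|s - t| < d -> 0 < s /\
    (L1dist r (fun x => u (x, s)) (fun x => u (x, t)) <= e%:E)%E.
Proof.
move=> t0 r0 e0; have := cvge0_near_le (uc.2 t r t0 r0) e0.
move/nbhs_ballP => [d /= d0 H].
exists (Num.min d t); first by rewrite lt_min d0.
move=> s; rewrite lt_min => /andP[sd st]; split.
  by move: st; rewrite ltr_distl => /andP[+ _]; rewrite subrr.
by apply: H; rewrite /ball/= distrC.
Qed.

(** Cutting u at the levels 0 and M alters it on a null set of the half-plane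
    and makes every time slice bounded, which a.e. bounds in the plane do not.
    *)
Definition truncation (M : R) (t x : R) : R :=
  Num.max 0 (Num.min M ((u \_ (@halfplane R)) (x, t))).

(** By Fubini u agrees with its truncation on almost every time slice; as
    truncation is a contraction, continuity in L^1_loc extends this to all
    positive times. In the same way the exceptional times of the initial trace
    disappear. *)
Lemma representative : exists M w,
  [/\ 0 < M, flow M w, bm (fun z : R * R => w z.2 z.1),
      forall t, 0 < t -> {ae mu, forall x, u (x, t) = w t x} &
      forall f, bm f -> {ae mu, forall x, u0 x = f x} -> initial_value w f].
Proof.
have [uLf uge0] := uL.
have [muH [M0 M00 uM]] := Linfty_bound uLf.
pose M := M0 + 1; have M_gt0 : 0 < M by rewrite ltr_wpDl.
pose w := truncation M.
have w0M t x : 0 <= w t x <= M.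
  by rewrite /w /truncation le_max lexx/= ge_max (ltW M_gt0)/= ge_min lexx.
have bw2 : bm (fun z : R * R => w z.2 z.1).
  split; last by exists M => z; have /andP[x1 x2] := w0M z.2 z.1; rewrite ger0_norm.
  apply: measurable_maxr => //; apply: measurable_minr => //.
  have -> : (fun z : R * R => (u \_ (@halfplane R)) (z.1, z.2)) = u \_ (@halfplane R).
    by apply/funext => -[].
  exact: muH.
have bw t : bm (w t).
  by apply: (bm_comp (g := fun x => (x, t)) _ bw2); exact: measurable_pair2.
have wE t x : 0 < t -> w t x = Num.max 0 (Num.min M (u (x, t))).
  by move=> t0; rewrite /w /truncation patchE ifT// inE.
have slice : {ae mu, forall t, 0 < t -> {ae mu, forall x, u (x, t) = w t x}}.
  have := ae_and (ae_section2 uM) (ae_section2 uge0).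
  apply: ae_imp => t [ut1 ut2] t0; have := ae_and ut1 ut2.
  apply: ae_imp => x [+ /(_ t0) u_ge0].
  rewrite patchE ifT; last by rewrite inE.
  rewrite ler_norml => /andP[_ u_le].
  rewrite wE// min_r; last by rewrite (le_trans u_le)// lerDl.
  by rewrite max_r.
have wcontr s t : 0 < s -> 0 < t -> forall x, `|w s x - w t x| <= `|u (x, s) - u (x, t)|.
  move=> s0 t0 x; rewrite !wE//.
  have mx (a b : R) : `|Num.max 0 a - Num.max 0 b| <= `|a - b|.
    by rewrite !(maxC 0); exact: posB_norm.
  apply: (le_trans (mx _ _)).
  have mn (a b : R) : Num.min M a = M - pos (M - a).
    rewrite /pos; case: (leP M a) => Ma.
      by rewrite max_r ?subr0// subr_le0.
    by rewrite max_l ?subr_ge0 ?(ltW Ma)// subKr.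
  rewrite !mn// opprD addrACA subrr add0r opprK addrC.
  apply: (le_trans (posB_norm _ _)).
  by rewrite (_ : _ - _ = u (x, s) - u (x, t)) //; ring.
have all_t t : 0 < t -> {ae mu, forall x, u (x, t) = w t x}.
  move=> t0; apply: L1dist_eq0; [exact: mut|by have [] := bw t|] => r r0.
  apply/eqP; rewrite eq_le L1dist_ge0 andbT; apply/lee_addgt0Pr => e e0; rewrite add0e.
  have e2 : 0 < e / 2 by rewrite divr_gt0.
  have [d d0 Hd] := ucont t0 r0 e2.
  have [s /andP[s1 s2] Hs] : exists2 s, t - d < s < t + d &
      0 < s -> {ae mu, forall x, u (x, s) = w s x}.
    by apply: ae_exists_near slice; rewrite ltrD2l gtrN.
  have [s0 us] : 0 < s /\ (L1dist r (fun x => u (x, s)) (fun x => u (x, t)) <= (e / 2)%:E)%E.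
    by apply: Hd; rewrite ltr_distl s1 s2.
  have {}Hs := Hs s0.
  have mw q : measurable_fun setT (w q) by have [] := bw q.
  apply: (le_trans (L1dist_triangle r (mut t0) (mw t) (mut s0))).
  rewrite [e]splitr EFinD; apply: leeD; first by rewrite L1distC.
  apply: (le_trans (L1dist_triangle r (mut s0) (mw t) (mw s))).
  rewrite (L1dist_ae0 r (mut s0) (mw s) Hs) add0e.
  by apply: le_trans us; apply: L1dist_contract => //; [exact: mut|exact: mut|exact: wcontr].
have mw q : measurable_fun setT (w q) by have [] := bw q.
exists M, w; split => //.
- split => // t r e t0 e0.
  have r'0 : 0 < Num.max r 1 by rewrite lt_max ltr01 orbT.
  have [d d0 Hd] := ucont t0 r'0 e0; exists d => // s sd.
  have [s0 us] := Hd _ sd.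
  apply: (@le_trans _ _ (l1 (Num.max r 1) (w s) (w t))).
    by apply: l1_le_radius => //; rewrite le_max lexx.
  rewrite -lee_fin -L1distE//; apply: le_trans us.
  by apply: L1dist_contract => //; [exact: mut|exact: mut|exact: wcontr].
move=> f bf u0f r0 e e0.
pose r := Num.max r0 1.
have r_gt0 : 0 < r by rewrite lt_max ltr01 orbT.
have [E [E0 Enull Etr]] := ut.
have e2 : 0 < e / 2 by rewrite divr_gt0.
have := cvge0_near_le (Etr r r_gt0) e2; rewrite /within/= => near0.
have [d d0 Hd] : exists2 d : R, 0 < d & forall t, 0 < t -> t < d -> ~ E t ->
    (L1dist r (fun x => u (x, t)) u0 <= (e / 2)%:E)%E.
  have /nbhs_ballP[d /= d0 Hd] := near0.
  exists d => // t t0 td nE; apply: Hd => //.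
  by rewrite /ball/= sub0r normrN gtr0_norm.
exists d => // t /andP[t0 td].
have [d' d'0 Hd'] := ucont t0 r_gt0 e2.
have nE : {ae mu, forall s, ~ E s}.
  by have [N [mN N0 EN]] := Enull; exists N; split => // s /= /contrapT; exact: EN.
have [s /andP[s1 s2] Hs] : exists2 s, Num.max (t - d') 0 < s < t & ~ E s.
  by apply: ae_exists_near nE; rewrite gt_max t0 andbT ltrBlDr ltrDl.
move: s1; rewrite gt_max => /andP[s1 s0].
have [_ us] : 0 < s /\ (L1dist r (fun x => u (x, s)) (fun x => u (x, t)) <= (e / 2)%:E)%E.
  by apply: Hd'; rewrite ltr_distl s1/= (lt_trans s2)// ltrDl.
have bf1 := bf.1.
apply: (@le_trans _ _ (l1 r (w t) f)).
  by apply: l1_le_radius => //; rewrite le_max lexx.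
rewrite -lee_fin -L1distE//.
apply: (le_trans (L1dist_triangle r (mw t) bf1 (mut t0))).
rewrite L1distC (L1dist_ae0 r (mut t0) (mw t) (all_t _ t0)) add0e.
apply: (le_trans (L1dist_triangle r (mut t0) bf1 mu0)).
rewrite (L1dist_ae0 r mu0 bf1 u0f) adde0.
apply: (le_trans (L1dist_triangle r (mut t0) mu0 (mut s0))).
rewrite [e]splitr EFinD; apply: leeD; first by rewrite L1distC.
by apply: Hd => //; exact: lt_trans td.
Qed.

End representative.

(** * From the entropy inequality to sub- and supersolutions *)

Section slices.
Context {R : realType}.
Local Notation mu := (@lebesgue_measure R).

(** Tonelli's theorem for the positive and the negative part. *)
Lemma bm_slice (g : R * R -> R) (A : R -> R) : bm g -> bcs A ->
  bm (fun t => I (fun x => g (x, t) * A x)).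
Proof.
move=> bg bA; have [_ [C gC]] := bg.
have bgt t : bm (fun x => g (x, t)).
  by apply: (bm_comp (g := fun x => (x, t)) _ bg); exact: measurable_pair2.
have bgA t : bcs (fun x => g (x, t) * A x) by exact: bcsMl.
split; last first.
  exists (I (fun x => C * `|A x|)) => t.
  apply: (le_trans (I_norm (bgA t))); apply: I_le; first exact: bcs_norm.
    by apply: bcsZ; exact: bcs_norm.
  by move=> x; rewrite normrM ler_wpM2r.
have mpos (q : R * R -> R) : bm q ->
    measurable_fun setT (fun t => I (fun x => pos (q (x, t)))).
  move=> bq; pose h (z : R * R) := (pos (q z))%:E.
  have mh : measurable_fun setT h by apply/measurable_EFinP; have [] := bm_pos bq.
  have h0 z : (0 <= h z)%E by rewrite lee_fin pos_ge0.
  have mG := measurable_fun_fubini_tonelli_G (m1 := mu) _ mh h0.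
  exact: (measurableT_comp (fine_measurable measurableT) mG).
have bq : bm (fun z => g z * A z.1) by apply: bmM => //; apply: bm_fst; exact: bA.1.
have -> : (fun t => I (fun x => g (x, t) * A x)) =
    (fun t => I (fun x => pos (g (x, t) * A x)) - I (fun x => pos (- (g (x, t) * A x)))).
  apply/funext => t; rewrite -IB; [|exact: bcs_pos|by apply: bcs_pos; exact: bcsN].
  congr I; apply/funext => x.
  have [y0|y0] := leP 0 (g (x, t) * A x).
    by rewrite pos_id// pos_eq0 ?subr0// oppr_le0.
  by rewrite pos_eq0 ?(ltW y0)// pos_id ?sub0r ?opprK// oppr_ge0 ltW.
by apply: measurable_funB; [exact: (mpos _ bq)|exact: (mpos _ (bmN bq))].
Qed.

End slices.

Lemma entropy_budget (R : realType) (d b x y q1 q2 s1 s2 g : R) :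
  g * b <= (s1 + s2) * b ->
  x * d + (q1 - s1) * b + (y * d + (q2 - s2) * b) <=
    (x + y) * d + (q1 + q2 - g) * b.
Proof. move=> ?; lra. Qed.

Lemma double_le (R : realType) (x y b c : R) : x - b * y <= c ->
  2 * x - 2 * b * y <= 2 * c.
Proof. move=> ?; lra. Qed.

Lemma half_le (R : realType) (x y z s c : R) : 2 * x + z - (2 * y + z) <= s * (2 * c) ->
  x - y <= s * c.
Proof. move=> ?; lra. Qed.

Lemma double_leD (R : realType) (x y c : R) : x + y <= c -> 2 * x + 2 * y <= 2 * c.
Proof. move=> ?; lra. Qed.

Section entropy_to_semi_solutions.
Context {R : realType}.
Local Notation mu := (@lebesgue_measure R).
Variables (m M : R) (phi S beta : R -> R) (u : R * R -> R) (w : R -> R -> R).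
Hypotheses (m1 : 1 < m) (M0 : 0 < M) (fw : flow M w)
  (bw2 : bm (fun z : R * R => w z.2 z.1))
  (mut : forall t, 0 < t -> measurable_fun setT (fun x => u (x, t)))
  (uw : forall t, 0 < t -> {ae mu, forall x, u (x, t) = w t x})
  (ent : entropy_inequality m phi u)
  (mphi : measurable_fun setT phi) (phiS : forall v, phi v = - S v)
  (S0 : S 0 = 0) (S_ge0 : forall v, 0 <= v -> 0 <= S v)
  (S_le : forall v v', 0 <= v -> v <= v' -> S v <= S v')
  (betaS : forall k v, 0 <= k -> k <= v -> beta k * (v - k) <= S v).

Let m0 : 0 <= m. Proof. by rewrite ltW// (lt_trans _ m1). Qed.
Let wM t x : 0 <= w t x <= M. Proof. by have [_ + _] := fw; apply. Qed.
Let bw t : bm (w t). Proof. by have [] := fw. Qed.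

(** Functions that may be applied to w, whose values lie in [0, M]. *)
Definition nice (g : R -> R) := measurable_fun setT g /\
  exists C : R, forall v, 0 <= v <= M -> `|g v| <= C.

Definition J (g A : R -> R) t := I (fun x => g (w t x) * A x).

Lemma nice_slice g t : nice g -> bm (fun x => g (w t x)).
Proof.
move=> [mg [C gC]]; split; first by apply: measurableT_comp => //; have [] := bw t.
by exists C => x; exact: gC.
Qed.

Lemma bcs_J g A t : nice g -> bcs A -> bcs (fun x => g (w t x) * A x).
Proof. by move=> ng bA; apply: bcsMl => //; exact: nice_slice. Qed.

Lemma bm_J g A : nice g -> bcs A -> bm (J g A).
Proof.
move=> [mg [C gC]] bA; apply: (bm_slice (g := fun z => g (w z.2 z.1))) => //.
split; first by apply: measurableT_comp => //; have [] := bw2.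
by exists C => z; exact: gC.
Qed.

Lemma JD g g' A t : nice g -> nice g' -> bcs A ->
  J (fun v => g v + g' v) A t = J g A t + J g' A t.
Proof.
move=> ng ng' bA; rewrite /J -ID; [|exact: bcs_J..].
by congr I; apply/funext => x; rewrite mulrDl.
Qed.

Lemma JZ c g A t : nice g -> bcs A -> J (fun v => c * g v) A t = c * J g A t.
Proof.
move=> ng bA; rewrite /J -IZ; [|exact: bcs_J].
by congr I; apply/funext => x; rewrite mulrA.
Qed.

Lemma J_cst c A t : bcs A -> J (fun=> c) A t = c * I A.
Proof. by move=> bA; rewrite /J IZ. Qed.

Lemma J_le g g' A t : nice g -> nice g' -> bcs A -> (forall x, 0 <= A x) ->
  (forall v, 0 <= v <= M -> g v <= g' v) -> J g A t <= J g' A t.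
Proof.
move=> ng ng' bA A0 gg; apply: I_le; [exact: bcs_J..|] => x.
by rewrite ler_wpM2r// gg.
Qed.

Lemma eq_J g g' A t : (forall v, 0 <= v <= M -> g v = g' v) -> J g A t = J g' A t.
Proof. by move=> gg; congr I; apply/funext => x; rewrite gg. Qed.

Lemma J_continuous g A (K : R) : nice g -> bcs A -> 0 <= K ->
  (forall v v', 0 <= v <= M -> 0 <= v' <= M -> `|g v - g v'| <= K * `|v - v'|) ->
  forall t, 0 < t -> {for t, continuous (J g A)}.
Proof.
move=> ng bA K0 gK t t0; apply/cvgrPdist_le => e e0.
have [r r0 Ar] := bcs_vanish bA.
have [[_ [C AC]] _] := bA.
have C0 : 0 <= C by exact: le_trans (normr_ge0 _) (AC 0).
pose e1 := e / (K * C + 1).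
have den : 0 < K * C + 1 by rewrite ltr_wpDl// mulr_ge0.
have e1_gt0 : 0 < e1 by rewrite divr_gt0.
have [_ _ cw] := fw.
have [d d0 Hd] := cw t r e1 t0 e1_gt0.
apply/nbhs_ballP; exists d => //= s; rewrite /ball/= distrC => /Hd l1s.
rewrite distrC /J -IB; [|exact: bcs_J..].
apply: (le_trans (I_norm (bcsB (bcs_J s ng bA) (bcs_J t ng bA)))).
apply: (@le_trans _ _ (I (fun x => K * C * (`|w s x - w t x| * window r x)))).
  apply: I_le.
  - by apply: bcs_norm; apply: bcsB; exact: bcs_J.
  - by apply: bcsZ; exact: bcs_l1.
  move=> x; rewrite -mulrBl normrM windowE; case: ifPn => xr.
    by rewrite mulr1 mulrAC ler_pM// gK.
  by rewrite Ar ?normr0 ?mulr0// ltNge.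
rewrite IZ; last exact: bcs_l1.
apply: (@le_trans _ _ (K * C * e1)); first by rewrite ler_wpM2l// mulr_ge0.
have : e1 * (K * C + 1) = e by rewrite /e1 divfK// gt_eqF.
move=> <-; rewrite [leRHS]mulrC; apply: ler_wpM2r; first exact: ltW.
by rewrite lerDl.
Qed.

Let mS : measurable_fun setT S.
Proof.
have -> : S = (fun v => - phi v) by apply/funext => v; rewrite phiS opprK.
exact: measurable_funN.
Qed.

Lemma nice_abs k : nice (fun v => `|v - k|).
Proof.
split.
  by apply: (measurableT_comp (f := fun x : R => `|x|)) => //; exact: measurable_funB.
exists (M + `|k|) => v /andP[v0 vM].
by rewrite normr_id (le_trans (ler_normB _ _))// lerD2r ger0_norm.
Qed.

Lemma nice_pos k : nice (fun v => pos (v - k)).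
Proof.
split; first by apply: measurable_maxr => //; exact: measurable_funB.
exists (M + `|k|) => v /andP[v0 vM]; rewrite ger0_norm ?pos_ge0//.
by rewrite (le_trans (pos_norm _))// (le_trans (ler_normB _ _))// lerD2r ger0_norm.
Qed.

Lemma nice_neg k : nice (fun v => pos (k - v)).
Proof.
split; first by apply: measurable_maxr => //; exact: measurable_funB.
exists (M + `|k|) => v /andP[v0 vM]; rewrite ger0_norm ?pos_ge0//.
by rewrite (le_trans (pos_norm _))// distrC (le_trans (ler_normB _ _))// lerD2r ger0_norm.
Qed.

Let powM v : 0 <= v <= M -> `|v `^ m| <= M `^ m.
Proof.
move=> /andP[v0 vM]; rewrite ger0_norm ?powR_ge0//.
by apply: ge0_ler_powR => //; rewrite nnegrE// ltW.
Qed.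

Let mpow : measurable_fun setT (fun v : R => v `^ m).
Proof. exact: (measurable_powR m). Qed.

Let mpowB k : measurable_fun setT (fun v : R => v `^ m - k).
Proof. exact: measurable_funB. Qed.

Lemma nice_powabs k : nice (fun v => `|v `^ m - k|).
Proof.
split.
  exact: (measurableT_comp (f := fun x : R => `|x|)).
exists (M `^ m + `|k|) => v vM.
by rewrite normr_id (le_trans (ler_normB _ _))// lerD2r powM.
Qed.

Lemma nice_powpos k : nice (fun v => pos (v `^ m - k)).
Proof.
split; first by apply: measurable_maxr => //; exact: measurable_funB.
exists (M `^ m + `|k|) => v vM; rewrite ger0_norm ?pos_ge0//.
by rewrite (le_trans (pos_norm _))// (le_trans (ler_normB _ _))// lerD2r powM.
Qed.

Lemma nice_powneg k : nice (fun v => pos (k - v `^ m)).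
Proof.
split; first by apply: measurable_maxr => //; exact: measurable_funB.
exists (M `^ m + `|k|) => v vM; rewrite ger0_norm ?pos_ge0//.
by rewrite (le_trans (pos_norm _))// distrC (le_trans (ler_normB _ _))// lerD2r powM.
Qed.

Let msg k : measurable_fun setT (fun v : R => Num.sg (v - k)).
Proof.
have -> : (fun v => Num.sg (v - k)) =
    (fun v => if 0 < v - k then 1 else if v - k < 0 then -1 else 0 : R).
  by apply/funext => v; case: sgrP.
have mB : measurable_fun setT (fun v : R => v - k) by exact: measurable_funB.
apply: measurable_fun_ifT => //; first exact: measurable_fun_ltr.
by apply: measurable_fun_ifT => //; exact: measurable_fun_ltr.
Qed.

Lemma nice_source k : nice (fun v => Num.sg (v - k) * S v).
Proof.
split; first by apply: measurable_funM => //.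
exists (S M) => v /andP[v0 vM]; rewrite normrM normr_sg.
rewrite (ger0_norm (S_ge0 v0)); apply: (@le_trans _ _ (S v)); last exact: S_le.
by case: (_ != _); rewrite ?mul1r// mul0r S_ge0.
Qed.

Lemma nice_cst c : nice (fun=> c).
Proof. by split => //; exists `|c|. Qed.

Lemma niceD g g' : nice g -> nice g' -> nice (fun v => g v + g' v).
Proof.
move=> [mg [C gC]] [mg' [C' gC']]; split; first exact: measurable_funD.
exists (C + C') => v vM; rewrite (le_trans (ler_normD _ _))// lerD ?gC ?gC'//.
Qed.

Lemma niceZ c g : nice g -> nice (fun v => c * g v).
Proof.
move=> [mg [C gC]]; split; first exact: measurable_funM.
by exists (`|c| * C) => v vM; rewrite normrM ler_wpM2l ?gC.
Qed.

Lemma bcs_entropy k A B : test1 A -> test1 B ->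
  bcs (fun t => J (fun v => `|v - k|) A t * derive1 B t +
    (J (fun v => `|v `^ m - k `^ m|) (derive1 A) t
     - J (fun v => Num.sg (v - k) * S v) A t) * B t).
Proof.
move=> tA tB; have bA := test1_bcs tA; have bB := test1_bcs tB.
have bA' := test1_bcs (test1_derive1 tA); have bB' := test1_bcs (test1_derive1 tB).
have n1 := nice_abs k; have n2 := nice_powabs (k `^ m); have n3 := nice_source k.
apply: bcsD; apply: bcsMl => //; first exact: bm_J.
by apply: bmB; exact: bm_J.
Qed.

(** With the test function A(x) B(t) the entropy inequality reduces to an
    inequality in time alone, in the sense of distributions, between moments
    of w. *)
Lemma entropy_in_time (k a : R) A B : 0 <= k -> test1 A -> (forall x, 0 <= A x) ->
  test1 B -> 0 < a -> (forall t, t < a -> B t = 0) -> (forall t, 0 <= B t) ->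
  0 <= I (fun t => J (fun v => `|v - k|) A t * derive1 B t +
    (J (fun v => `|v `^ m - k `^ m|) (derive1 A) t
     - J (fun v => Num.sg (v - k) * S v) A t) * B t).
Proof.
move=> k0 tA A0 tB a0 Ba B0.
set G := fun t => _.
have bA := test1_bcs tA; have bA' := test1_bcs (test1_derive1 tA).
have bB := test1_bcs tB; have bB' := test1_bcs (test1_derive1 tB).
have n1 := nice_abs k; have n2 := nice_powabs (k `^ m); have n3 := nice_source k.
have bG : bcs G by exact: bcs_entropy.
have eta_test := test_function_tensor tA tB a0 Ba.
have eta_ge0 z : 0 <= A z.1 * B z.2 by rewrite mulr_ge0.
rewrite -lee_fin -(I_EFin bG).
have := ent k0 eta_test eta_ge0.
set X := (\int[mu]_(t in _) _)%E; suff -> : X = (\int[mu]_t (G t)%:E)%E by [].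
rewrite /X integral_mkcond; apply: eq_integral => t _.
rewrite patchE; case: ifPn => [|] tt; last first.
  have t0 : t <= 0 by move: tt; rewrite notin_setE/= => /negP; rewrite -leNgt.
  rewrite /G Ba ?(le_lt_trans t0)// mulr0 addr0.
  have -> : derive1 B t = 0; last by rewrite mulr0.
  have e0 : \forall s \near t, cst 0 s = B s.
    near=> s; rewrite Ba//; near: s; apply: lt_nbhsl; exact: le_lt_trans t0 _.
  rewrite derive1E.
  by have := near_eq_is_derive e0 (is_derive_cst 0 t 1) => ?; rewrite derive_val.
have t_gt0 : 0 < t by move: tt; rewrite inE.
have D1 x : 'D_(1, 0) (fun z : R * R => A z.1 * B z.2) (x, t) = derive1 A x * B t.
  exact: (congr1 (fun f => f (x, t)) (derive_tensor1 B tA.1)).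
have D2 x : 'D_(0, 1) (fun z : R * R => A z.1 * B z.2) (x, t) = A x * derive1 B t.
  exact: (congr1 (fun f => f (x, t)) (derive_tensor2 A tB.1)).
pose E (f : R -> R) x := `|f x - k| * (A x * derive1 B t)
  + `|f x `^ m - k `^ m| * (derive1 A x * B t)
  + Num.sg (f x - k) * phi (f x) * (A x * B t).
have mA : measurable_fun setT A by have [[]] := bA.
have mA' : measurable_fun setT (derive1 A) by have [[]] := bA'.
have mE (f : R -> R) : measurable_fun setT f -> measurable_fun setT (E f).
  move=> mf.
  have c (g : R -> R) : measurable_fun setT g -> measurable_fun setT (fun x => g (f x)).
    by move=> mg; exact: measurableT_comp.
  apply: measurable_funD; first apply: measurable_funD.
  - apply: measurable_funM; first exact: (c (fun v => `|v - k|) n1.1).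
    by apply: measurable_funM.
  - apply: measurable_funM; first exact: (c (fun v => `|v `^ m - k `^ m|) n2.1).
    by apply: measurable_funM.
  - apply: measurable_funM; last by apply: measurable_funM.
    apply: (c (fun v => Num.sg (v - k) * phi v)).
    by apply: measurable_funM.
have -> : (\int[mu]_x (`|u (x, t) - k| * 'D_(0, 1) (fun z : R * R => A z.1 * B z.2) (x, t) +
     `|u (x, t) `^ m - k `^ m| * 'D_(1, 0) (fun z : R * R => A z.1 * B z.2) (x, t) +
     Num.sg (u (x, t) - k) * phi (u (x, t)) * (A (x, t).1 * B (x, t).2))%:E)%E =
   (\int[mu]_x (E (fun x => u (x, t)) x)%:E)%E.
  by apply: eq_integral => x _; rewrite D1 D2.
have -> : (\int[mu]_x (E (fun x => u (x, t)) x)%:E)%E = (\int[mu]_x (E (w t) x)%:E)%E.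
  have ae : {ae mu, forall x, [set: R] x ->
      (E (fun x => u (x, t)) x)%:E = (E (w t) x)%:E}.
    by move: (uw t_gt0); apply: ae_imp => x; rewrite /E => ->.
  apply: ae_eq_integral => //; apply/measurable_EFinP; apply: mE; first exact: mut.
  by have [] := bw t.
have EE : E (w t) = (fun x => (derive1 B t * (`|w t x - k| * A x) +
    B t * (`|w t x `^ m - k `^ m| * derive1 A x)) -
    B t * ((Num.sg (w t x - k) * S (w t x)) * A x)).
  by apply/funext => x; rewrite /E phiS; ring.
have j1 := bcs_J t n1 bA; have j2 := bcs_J t n2 bA'; have j3 := bcs_J t n3 bA.
have bE : bcs (E (w t)).
  rewrite EE; apply: bcsB; last exact: bcsZ.
  by apply: bcsD; exact: bcsZ.
rewrite (I_EFin bE); congr EFin; rewrite EE IB; [|by apply: bcsD; exact: bcsZ|exact: bcsZ].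
rewrite ID; [|exact: bcsZ..]; rewrite !IZ// /G /J; ring.
Unshelve. all: by end_near.
Qed.

(** The entropy inequalities for the levels k and 0 are added: for v >= 0, |v
    - k| + |v| = 2 (v - k)^+ + k, and the analogous constant k^m of the flux
    disappears on integration against A'. The sum of the two sources is 2 S(v)
    for v > k and nonnegative otherwise. *)
Lemma entropy_subsol : subsol m beta w.
Proof.
move=> k A t t' c k0 tA A0 t0 tt' Hc.
have bA := test1_bcs tA; have tA' := test1_derive1 tA; have bA' := test1_bcs tA'.
have K0 := lip_ge0 M m1.
pose F := J (fun v => `|v - k| + `|v - 0|) A.
pose G s := 2 * J (fun v => pos (v `^ m - k `^ m)) (derive1 A) s
  - 2 * beta k * J (fun v => pos (v - k)) A s.
have FE s : F s = 2 * J (fun v => pos (v - k)) A s + k * I A.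
  rewrite -(J_cst k s bA) -JZ//; last exact: nice_pos.
  rewrite -JD//; [|exact/niceZ/nice_pos|exact: nice_cst].
  apply: eq_J => v /andP[v0 _].
  by rewrite subr0 (ger0_norm v0) mulr_natl pos2; ring.
have H : F t' - F t <= (t' - t) * (2 * c).
  have bF : bm F by apply: bm_J => //; apply: niceD; exact: nice_abs.
  have bG : bm G.
    apply: bmB; apply: bmM; try exact: bm_cst; apply: bm_J => //.
      exact: nice_powpos.
    exact: nice_pos.
  apply: (time_increment bF bG) => //.
  - apply: (J_continuous (K := 2)) => //.
      by apply: niceD; exact: nice_abs.
    move=> v v' _ _; rewrite opprD addrACA (le_trans (ler_normD _ _))//.
    rewrite mulr_natl mulr2n lerD//.
      by rewrite (le_trans (ler_dist_dist _ _))// opprB addrA subrK.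
    by rewrite (le_trans (ler_dist_dist _ _))// !subr0.
  - move=> s s0; apply: (@continuousB _ R^o R (fun s => 2 * _) (fun s => 2 * beta k * _)).
      apply: continuousM; first exact: cvg_cst.
      apply: (J_continuous (K := lip m M)) => //; first exact: nice_powpos.
      move=> v v' Hv Hv'; rewrite (le_trans (posB_norm _ _))//.
      by rewrite opprB addrA subrK powR_lip_norm.
    apply: continuousM; first exact: cvg_cst.
    apply: (J_continuous (K := 1)) => //; first exact: nice_pos.
    by move=> v v' _ _; rewrite mul1r (le_trans (posB_norm _ _))// opprB addrA subrK.
  - move=> B a tB a0 Ba B0.
    have bB := test1_bcs tB; have bB' := test1_bcs (test1_derive1 tB).
    have E1 := entropy_in_time k0 tA A0 tB a0 Ba B0.
    have E2 := entropy_in_time (lexx 0) tA A0 tB a0 Ba B0.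
    have := addr_ge0 E1 E2; rewrite -ID; [|exact: bcs_entropy..].
    move/le_trans; apply; apply: I_le.
    + by apply: bcsD; exact: bcs_entropy.
    + by apply: bcsD; exact: bcsMl.
    move=> s.
    have Q : J (fun v => `|v `^ m - k `^ m|) (derive1 A) s +
        J (fun v => `|v `^ m - 0 `^ m|) (derive1 A) s =
        2 * J (fun v => pos (v `^ m - k `^ m)) (derive1 A) s.
      transitivity (2 * J (fun v => pos (v `^ m - k `^ m)) (derive1 A) s +
          k `^ m * I (derive1 A)); last by rewrite (I_derive_test1 tA) mulr0 addr0.
      rewrite -(J_cst (k `^ m) s bA') -JZ//; last exact: nice_powpos.
      rewrite -!JD//; [|exact/niceZ/nice_powpos|exact: nice_cst|exact: nice_powabs|exact: nice_powabs].
      apply: eq_J => v /andP[v0 _].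
      rewrite (powR0 (lt0r_neq0 (lt_trans ltr01 m1))) subr0 (ger0_norm (powR_ge0 _ _)).
      by rewrite [2 * _]mulr_natl pos2; ring.
    have Sg : 2 * beta k * J (fun v => pos (v - k)) A s <=
        J (fun v => Num.sg (v - k) * S v) A s + J (fun v => Num.sg (v - 0) * S v) A s.
      rewrite -JZ//; last exact: nice_pos.
      rewrite -JD//; [|exact: nice_source..].
      apply: J_le => //; first exact/niceZ/nice_pos.
        by apply: niceD; exact: nice_source.
      move=> v /andP[v0 vM]; rewrite subr0.
      have sS : Num.sg v * S v = S v.
        by move: v0; rewrite le_eqVlt => /predU1P[<-|v0]; [rewrite S0 mulr0|rewrite gtr0_sg// mul1r].
      rewrite sS; have [kv|vk|->] := ltgtP k v.
      - rewrite pos_id ?subr_ge0 ?(ltW kv)// gtr0_sg ?subr_gt0// mul1r.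
        by rewrite -mulrA -mulr2n -[leRHS]mulr_natl ler_wpM2l// betaS// ltW.
      - by rewrite pos_eq0 ?subr_le0 ?(ltW vk)// ltr0_sg ?subr_lt0// mulr0 mulN1r addNr.
      - by rewrite subrr pos_id// sgr0 mulr0 mul0r add0r S_ge0.
    have FA : F s = J (fun v => `|v - k|) A s + J (fun v => `|v - 0|) A s.
      by rewrite /F JD//; exact: nice_abs.
    rewrite FA /G -Q; have Bs := B0 s.
    exact: entropy_budget (ler_wpM2r Bs Sg).
  - by move=> s sH; exact: double_le (Hc s sH).
by rewrite !FE in H; exact: half_le H.
Qed.

(** The entropy inequalities for k and for a level k' above all values of w
    are added: |v - k| + |v - k'| = 2 (k - v)^+ + k' - k. The sources cancel
    for v > k and amount to -2 S(v) >= -2 S(k) for v < k. *)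
Lemma entropy_supersol : supersol m S w.
Proof.
move=> k A t t' c k0 tA A0 t0 tt' Hc.
have bA := test1_bcs tA; have tA' := test1_derive1 tA; have bA' := test1_bcs tA'.
have K0 := lip_ge0 M m1.
(* a level above all values of w *)
pose k' := M + 1.
have k'0 : 0 <= k' by rewrite addr_ge0// ltW.
have vk' v : 0 <= v <= M -> v < k'.
  by move=> /andP[_ vM]; rewrite (le_lt_trans vM)// ltrDl.
have pk' v : 0 <= v <= M -> v `^ m <= k' `^ m.
  move=> vM; have /andP[v0 _] := vM.
  by apply: ge0_ler_powR => //; rewrite ?nnegrE// ltW// vk'.
clearbody k'.
have neg_abs (x y : R) : `|x - y| = 2 * pos (y - x) + (x - y).
  by rewrite mulr_natl pos2 distrC; ring.
pose F := J (fun v => `|v - k| + `|v - k'|) A.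
pose G s := 2 * J (fun v => pos (k `^ m - v `^ m)) (derive1 A) s + 2 * (S k * I A).
have FE s : F s = 2 * J (fun v => pos (k - v)) A s + (k' - k) * I A.
  rewrite -(J_cst (k' - k) s bA) -JZ//; last exact: nice_neg.
  rewrite -JD//; [|exact/niceZ/nice_neg|exact: nice_cst].
  apply: eq_J => v Hv.
  by rewrite (ler0_norm (x := v - k')) ?subr_le0 ?(ltW (vk' _ Hv))// neg_abs; ring.
have H : F t' - F t <= (t' - t) * (2 * c).
  have bF : bm F by apply: bm_J => //; apply: niceD; exact: nice_abs.
  have bG : bm G.
    apply: bmD; last exact: bm_cst.
    by apply: bmM; [exact: bm_cst|apply: bm_J => //; exact: nice_powneg].
  apply: (time_increment bF bG) => //.
  - apply: (J_continuous (K := 2)) => //.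
      by apply: niceD; exact: nice_abs.
    move=> v v' _ _; rewrite opprD addrACA (le_trans (ler_normD _ _))//.
    rewrite mulr_natl mulr2n lerD//.
      by rewrite (le_trans (ler_dist_dist _ _))// opprB addrA subrK.
    by rewrite (le_trans (ler_dist_dist _ _))// opprB addrA subrK.
  - move=> s s0; apply: (@continuousD _ R^o R (fun s => 2 * _) (fun s => 2 * _)).
      apply: continuousM; first exact: cvg_cst.
      apply: (J_continuous (K := lip m M)) => //; first exact: nice_powneg.
      move=> v v' Hv Hv'; rewrite (le_trans (posB_norm _ _))//.
      by rewrite opprB addrC addrA subrK distrC powR_lip_norm.
    exact: cvg_cst.
  - move=> B a tB a0 Ba B0.
    have bB := test1_bcs tB; have bB' := test1_bcs (test1_derive1 tB).
    have E1 := entropy_in_time k0 tA A0 tB a0 Ba B0.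
    have E2 := entropy_in_time k'0 tA A0 tB a0 Ba B0.
    have := addr_ge0 E1 E2; rewrite -ID; [|exact: bcs_entropy..].
    move/le_trans; apply; apply: I_le.
    + by apply: bcsD; exact: bcs_entropy.
    + by apply: bcsD; exact: bcsMl.
    move=> s.
    have Q : J (fun v => `|v `^ m - k `^ m|) (derive1 A) s +
        J (fun v => `|v `^ m - k' `^ m|) (derive1 A) s =
        2 * J (fun v => pos (k `^ m - v `^ m)) (derive1 A) s.
      transitivity (2 * J (fun v => pos (k `^ m - v `^ m)) (derive1 A) s +
          (k' `^ m - k `^ m) * I (derive1 A)); last by rewrite (I_derive_test1 tA) mulr0 addr0.
      rewrite -(J_cst (k' `^ m - k `^ m) s bA') -JZ//; last exact: nice_powneg.
      rewrite -!JD//; [|exact/niceZ/nice_powneg|exact: nice_cst|exact: nice_powabs|exact: nice_powabs].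
      apply: eq_J => v Hv.
      by rewrite (ler0_norm (x := v `^ m - k' `^ m)) ?subr_le0 ?pk'// neg_abs; ring.
    have Sg : - (2 * (S k * I A)) <=
        J (fun v => Num.sg (v - k) * S v) A s + J (fun v => Num.sg (v - k') * S v) A s.
      rewrite mulrA -mulNr -(J_cst _ s bA).
      rewrite -JD//; [|exact: nice_source..].
      apply: J_le => //; first exact: nice_cst.
        by apply: niceD; exact: nice_source.
      move=> v Hv; have /andP[v0 vM] := Hv.
      rewrite (ltr0_sg (x := v - k')) ?subr_lt0 ?vk'// mulN1r.
      have Sk0 := S_ge0 k0; have Sv0 := S_ge0 v0.
      have [kv|vk|kv] := ltgtP k v.
      - by rewrite gtr0_sg ?subr_gt0// mul1r subrr oppr_le0 mulr_ge0.
      - rewrite ltr0_sg ?subr_lt0// mulN1r -opprD lerN2 -mulr2n -[leLHS]mulr_natl.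
        by rewrite ler_wpM2l// S_le// ltW.
      - by rewrite kv subrr sgr0 mul0r sub0r lerN2 ler_peMl// ?ler1n// -kv.
    have FA : F s = J (fun v => `|v - k|) A s + J (fun v => `|v - k'|) A s.
      by rewrite /F JD//; exact: nice_abs.
    rewrite FA /G -Q -[2 * (S k * I A)]opprK; have Bs := B0 s.
    exact: entropy_budget (ler_wpM2r Bs Sg).
  - by move=> s sH; exact: double_leD (Hc s sH).
by rewrite !FE in H; exact: half_le H.
Qed.

End entropy_to_semi_solutions.

(** * The maximum principle *)

Section good_representatives.
Context {R : realType}.
Local Notation mu := (@lebesgue_measure R).

Lemma flow_le M M' (w : R -> R -> R) : flow M w -> M <= M' -> flow M' w.
Proof.
move=> [bw wM cw] MM'; split => // t x.
by have /andP[-> wx] := wM t x; exact: le_trans MM'.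
Qed.

Lemma flow_cst (M kappa : R) : 0 <= kappa <= M -> flow M (fun _ _ => kappa).
Proof.
move=> kM; split => // [t|t r e t0 e0]; first exact: bm_cst.
by exists 1 => // s _; rewrite l1xx ltW.
Qed.

Lemma supersol_cst m (kappa : R) : supersol m (fun=> 0) (fun _ _ => kappa).
Proof.
move=> k A t t' c k0 tA A0 t0 tt' Hc.
have := Hc t; rewrite lexx tt' => /(_ isT).
rewrite mul0r addr0 IZ; last exact/test1_bcs/test1_derive1.
by rewrite (I_derive_test1 tA) mulr0 subrr => c0; rewrite mulr_ge0// subr_ge0.
Qed.

Lemma I_window_le (f psi : R -> R) (r : R) : bm f -> (forall x, 0 <= f x) -> bcs psi ->
  (forall x, 0 <= psi x) -> (forall x, `|x| <= r -> (1 + r ^+ 2)^-1 <= psi x) ->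
  I (fun x => f x * window r x) <= (1 + r ^+ 2) * I (fun x => f x * psi x).
Proof.
move=> bf f0 bpsi psi0 psir.
have den : 0 < 1 + r ^+ 2 by rewrite ltr_pwDl// sqr_ge0.
rewrite -IZ; last exact: bcsMl.
apply: I_le; [by apply: bcsMl => //; exact: bcs_window|by apply: bcsZ; exact: bcsMl|] => x.
rewrite windowE; case: ifPn => xr; last by rewrite mulr0 mulr_ge0 ?(ltW den) ?mulr_ge0.
by rewrite mulrCA ler_wpM2l// -ler_pdivrMl// mulr1 psir.
Qed.

(** The defect e / L of the weight, integrated over its support [-L, L]. *)
Lemma weight_error (K M e L : R) : 0 < L -> K * M * (e / L) * (2 * L) = 2 * K * M * e.
Proof. by move=> L0; have := lt0r_neq0 L0 => ?; field. Qed.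

(** Comparison with the constant solution kappa, starting from a time s so
    small that w(s) is close to its initial value. *)
Lemma sup_bound m M beta (w : R -> R -> R) (f : R -> R) (kappa t r : R) : 1 < m ->
  flow M w -> subsol m beta w -> (forall k, 0 <= k -> 0 <= beta k) ->
  initial_value w f -> bm f -> (forall x, f x <= kappa) -> 0 <= kappa ->
  0 < t -> I (fun x => pos (w t x - kappa) * window r x) = 0.
Proof.
move=> m1 fw0 subw beta0 inw bf fk k0 t0.
pose M' := Num.max M kappa.
have kM' : 0 <= kappa <= M' by rewrite k0 le_max lexx orbT.
have fw : flow M' w by apply: (flow_le fw0); rewrite le_max lexx.
have M'0 : 0 <= M' by have /andP[x1 x2] := kM'; exact: le_trans x2.
have [bw wM _] := fw.
pose K := lip m M'; have K0 : 0 <= K by exact: lip_ge0.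
have bp q : bm (fun x => pos (w q x - kappa)).
  by apply: bm_pos; apply: bmB => //; exact: bm_cst.
apply/eqP; rewrite eq_le; apply/andP; split; last first.
  by apply: I_ge0 => x; rewrite mulr_ge0 ?pos_ge0 ?window_ge0.
apply/ler_addgt0Pr => e e0; rewrite add0r.
pose Q := (1 + r ^+ 2) * (expR (K * t) * (1 + t * (2 * K * M'))) + 1.
have KM0 : 0 <= 2 * K * M' by exact: mulr_ge0 (mulr_ge0 _ K0) M'0.
have r1 : 0 <= 1 + r ^+ 2 by rewrite addr_ge0// sqr_ge0.
have Q0 : 0 < Q.
  apply: ltr_wpDl => //; apply: mulr_ge0 => //.
  apply: mulr_ge0; first exact: expR_ge0.
  by apply: addr_ge0 => //; apply: mulr_ge0 => //; exact: ltW.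
pose e1 := e / Q; have e1_gt0 : 0 < e1 by rewrite divr_gt0.
have [psi [L [[L0 tpsi] psi01 psir psiL dpsi]]] := weight_exists r e1_gt0.
have psi0 x : 0 <= psi x by have /andP[] := psi01 x.
have [d d0 Hd] := inw L _ e1_gt0.
pose s := Num.min d t / 2.
have dt : 0 < Num.min d t by rewrite lt_min d0.
have s0 : 0 < s by rewrite divr_gt0.
have : s < Num.min d t by rewrite [ltRHS]splitr ltrDl.
rewrite lt_min => /andP[sd st].
have eL0 : 0 <= e1 / L by rewrite divr_ge0 ?ltW.
have C := compare (b := fun _ _ => kappa) (gamma := fun=> 0) (c := 0) (kappa := M')
  m1 (ltW L0) tpsi psi01 psiL fw
  (flow_cst kM') subw beta0 (@supersol_cst m kappa) (lexx 0) (fun _ _ => lexx 0)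
  (fun s x => proj2 (andP (wM s x))) eL0 dpsi s0 (ltW st).
have H1 : I (fun x => pos (w s x - kappa) * psi x) <= e1.
  apply: (@le_trans _ _ (l1 L (w s) f)); last by apply: Hd; rewrite s0.
  rewrite -[leRHS]mul1r; apply: I_weight_le => //.
  - exact: test1_bcs.
  - by move=> x; rewrite ger0_norm//; have /andP[] := psi01 x.
  - by move=> x; rewrite (le_trans _ (pos_norm _))// le_pos// lerD2l lerN2.
  - by move=> x; exact: pos_ge0.
apply: (le_trans (I_window_le (bp t) (fun x => pos_ge0 _) (test1_bcs tpsi) psi0 psir)).
apply: (@le_trans _ _ ((1 + r ^+ 2) * (expR (K * t) * (e1 + t * (2 * K * M' * e1))))).
  apply: ler_wpM2l => //; apply: (le_trans C); rewrite -/K.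
  rewrite addr0 weight_error//; apply: ler_pM.
  - exact: expR_ge0.
  - rewrite addr_ge0//; first by apply: I_ge0 => x; rewrite mulr_ge0 ?pos_ge0.
    apply: mulr_ge0; first by rewrite subr_ge0 ltW.
    by apply: mulr_ge0 => //; exact: ltW.
  - by rewrite ler_expR ler_wpM2l// gerBl ltW.
  - apply: lerD => //; apply: ler_wpM2r; last by rewrite gerBl ltW.
    by apply: mulr_ge0 => //; exact: ltW.
have : e1 * Q = e by rewrite /e1 divfK// gt_eqF.
move=> <-; rewrite /Q [leRHS]mulrDr mulr1 ler_wpDr ?(ltW e1_gt0)//.
by rewrite le_eqVlt; apply/orP; left; apply/eqP; ring.
Qed.

Section ae_congruence.
Variables (m M M' : R) (w w' : R -> R -> R).
Hypotheses (m1 : 1 < m) (fw : flow M w) (fw' : flow M' w')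
  (ww' : forall t, 0 < t -> {ae mu, forall x, w t x = w' t x}).

Let m0 : 0 <= m. Proof. by rewrite ltW// (lt_trans _ m1). Qed.

Let I_congr (g A : R -> R) t : 0 < t ->
  (forall (p : R -> R), bm p -> (forall x, 0 <= p x) -> bm (fun x => g (p x))) ->
  bcs A -> I (fun x => g (w t x) * A x) = I (fun x => g (w' t x) * A x).
Proof.
move=> t0 bg bA; have [bw wM _] := fw; have [bw' wM' _] := fw'.
apply: I_ae_eq.
- by apply: bcsMl => //; apply: bg => // x; have /andP[] := wM t x.
- by apply: bcsMl => //; apply: bg => // x; have /andP[] := wM' t x.
- by move: (ww' t0); apply: ae_imp => x ->.
Qed.

Lemma subsol_ae beta : subsol m beta w -> subsol m beta w'.
Proof.
move=> H k A t t' c k0 tA A0 t0 tt' Hc.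
have bA := test1_bcs tA; have bA' := test1_bcs (test1_derive1 tA).
have b1 (p : R -> R) : bm p -> (forall x, 0 <= p x) -> bm (fun x => pos (p x - k)).
  by move=> bp p0; apply: bm_pos; apply: bmB => //; exact: bm_cst.
have b2 (p : R -> R) : bm p -> (forall x, 0 <= p x) -> bm (fun x => pos (p x `^ m - k `^ m)).
  by move=> bp p0; apply: bm_pos; apply: bmB; [exact: bm_powR|exact: bm_cst].
rewrite -!(I_congr (g := fun v => pos (v - k)))//; last exact: lt_le_trans tt'.
apply: (H k A t t' c k0 tA A0 t0 tt') => s ts; have s0 : 0 < s by apply: lt_le_trans (proj1 (andP ts)).
have := Hc s ts.
rewrite -(I_congr (g := fun v => pos (v - k)) s0 b1 bA).
by rewrite -(I_congr (g := fun v => pos (v `^ m - k `^ m)) s0 b2 bA').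
Qed.

Lemma supersol_ae gamma : supersol m gamma w -> supersol m gamma w'.
Proof.
move=> H k A t t' c k0 tA A0 t0 tt' Hc.
have bA := test1_bcs tA; have bA' := test1_bcs (test1_derive1 tA).
have b1 (p : R -> R) : bm p -> (forall x, 0 <= p x) -> bm (fun x => pos (k - p x)).
  by move=> bp p0; apply: bm_pos; apply: bmB => //; exact: bm_cst.
have b2 (p : R -> R) : bm p -> (forall x, 0 <= p x) -> bm (fun x => pos (k `^ m - p x `^ m)).
  by move=> bp p0; apply: bm_pos; apply: bmB; [exact: bm_cst|exact: bm_powR].
rewrite -!(I_congr (g := fun v => pos (k - v)))//; last exact: lt_le_trans tt'.
apply: (H k A t t' c k0 tA A0 t0 tt') => s ts; have s0 : 0 < s by apply: lt_le_trans (proj1 (andP ts)).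
have := Hc s ts.
by rewrite -(I_congr (g := fun v => pos (k `^ m - v `^ m)) s0 b2 bA').
Qed.

End ae_congruence.

(** By the maximum principle, cutting at the bound kappa of the initial value
    alters the representative on null sets only. The bound kappa does not
    depend on the damping, hence is common to all exponents p. *)
Lemma kruzkov_representative (m kappa : R) (phi S beta : R -> R) (u0 f : R -> R)
    (u : R * R -> R) : 1 < m -> 0 < kappa ->
  measurable_fun setT phi -> (forall v, phi v = - S v) -> S 0 = 0 ->
  (forall v, 0 <= v -> 0 <= S v) ->
  (forall v v', 0 <= v -> v <= v' -> S v <= S v') ->
  (forall k, 0 <= k -> 0 <= beta k) ->
  (forall k v, 0 <= k -> k <= v -> beta k * (v - k) <= S v) ->
  kruzkov_solution m phi u0 u -> continuous_L1loc u ->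
  measurable_fun setT u0 -> bm f -> (forall x, 0 <= f x <= kappa) ->
  {ae mu, forall x, u0 x = f x} ->
  exists w, [/\ flow kappa w, subsol m beta w, supersol m S w, initial_value w f &
    forall t, 0 < t -> {ae mu, forall x, u (x, t) = w t x}].
Proof.
move=> m1 k0 mphi phiS S0 S_ge0 S_le beta0 betaS [uL ent ut] uc mu0 bf fk u0f.
have [M [w [M0 fw bw2 uw inw]]] := representative uL uc ut mu0.
have mut t : 0 < t -> measurable_fun setT (fun x => u (x, t)).
  by move=> t0; have [] := uc.1 t t0.
have subw := entropy_subsol m1 M0 fw bw2 mut uw ent mphi phiS S0 S_ge0 S_le betaS.
have superw := entropy_supersol m1 M0 fw bw2 mut uw ent mphi phiS S_ge0 S_le.
have {}inw := inw f bf u0f.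
have [bw wM cw] := fw.
pose w' t x := Num.min (w t x) kappa.
have bw' t : bm (w' t) by apply: bm_min => //; exact: bm_cst.
have minE (a : R) : a - Num.min a kappa = pos (a - kappa).
  rewrite /pos; case: (leP a kappa) => ak; first by rewrite subrr max_r// subr_le0.
  by rewrite max_l// subr_ge0 ltW.
have ww' t : 0 < t -> {ae mu, forall x, w t x = w' t x}.
  move=> t0; apply: L1dist_eq0; [exact: (bw t).1|exact: (bw' t).1|] => r r0.
  rewrite L1distE// /l1.
  have := sup_bound (kappa := kappa) r m1 fw subw beta0 inw bf
    (fun x => proj2 (andP (fk x))) (ltW k0) t0.
  move=> E0; rewrite -[RHS]/((0 : R)%:E) -E0; congr ((I _)%:E); apply/funext => x.
  by rewrite /w' minE ger0_norm ?pos_ge0.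
have minc (a b : R) : `|Num.min a kappa - Num.min b kappa| <= `|a - b|.
  have E (c : R) : Num.min c kappa = kappa - pos (kappa - c).
    rewrite /pos; case: (leP c kappa) => ck.
      by rewrite max_l ?subr_ge0// subKr.
    by rewrite max_r ?subr0// subr_le0 ltW.
  rewrite !E (_ : _ - _ = pos (kappa - b) - pos (kappa - a)); last by ring.
  apply: (le_trans (posB_norm _ _)).
  by rewrite (_ : _ - _ = a - b)//; ring.
have l1c r s (g : R -> R) : bm g -> (forall x, Num.min (g x) kappa = g x) ->
    l1 r (w' s) g <= l1 r (w s) g.
  move=> bg gk; apply: I_le; [exact: bcs_l1..|] => x.
  by rewrite ler_wpM2r ?window_ge0// -{1}(gk x) minc.
have fw' : flow kappa w'.
  split => // [t x|t r e t0 e0].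
    have /andP[w0 _] := wM t x.
    by rewrite /w' le_min w0 (ltW k0)/= ge_min lexx orbT.
  have [d d0 Hd] := cw t r e t0 e0; exists d => // s /Hd; apply: le_trans.
  apply: I_le; [exact: bcs_l1..|] => x.
  by rewrite ler_wpM2r ?window_ge0// minc.
exists w'; split.
- exact: fw'.
- exact: (subsol_ae m1 fw fw' ww').
- exact: (supersol_ae m1 fw fw' ww').
- move=> r e e0; have [d d0 Hd] := inw r e e0; exists d => // t /Hd; apply: le_trans.
  apply: l1c => // x; apply/min_idPl; by have /andP[] := fk x.
- move=> t t0; have := ae_and (uw _ t0) (ww' _ t0).
  by apply: ae_imp => x [-> ->].
Qed.

End good_representatives.

(** * Large exponents, scaling and damping *)

Section thresholds.
Context {R : realType}.

Lemma powR_small (lam d : R) : 0 < lam -> lam < 1 -> 0 < d ->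
  exists P : R, forall p, P <= p -> lam `^ p <= d.
Proof.
move=> l0 l1 d0; have ln0 : ln lam < 0 by rewrite ln_lt0// l0.
exists (ln d / ln lam) => p.
rewrite ler_ndivrMr// => H.
by rewrite /powR gt_eqF// -ler_ln ?posrE ?expR_gt0// expRK.
Qed.

Lemma damping_small (kappa K tau d : R) : 1 < kappa -> 0 < tau -> 0 < d ->
  exists P : R, forall p, P <= p -> expR ((K - kappa `^ (p - 1)) * tau) <= d.
Proof.
move=> k1 t0 d0; have k0 : 0 < kappa by exact: lt_trans k1.
have ln0 : 0 < ln kappa by rewrite ln_gt0.
exists (1 + (K - ln d / tau) / ln kappa) => p.
rewrite -lerBrDl ler_pdivrMr// => H.
rewrite -ler_ln ?posrE ?expR_gt0// expRK -ler_pdivlMr//.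
have : 1 + (p - 1) * ln kappa <= kappa `^ (p - 1).
  by rewrite /powR gt_eqF//; exact: expR_ge1Dx.
by move: H; clear => *; lra.
Qed.

Lemma near1_powR (q a : R) : 0 < a -> exists2 lam : R, 0 < lam < 1 &
  1 - lam <= a /\ `|lam `^ q - 1| < a.
Proof.
move=> a0.
have C : {for (1:R), continuous (fun x : R => x `^ q)}.
  apply: differentiable_continuous; apply/derivable1_diffP.
  by have := is_derive1_powR q (@ltr01 R); case.
move: C => /cvgrPdist_lt/(_ _ a0)/nbhs_ballP[d /= d0 H].
rewrite powR1 in H.
pose b := Num.min (Num.min d a) 1 / 2.
have b0' : 0 < Num.min (Num.min d a) 1 by rewrite !lt_min d0 a0 ltr01.
have b0 : 0 < b by rewrite divr_gt0.
have : b < Num.min (Num.min d a) 1 by rewrite [ltRHS]splitr ltrDl.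
rewrite !lt_min => /andP[/andP[bd ba] b1].
exists (1 - b); first by rewrite subr_gt0 b1/= gtrBl.
split; first by rewrite subKr ltW.
by rewrite distrC; apply: H; rewrite /ball/= subKr gtr0_norm.
Qed.

End thresholds.

Section scaling.
Context {R : realType}.
Variables (m M lam : R) (v : R -> R -> R).
Hypotheses (m1 : 1 < m) (lam0 : 0 < lam) (fv : flow M v).

Let m0 : 0 <= m. Proof. by rewrite ltW// (lt_trans _ m1). Qed.
Let q := lam `^ (m - 1).
Let q0 : 0 < q. Proof. exact: powR_gt0. Qed.
Let lamq : lam `^ m = lam * q.
Proof. by rewrite -(mulr_powRB1 (ltW lam0) (lt_trans ltr01 m1)). Qed.

(** The flux is homogeneous of degree m: multiplying a solution by lam slows
    it down by the factor lam^(m-1). *)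
Definition rescale t x := lam * v (lam `^ (m - 1) * t) x.

Lemma flow_rescale : flow (lam * M) rescale.
Proof.
have [bv vM cv] := fv; split.
- by move=> t; apply: bmM => //; exact: bm_cst.
- move=> t x; have /andP[v0 v1] := vM (lam `^ (m - 1) * t) x.
  by rewrite /rescale mulr_ge0 ?(ltW lam0)//= ler_wpM2l// ltW.
move=> t r e t0 e0.
have [d d0 Hd] := cv (q * t) r (e / lam) (mulr_gt0 q0 t0) (divr_gt0 e0 lam0).
exists (d / q) => [|s sd]; first exact: divr_gt0.
have : l1 r (v (q * s)) (v (q * t)) <= e / lam.
  apply: Hd; rewrite -mulrBr normrM gtr0_norm// mulrC -ltr_pdivlMr//.
rewrite ler_pdivlMr// mulrC -IZ; last exact: bcs_l1.
apply: le_trans; rewrite le_eqVlt; apply/orP; left; apply/eqP; congr I.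
by apply/funext => x; rewrite /rescale -mulrBr normrM (gtr0_norm lam0) mulrA.
Qed.

Lemma subsol_rescale : subsol m (fun=> 0) v -> subsol m (fun=> 0) rescale.
Proof.
have [bv vM cv] := fv.
have v0 t x : 0 <= v t x by have /andP[] := vM t x.
move=> sv k A t t' c k0 tA A0 t0 tt' Hc.
have bA := test1_bcs tA; have bA' := test1_bcs (test1_derive1 tA).
have k'0 : 0 <= k / lam by rewrite divr_ge0// ltW.
have kE : k = lam * (k / lam) by rewrite mulrC divfK// gt_eqF.
have b1 t1 : bcs (fun x => pos (v t1 x - k / lam) * A x).
  by apply: bcsMl => //; apply: bm_pos; apply: bmB => //; exact: bm_cst.
have b2 t1 : bcs (fun x => pos (v t1 x `^ m - (k / lam) `^ m) * derive1 A x).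
  by apply: bcsMl => //; apply: bm_pos; apply: bmB; [exact: bm_powR|exact: bm_cst].
have E1 s : I (fun x => pos (rescale s x - k) * A x) =
    lam * I (fun x => pos (v (q * s) x - k / lam) * A x).
  rewrite -IZ//; congr I; apply/funext => x.
  by rewrite {1}kE /rescale -mulrBr posMl ?(ltW lam0)// mulrA.
have E2 s : I (fun x => pos (rescale s x `^ m - k `^ m) * derive1 A x) =
    lam * q * I (fun x => pos (v (q * s) x `^ m - (k / lam) `^ m) * derive1 A x).
  rewrite -IZ//; congr I; apply/funext => x.
  rewrite {1}kE /rescale (@powRM _ lam (v _ x) m) ?(ltW lam0)//.
  rewrite (@powRM _ lam (k / lam) m) ?(ltW lam0)// lamq -mulrBr posMl ?mulrA//.
  by rewrite mulr_ge0// ltW.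
have lq0 : 0 < lam * q by exact: mulr_gt0.
have := sv (k / lam) A (q * t) (q * t') (c / (lam * q)) k'0 tA A0.
move=> /(_ _ _ _)/wrap[|||H].
- exact: mulr_gt0.
- by rewrite ler_pM2l.
- move=> s /andP[ts st]; rewrite mul0r subr0 ler_pdivlMr// mulrC.
  have -> : s = q * (s / q) by rewrite mulrC divfK// gt_eqF.
  have := Hc (s / q); rewrite mul0r subr0 E2; apply.
  by rewrite ler_pdivlMr// mulrC ts/= ler_pdivrMr// mulrC.
rewrite !E1 -mulrBr -ler_pdivlMl//; apply: (le_trans H).
rewrite le_eqVlt; apply/orP; left; apply/eqP.
by have lq := lt0r_neq0 q0; have ll := lt0r_neq0 lam0; field; rewrite ll lq.
Qed.

Lemma initial_value_rescale f : bm f -> initial_value v f ->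
  initial_value rescale (fun x => lam * f x).
Proof.
have [bv vM cv] := fv; move=> bf H r e e0.
have [d d0 Hd] := H r (e / lam) (divr_gt0 e0 lam0).
exists (d / q) => [|t /andP[t0 td]]; first exact: divr_gt0.
have : l1 r (v (q * t)) f <= e / lam.
  by apply: Hd; rewrite mulr_gt0//= mulrC -ltr_pdivlMr.
rewrite ler_pdivlMr// mulrC -IZ; last exact: bcs_l1.
apply: le_trans; rewrite le_eqVlt; apply/orP; left; apply/eqP; congr I.
by apply/funext => x; rewrite /rescale -mulrBr normrM (gtr0_norm lam0) mulrA.
Qed.

End scaling.

Section decay.
Context {R : realType}.
Variables (m M : R) (psi : R -> R) (L e kappa : R).
Hypotheses (m1 : 1 < m) (L0 : 0 < L) (e0 : 0 <= e) (kM : 0 <= kappa <= M).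
Hypotheses (tpsi : test1 psi) (psi01 : forall x, 0 <= psi x <= 1).
Hypotheses (psiL : vanish L psi) (dpsi : forall x, `|derive1 psi x| <= psi x + e / L).

Let K := lip m M.

(** The flux of the excess is at most K times the excess and |psi'| at most
    psi up to the defect of the weight, whence a growth at the rate K, against
    which the damping acts at the rate beta kappa. *)
Lemma excess_decay beta (w : R -> R -> R) (s t : R) : flow M w -> subsol m beta w ->
  0 < s -> s <= t ->
  I (fun x => pos (w t x - kappa) * psi x) <=
    expR ((K - beta kappa) * (t - s)) * I (fun x => pos (w s x - kappa) * psi x) +
    expR (Num.max (K - beta kappa) 0 * (t - s)) * ((t - s) * (2 * K * M * e)).
Proof.
move=> fw subw s0 st; have [bw wM cw] := fw.
have K0 : 0 <= K by exact: lip_ge0.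
have M0 : 0 <= M by have /andP[x1 x2] := kM; exact: le_trans x2.
have KM0 : 0 <= 2 * K * M * e by exact: mulr_ge0 (mulr_ge0 (mulr_ge0 _ K0) M0) e0.
have psi0 x : 0 <= psi x by have /andP[] := psi01 x.
have w0 q x : 0 <= w q x by have /andP[] := wM q x.
have k0 : 0 <= kappa by have /andP[] := kM.
have m0 : 0 <= m by rewrite ltW// (lt_trans _ m1).
have bA := test1_bcs tpsi; have tA' := test1_derive1 tpsi; have bA' := test1_bcs tA'.
have dpsiL : vanish L (derive1 psi) by apply: derive1_vanishing => //; exact: tpsi.1.
have bp q : bm (fun x => pos (w q x - kappa)).
  by apply: bm_pos; apply: bmB => //; exact: bm_cst.
have bpm q : bm (fun x => pos (w q x `^ m - kappa `^ m)).
  by apply: bm_pos; apply: bmB; [exact: bm_powR|exact: bm_cst].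
pose D q := I (fun x => pos (w q x - kappa) * psi x).
have D0 q : 0 <= D q by apply: I_ge0 => x; rewrite mulr_ge0 ?pos_ge0.
have eL0 : 0 <= e / L by rewrite divr_ge0// ltW.
have flux_le q : I (fun x => pos (w q x `^ m - kappa `^ m) * derive1 psi x) <=
    K * D q + 2 * K * M * e.
  rewrite -(weight_error K M e L0) -(I_window (ltW L0)).
  rewrite /D -(IZ K (bcsMl (bp q) bA)) -(IZ _ (@bcs_window R L)).
  rewrite -ID; [|apply: bcsZ; exact: bcsMl|apply: bcsZ; exact: bcs_window].
  apply: I_le; [exact: bcsMl| |] .
    by apply: bcsD; apply: bcsZ; [exact: bcsMl|exact: bcs_window].
  move=> x; rewrite windowE; case: ifPn => xL; last first.
    rewrite dpsiL ?ltNge// !mulr0 addr0.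
    by apply: mulr_ge0 => //; apply: mulr_ge0 => //; exact: pos_ge0.
  rewrite mulr1.
  set p := pos (w q x `^ m - kappa `^ m); have p0 : 0 <= p by exact: pos_ge0.
  have pK : p <= K * pos (w q x - kappa) by exact: powR_lip_pos.
  have qM : pos (w q x - kappa) <= M.
    rewrite pos_le// (@le_trans _ _ (w q x)) ?gerBl//.
    by have /andP[] := wM q x.
  apply: (@le_trans _ _ (p * (psi x + e / L))).
    by rewrite ler_wpM2l// (le_trans _ (dpsi _))// ler_norm.
  rewrite mulrDr lerD//; first by rewrite mulrA ler_wpM2r.
  by rewrite ler_wpM2r// (le_trans pK)// ler_wpM2l.
have := @gronwall R D s t (K - beta kappa) _ st KM0 D0; apply.
move=> e1 e1_gt0.
pose B := `|K - beta kappa| + 1.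
have B0 : 0 < B by rewrite ltr_wpDl.
have eB : 0 < e1 / B by exact: divr_gt0.
have [d d0 Hd] := flow_uniform t L fw s0 eB.
exists d => // r r' sr rr' r't rd.
have r0 : 0 < r by exact: lt_le_trans sr.
apply: (subw kappa psi r r') => // q /andP[rq qr'].
have near_q : l1 L (w q) (w r) <= e1 / B.
  rewrite l1C; apply: Hd; first by rewrite sr (le_trans rr').
  by rewrite ger0_norm ?subr_ge0// (le_lt_trans _ rd)// lerD2r.
have Dqr : `|D q - D r| <= e1 / B.
  apply: le_trans near_q; rewrite /D -IB; [|exact: bcsMl..].
  have bd : bcs (fun x => pos (w q x - kappa) * psi x - pos (w r x - kappa) * psi x).
    by apply: bcsB; exact: bcsMl.
  apply: (le_trans (I_norm bd)).
  apply: I_le; [exact: bcs_norm|exact: bcs_l1|] => x.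
  rewrite -mulrBl normrM windowE; case: ifPn => xL; last first.
    by rewrite psiL ?normr0 ?mulr0// ltNge.
  rewrite mulr1 (ger0_norm (psi0 x)) (@le_trans _ _ `|pos (w q x - kappa) - pos (w r x - kappa)|)//.
    by rewrite ler_piMr//; have /andP[] := psi01 x.
  by rewrite (le_trans (posB_norm _ _))// opprB addrA subrK.
have F := flux_le q; rewrite -/(D q) in F *.
have H : (K - beta kappa) * (D q - D r) <= e1.
  apply: (le_trans (ler_norm _)); rewrite normrM.
  apply: (@le_trans _ _ (B * (e1 / B))); last by rewrite mulrC divfK// gt_eqF.
  by rewrite ler_pM// lerDl.
apply: (@le_trans _ _ (K * D q + 2 * K * M * e - beta kappa * D q)).
  by rewrite lerD2r.
rewrite (_ : _ - _ = (K - beta kappa) * D r + 2 * K * M * e +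
  (K - beta kappa) * (D q - D r)); last by ring.
by rewrite lerD2l.
Qed.

End decay.

(** * The lower and the upper bound *)

Lemma small_factor (R : realType) (c e : R) : 0 <= c -> 0 < e ->
  exists2 d : R, 0 < d & c * d <= e.
Proof.
move=> c0 e0; have den : 0 < c + 1 by rewrite ltr_wpDl.
exists (e / (c + 1)); first exact: divr_gt0.
by rewrite mulrCA ler_piMr ?(ltW e0)// ler_pdivrMr// mul1r lerDl.
Qed.

Lemma lower_budget (R : realType) (eps a b x E r2 k e l h : R) :
  0 <= E -> 0 <= r2 -> x <= E * (2 * h + (k * e + l)) ->
  r2 * E * (2 * h) <= eps / 8 -> r2 * E * k * e <= eps / 8 -> r2 * E * l <= eps / 8 ->
  a <= eps / 8 -> b <= eps / 8 -> 0 < eps ->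
  a + b + r2 * x <= eps.
Proof.
move=> E0 r0 xE H1 H2 H3 H4 H5 e0.
have := ler_wpM2l r0 xE.
rewrite (_ : r2 * (E * (2 * h + (k * e + l))) =
  r2 * E * (2 * h) + r2 * E * k * e + r2 * E * l); last by ring.
lra.
Qed.

Lemma sub_le_dist (R : realType) (z w a b : R) : a <= b ->
  z - w <= `|z - a| + `|w - b|.
Proof.
move=> ab; have := ler_norm (z - a); have := ler_norm (b - w).
by rewrite (distrC b) => *; lra.
Qed.

Lemma sub_le_rescaled (R : realType) (v y w lam p : R) :
  (1 - lam) * y <= 1 - lam -> lam * y - w <= p ->
  v - w <= `|v - y| + (1 - lam) + p.
Proof. by move=> *; have := ler_norm (v - y) => *; lra. Qed.

Lemma upper_budget (R : realType) (eps E r2 x y a b c g damp q h : R) :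
  0 <= E -> 1 <= E -> 0 <= r2 -> 0 <= q -> x <= E * (y + q) -> y <= a + b + c + g ->
  a <= damp + E * q -> damp <= h -> b <= h -> c <= h -> g <= h ->
  r2 * E * h <= eps / 8 -> r2 * E * E * q <= eps / 8 -> 0 < eps ->
  r2 * x <= eps.
Proof.
move=> E0 E1 r0 q0 xE ya aq dh bh ch gh H1 H2 e0.
have rE0 : 0 <= r2 * E by exact: mulr_ge0.
have qE : r2 * E * q <= r2 * E * E * q.
  by rewrite ler_wpM2r// ler_peMr.
have y4 : y <= 4 * h + E * q by lra.
have := ler_wpM2l r0 xE; rewrite mulrA => H.
have := ler_wpM2l rE0 (lerD y4 (lexx q)).
rewrite (_ : r2 * E * (4 * h + E * q + q) =
  4 * (r2 * E * h) + r2 * E * E * q + r2 * E * q); last by ring.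
lra.
Qed.

Lemma sub_le_layers (R : realType) (w f v kappa : R) : 1 <= kappa ->
  w - v <= pos (w - kappa) + (kappa - 1) + pos (w - f) + `|v - Num.min f 1|.
Proof.
move=> k1.
have := ler_pos (w - kappa); have := ler_pos (w - f).
have := pos_ge0 (w - kappa); have := pos_ge0 (w - f).
have := ler_norm (Num.min f 1 - v); rewrite distrC.
by case: (leP f 1) => *; lra.
Qed.

Section convergence.
Context {R : realType}.
Variables (m M : R) (f0 : R -> R) (v : R -> R -> R) (t0 T r : R).
Hypotheses (m1 : 1 < m) (M2 : 2 <= M) (bf0 : bm f0) (f0M : forall x, 0 <= f0 x <= M).
Hypotheses (t0_gt0 : 0 < t0) (t0T : t0 < T) (r_gt0 : 0 < r).

Let f1 x := Num.min (f0 x) 1.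

Hypotheses (fv : flow 1 v) (subv : subsol m (fun=> 0) v)
  (superv : supersol m (fun=> 0) v) (inv : initial_value v f1).

Let K := lip m M.
Let E := expR (K * T).
Let r2 := 1 + r ^+ 2.

Let K0 : 0 <= K. Proof. exact: lip_ge0. Qed.
Let M0 : 0 <= M. Proof. exact: le_trans M2. Qed.
Let M1 : 1 <= M. Proof. by apply: le_trans M2; rewrite ler1n. Qed.
Let T0 : 0 < T. Proof. exact: lt_trans t0T. Qed.
Let E0 : 0 <= E. Proof. exact: expR_ge0. Qed.
Let E1 : 1 <= E.
Proof. by rewrite (le_trans _ (expR_ge1Dx _))// lerDl mulr_ge0// ltW. Qed.
Let r20 : 0 <= r2. Proof. by rewrite addr_ge0// sqr_ge0. Qed.
Let KM0 : 0 <= 2 * K * M. Proof. exact: mulr_ge0 (mulr_ge0 _ K0) M0. Qed.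
Let bf1 : bm f1. Proof. by apply: bm_min => //; exact: bm_cst. Qed.
Let f1_ge0 x : 0 <= f1 x.
Proof. by rewrite /f1 le_min ler01 andbT; have /andP[] := f0M x. Qed.
Let fvM : flow M v. Proof. exact: flow_le fv M1. Qed.

(** The solution w lies, up to a small error, above the rescaled solution z =
    lam v(lam^(m-1) t): the latter takes its values in [0, lam], where the
    source is at most lam^p, and starts below f0. *)
Lemma lower_bound (eps : R) : 0 < eps -> exists P : R, forall p w, P <= p ->
  flow M w -> supersol m (fun k => k `^ p) w -> initial_value w f0 ->
  forall t, t0 <= t <= T -> I (fun x => pos (v t x - w t x) * window r x) <= eps.
Proof.
move=> eps0; have e8 : 0 < eps / 8 by rewrite divr_gt0.
have rE0 : 0 <= r2 * E by exact: mulr_ge0.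
have [e e_gt0 He] : exists2 e : R, 0 < e & r2 * E * (T * (2 * K * M)) * e <= eps / 8.
  by apply: small_factor => //; apply: mulr_ge0 => //; apply: mulr_ge0 => //; exact: ltW.
have [psi [L [[L0 tpsi] psi01 psir psiL dpsi]]] := weight_exists r e_gt0.
have psi0 x : 0 <= psi x by have /andP[] := psi01 x.
have eL0 : 0 <= e / L by rewrite divr_ge0 ?ltW.
have [del del0 Hdel] : exists2 d : R, 0 < d & r2 * E * (T * (2 * L)) * d <= eps / 8.
  by apply: small_factor => //; apply: mulr_ge0 => //; apply: mulr_ge0;
    [exact: ltW|apply: mulr_ge0 => //; exact: ltW].
have [h h0 Hh] : exists2 d : R, 0 < d & r2 * E * 2 * d <= eps / 8.
  by apply: small_factor => //; exact: mulr_ge0.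
have [d d0 Hd] := flow_uniform T r fvM t0_gt0 e8.
have [a a0 Ha] : exists2 a : R, 0 < a & (2 * r) * a <= eps / 8.
  by apply: small_factor => //; apply: mulr_ge0 => //; exact: ltW.
(* lam is so close to 1 that the change of time scale stays below the modulus
   of continuity d of v *)
have a'0 : 0 < Num.min (d / T) a by rewrite lt_min a0 andbT divr_gt0.
have [lam /andP[lam0 lam1] [la lq]] := near1_powR (m - 1) a'0.
have [P HP] := powR_small lam0 lam1 del0.
exists (Num.max P 1) => p w; rewrite ge_max => /andP[/HP lp p1] fw superw inw t /andP[t0t tT].
have t_gt0 : 0 < t by exact: lt_le_trans t0t.
have [bw wM _] := fw; have [bv v1 _] := fv.
pose z := rescale m lam v.
have fz : flow lam z by have := flow_rescale m lam0 fv; rewrite mulr1.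
have fzM : flow M z by apply: flow_le fz _; rewrite (le_trans (ltW lam1)).
have subz : subsol m (fun=> 0) z by exact: (subsol_rescale m1 lam0 fv subv).
have inz : initial_value z (fun x => lam * f1 x) by exact: (initial_value_rescale m lam0 fv bf1 inv).
have [bz zl _] := fz.
have [d1 d1_gt0 Hd1] := inz L _ h0.
have [d2 d2_gt0 Hd2] := inw L _ h0.
pose s := Num.min (Num.min d1 d2) t / 2.
have s0' : 0 < Num.min (Num.min d1 d2) t by rewrite !lt_min d1_gt0 d2_gt0.
have s0 : 0 < s by rewrite divr_gt0.
have : s < Num.min (Num.min d1 d2) t by rewrite [ltRHS]splitr ltrDl.
rewrite !lt_min => /andP[/andP[sd1 sd2] st].
have gammac k : 0 <= k <= lam -> k `^ p <= lam `^ p.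
  move=> /andP[k0 kl]; apply: ge0_ler_powR => //; rewrite ?nnegrE//.
    exact: le_trans p1.
  exact: ltW.
have C := compare m1 (ltW L0) tpsi psi01 psiL fzM fw subz (fun _ _ => lexx 0) superw
  (powR_ge0 lam p) gammac (fun s x => proj2 (andP (zl s x))) eL0 dpsi s0 (ltW st).
have bpos (g g' : R -> R) : bm g -> bm g' -> bm (fun x => pos (g x - g' x)).
  by move=> bg bg'; apply: bm_pos; exact: bmB.
have bA := test1_bcs tpsi.
have start : I (fun x => pos (z s x - w s x) * psi x) <= 2 * h.
  have H1 : I (fun x => `|z s x - lam * f1 x| * psi x) <= h.
    apply: (@le_trans _ _ (l1 L (z s) (fun x => lam * f1 x))); last by apply: Hd1; rewrite s0.
    rewrite -[leRHS]mul1r; apply: I_weight_le => //; try by apply: bmM => //; exact: bm_cst.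
      by apply: bm_norm; apply: bmB => //; apply: bmM => //; exact: bm_cst.
    by move=> x; rewrite ger0_norm//; have /andP[] := psi01 x.
  have H2 : I (fun x => `|w s x - f0 x| * psi x) <= h.
    apply: (@le_trans _ _ (l1 L (w s) f0)); last by apply: Hd2; rewrite s0.
    rewrite -[leRHS]mul1r; apply: I_weight_le => //.
      by apply: bm_norm; exact: bmB.
    by move=> x; rewrite ger0_norm//; have /andP[] := psi01 x.
  have blf : bm (fun x => lam * f1 x) by apply: bmM => //; exact: bm_cst.
  have b1 : bcs (fun x => `|z s x - lam * f1 x| * psi x).
    by apply: bcsMl => //; apply: bm_norm; exact: bmB.
  have b2 : bcs (fun x => `|w s x - f0 x| * psi x).
    by apply: bcsMl => //; apply: bm_norm; exact: bmB.
  rewrite mulr_natl mulr2n; apply: le_trans (lerD H1 H2); rewrite -ID//.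
  apply: I_le; [by apply: bcsMl => //; exact: bpos|exact: bcsD|] => x.
  rewrite -mulrDl ler_wpM2r// pos_le ?addr_ge0//.
  have f10 : lam * f1 x <= f0 x.
    rewrite (@le_trans _ _ (f1 x))//; last by rewrite ge_min lexx.
    by rewrite ler_piMl// (ltW lam1).
  exact: sub_le_dist.
have X : I (fun x => pos (z t x - w t x) * psi x) <=
    E * (2 * h + (T * (2 * K * M) * e + T * (2 * L) * lam `^ p)).
  apply: (le_trans C); rewrite -/K (mulrDl (K * M * (e / L))) weight_error//.
  apply: ler_pM; first exact: expR_ge0.
  - apply: addr_ge0; first by apply: I_ge0 => x; rewrite mulr_ge0 ?pos_ge0.
    apply: mulr_ge0; first by rewrite subr_ge0 ltW.
    apply: addr_ge0; first by apply: mulr_ge0 => //; exact: ltW.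
    by apply: mulr_ge0; [exact: powR_ge0|apply: mulr_ge0 => //; exact: ltW].
  - by rewrite ler_expR ler_wpM2l// (le_trans _ tT)// gerBl ltW.
  rewrite (_ : T * (2 * K * M) * e + T * (2 * L) * lam `^ p =
    T * (2 * K * M * e + lam `^ p * (2 * L))); last by ring.
  apply: lerD => //.
  apply: ler_wpM2r; last by rewrite (le_trans _ tT)// gerBl ltW.
  apply: addr_ge0; first by apply: mulr_ge0 => //; exact: ltW.
  by apply: mulr_ge0; [exact: powR_ge0|apply: mulr_ge0 => //; exact: ltW].
have A1 : l1 r (v t) (v (lam `^ (m - 1) * t)) <= eps / 8.
  apply: Hd; first by rewrite t0t.
  rewrite -[X in _ - X]mul1r -mulrBl normrM (gtr0_norm t_gt0).
  apply: (@le_lt_trans _ _ (`|lam `^ (m - 1) - 1| * T)); first by rewrite ler_wpM2l.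
  rewrite -ltr_pdivlMr//; apply: (lt_le_trans lq); by rewrite ge_min lexx.
have A2 : I (fun x => (1 - lam) * window r x) <= eps / 8.
  rewrite IZ ?I_window ?(ltW r_gt0)//; last exact: bcs_window.
  apply: le_trans Ha; rewrite mulrC ler_wpM2l ?mulr_ge0 ?(ltW r_gt0)//.
  by rewrite (le_trans la)// ge_min lexx orbT.
have B1 := I_window_le (bpos _ _ (bz t) (bw t)) (fun x => pos_ge0 _) bA psi0 psir.
apply: (@le_trans _ _ (l1 r (v t) (v (lam `^ (m - 1) * t)) +
    I (fun x => (1 - lam) * window r x) +
    r2 * I (fun x => pos (z t x - w t x) * psi x))); last first.
  apply: (lower_budget E0 r20 X _ _ _ A1 A2 eps0); first by rewrite mulrA.
    by rewrite -(mulrA (r2 * E)) in He *.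
  apply: le_trans Hdel; rewrite mulrA; apply: ler_wpM2l => //.
  by apply: mulr_ge0 => //; apply: mulr_ge0; [exact: ltW|apply: mulr_ge0 => //; exact: ltW].
apply: le_trans (lerD (lexx _) B1).
have bw1 : bcs (fun x => (1 - lam) * window r x) by apply: bcsZ; exact: bcs_window.
have bw2 : bcs (fun x => pos (z t x - w t x) * window r x).
  by apply: bcsMl; [exact: bpos|exact: bcs_window].
have bl := bcs_l1 r (bv t) (bv (lam `^ (m - 1) * t)).
rewrite /l1 -!ID//; last exact: bcsD.
apply: I_le.
- by apply: bcsMl; [exact: bpos|exact: bcs_window].
- by apply: bcsD => //; exact: bcsD.
move=> x; rewrite -!mulrDl ler_wpM2r ?window_ge0//; apply: pos_le.
  apply: addr_ge0; last exact: pos_ge0.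
  by apply: addr_ge0 => //; rewrite subr_ge0 ltW.
set y := v (lam `^ (m - 1) * t) x.
have /andP[y0 y1] : 0 <= y <= 1 by exact: v1.
have zE : z t x = lam * y by [].
have yl : (1 - lam) * y <= 1 - lam by rewrite ler_piMr// subr_ge0 ltW.
by rewrite zE; exact: sub_le_rescaled (ler_pos _).
Qed.

(** Within a short time tau the damping brings w below kappa, just above 1,
    while [initial_layer] keeps it below f0 up to a small error. At time tau
    it is thus essentially below min(f0, 1), hence below v, and comparison
    propagates this to the later times. *)
Lemma upper_bound (eps : R) : 0 < eps -> exists P : R, forall p w, P <= p ->
  flow M w -> subsol m (fun k => k `^ (p - 1)) w -> initial_value w f0 ->
  forall t, t0 <= t <= T -> I (fun x => pos (w t x - v t x) * window r x) <= eps.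
Proof.
move=> eps0; have e8 : 0 < eps / 8 by rewrite divr_gt0.
have rE0 : 0 <= r2 * E by exact: mulr_ge0.
have [e e_gt0 He] : exists2 e : R, 0 < e &
    r2 * E * E * (T * (2 * K * M)) * e <= eps / 8.
  apply: small_factor => //; apply: mulr_ge0; first exact: mulr_ge0.
  by apply: mulr_ge0 => //; exact: ltW.
have [psi [L [[L0 tpsi] psi01 psir psiL dpsi]]] := weight_exists r e_gt0.
have psi0 x : 0 <= psi x by have /andP[] := psi01 x.
have eL0 : 0 <= e / L by rewrite divr_ge0 ?ltW.
have L20 : 0 <= 2 * L by rewrite mulr_ge0// ltW.
have [h h0 Hh] := small_factor rE0 e8.
have [k k_gt0 Hk] := small_factor L20 h0.
pose kappa := 1 + Num.min k 1.
have mk0 : 0 < Num.min k 1 by rewrite lt_min k_gt0 ltr01.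
have kappa1 : 1 < kappa by rewrite ltrDl.
have kM : 0 <= kappa <= M.
  apply/andP; split; first exact: le_trans (ltW kappa1).
  by apply: le_trans M2; rewrite /kappa -natr1 addrC lerD2r ge_min lexx orbT.
have [tau0 tau0_gt0 layer] := initial_layer m1 (ltW L0) tpsi psi01 psiL bf0 f0M h0.
have [d d0 Hd] := inv L h0.
pose tau := Num.min (Num.min tau0 d) t0 / 2.
have tau_min : 0 < Num.min (Num.min tau0 d) t0 by rewrite !lt_min tau0_gt0 d0.
have tau_gt0 : 0 < tau by rewrite divr_gt0.
have : tau < Num.min (Num.min tau0 d) t0 by rewrite [ltRHS]splitr ltrDl.
rewrite !lt_min => /andP[/andP[tau_tau0 tau_d] tau_t0].
have s0 : 0 < tau / 2 by rewrite divr_gt0.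
have stau : tau / 2 <= tau by rewrite [leRHS]splitr lerDl ltW.
have ML0 : 0 <= M * (2 * L) by exact: mulr_ge0.
have [del del0 Hdel] := small_factor ML0 h0.
(* the damping is made to act on [tau / 2, tau], away from the initial time *)
have [P HP] := damping_small K kappa1 s0 del0.
exists P => p w /HP damp fw subw inw t /andP[t0t tT].
have beta0 (q : R) : 0 <= q -> 0 <= q `^ (p - 1) by move=> _; exact: powR_ge0.
have [bw wM _] := fw; have [bv v1 _] := fv.
have taut : tau <= t by rewrite (le_trans (ltW tau_t0)).
have tauT : tau <= T by exact: le_trans tT.
have bA := test1_bcs tpsi.
have C := compare m1 (ltW L0) tpsi psi01 psiL fw fvM subw beta0 superv (lexx 0)
  (fun _ _ => lexx 0) (fun s x => proj2 (andP (wM s x))) eL0 dpsi tau_gt0 taut.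
have D := excess_decay m1 L0 (ltW e_gt0) kM tpsi psi01 psiL dpsi fw subw s0 stau.
have bpos (g g' : R -> R) : bm g -> bm g' -> bm (fun x => pos (g x - g' x)).
  by move=> bg bg'; apply: bm_pos; exact: bmB.
have bk : bm (fun _ : R => kappa) by exact: bm_cst.
pose q := T * (2 * K * M) * e.
have Te0 : 0 <= 2 * K * M * e by apply: mulr_ge0 => //; exact: ltW.
have q0 : 0 <= q by rewrite /q -mulrA; apply: mulr_ge0 => //; exact: ltW.
have X : I (fun x => pos (w t x - v t x) * psi x) <=
    E * (I (fun x => pos (w tau x - v tau x) * psi x) + q).
  apply: (le_trans C); rewrite -/K addr0 weight_error//.
  apply: ler_pM; first exact: expR_ge0.
  - apply: addr_ge0; first by apply: I_ge0 => x; rewrite mulr_ge0 ?pos_ge0.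
    by apply: mulr_ge0 => //; rewrite subr_ge0.
  - by rewrite ler_expR ler_wpM2l// (le_trans _ tT)// gerBl ltW.
  apply: lerD => //; rewrite /q -[leRHS]mulrA; apply: ler_wpM2r => //.
  by rewrite (le_trans _ tT)// gerBl ltW.
have Y : I (fun x => pos (w tau x - v tau x) * psi x) <=
    I (fun x => pos (w tau x - kappa) * psi x) + (kappa - 1) * (2 * L) +
    I (fun x => pos (w tau x - f0 x) * psi x) + l1 L (v tau) f1.
  have b1 : bcs (fun x => pos (w tau x - kappa) * psi x).
    by apply: bcsMl => //; exact: (bpos _ _ (bw tau) bk).
  have b2 : bcs (fun x => pos (w tau x - f0 x) * psi x) by apply: bcsMl => //; exact: bpos.
  have b3 : bcs (fun x => (kappa - 1) * window L x) by apply: bcsZ; exact: bcs_window.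
  have b4 := bcs_l1 L (bv tau) bf1.
  rewrite -(I_window (ltW L0)) -IZ; last exact: bcs_window.
  rewrite /l1 -!ID//; try by do ! apply: bcsD => //.
  apply: I_le; [by apply: bcsMl => //; exact: bpos|by do 3 (apply: bcsD => //)|] => x.
  rewrite windowE; case: ifPn => xL; last first.
    by rewrite psiL ?ltNge// !mulr0 !addr0.
  rewrite !mulr1; have /andP[p0 p1] := psi01 x.
  apply: (@le_trans _ _ ((pos (w tau x - kappa) + (kappa - 1) + pos (w tau x - f0 x) +
    `|v tau x - f1 x|) * psi x)).
    rewrite ler_wpM2r//; apply: pos_le; last exact: sub_le_layers (ltW kappa1).
    apply: addr_ge0 => //; apply: addr_ge0; last exact: pos_ge0.
    by apply: addr_ge0; [exact: pos_ge0|rewrite subr_ge0 ltW].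
  rewrite 3!mulrDl; apply: lerD; last by rewrite ler_piMr.
  rewrite lerD2r lerD2l ler_piMr// subr_ge0; exact: ltW.
have A : I (fun x => pos (w tau x - kappa) * psi x) <= del * (M * (2 * L)) + E * q.
  apply: (le_trans D); rewrite -/K; apply: lerD.
    apply: ler_pM; [exact: expR_ge0|by apply: I_ge0 => x; rewrite mulr_ge0 ?pos_ge0| |].
      by rewrite [X in _ * (X - _)]splitr addrK.
    apply: I_le_bound; [|exact: ltW| |].
    - by apply: bcsMl => //; exact: (bpos _ _ (bw _) bk).
    - move=> x; have /andP[w0 w1] := wM (tau / 2) x; have /andP[p0 p1] := psi01 x.
      apply: (@le_trans _ _ (pos (w (tau / 2) x - kappa))).
        by rewrite ler_piMr// pos_ge0.
      rewrite pos_le// (@le_trans _ _ (w (tau / 2) x))// gerBl.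
      by have /andP[] := kM.
    - by move=> x xL; rewrite psiL// mulr0.
  have sT : tau - tau / 2 <= T by rewrite (le_trans _ tauT)// gerBl ltW.
  have s0' : 0 <= tau - tau / 2 by rewrite subr_ge0.
  apply: ler_pM; [exact: expR_ge0|exact: mulr_ge0| |].
    rewrite ler_expR; apply: ler_pM => //; first by rewrite le_max lexx orbT.
    by rewrite ge_max K0 andbT gerBl powR_ge0.
  by rewrite /q -[leRHS]mulrA; apply: ler_wpM2r.
have B : (kappa - 1) * (2 * L) <= h.
  rewrite /kappa addrC addKr mulrC; apply: le_trans Hk.
  by rewrite ler_wpM2l// ge_min lexx.
have F : I (fun x => pos (w tau x - f0 x) * psi x) <= h.
  by apply: (layer w _ tau fw subw beta0 inw); rewrite tau_gt0.
have G : l1 L (v tau) f1 <= h by apply: Hd; rewrite tau_gt0.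
apply: (le_trans (I_window_le (bpos _ _ (bw t) (bv t)) (fun x => pos_ge0 _) bA psi0 psir)).
apply: (upper_budget E0 E1 r20 q0 X Y A _ B F G Hh _ eps0).
  by rewrite mulrC.
by rewrite /q mulrA.
Qed.

End convergence.

(** * Convergence *)

Lemma cvge0_of_near_le (R : realType) (T : Type) (F : set_system T) (f : T -> \bar R) :
  Filter F -> (forall t, (0 <= f t)%E) ->
  (forall e : R, 0 < e -> F [set t | (f t <= e%:E)%E]) -> f @ F --> 0%E.
Proof.
move=> FF f0 H; apply/fine_cvgP; split.
  apply: filterS (H 1 ltr01) => t /= ft.
  by rewrite ge0_fin_numE// (le_lt_trans ft)// ltry.
apply/cvgrPdist_le => e e0; apply: filterS (H e e0) => t /= ft.
have ffin : f t \is a fin_num by rewrite ge0_fin_numE// (le_lt_trans ft)// ltry.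
by rewrite sub0r normrN ger0_norm ?fine_ge0// -lee_fin fineK.
Qed.

Theorem theorem1p2 (R : realType) (m : R) (u0 : R -> R)
    (u_ : R -> R * R -> R) (uoo : R * R -> R)
    (m_gt1 : 1 < m)
    (u0_Linfty : nonneg_Linfty u0)
    (u_sol : forall p : R, 1 < p ->
       kruzkov_solution m (fun v => - (v `^ p)) u0 (u_ p) /\
       continuous_L1loc (u_ p))
    (uoo_sol :
       kruzkov_solution m (fun=> 0) (fun x => Num.min (u0 x) 1) uoo /\
       continuous_L1loc uoo) :
  forall t0 T : R, 0 < t0 -> t0 < T -> cvg_C_L1loc t0 T u_ uoo.
Proof.
move=> t0 T t0_gt0 t0T r r_gt0.
have [u0L u0_ge0] := u0_Linfty.
have [mu0 [M0 M00 u0M]] := Linfty_bound u0L.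
(* M must be at least any level kappa <= 2 of [upper_bound] *)
pose M := M0 + 2.
have M2 : 2 <= M by rewrite lerDr.
have M_gt0 : 0 < M by exact: lt_le_trans M2.
(* u0 altered on a null set, in order to be bounded everywhere *)
pose f0 x := Num.max 0 (Num.min M (u0 x)).
have f0M x : 0 <= f0 x <= M by rewrite le_max lexx/= ge_max (ltW M_gt0)/= ge_min lexx.
have bf0 : bm f0.
  split; last by exists M => x; have /andP[x0 x1] := f0M x; rewrite ger0_norm.
  by apply: measurable_maxr => //; exact: measurable_minr.
have u0f0 : {ae @lebesgue_measure R, forall x, u0 x = f0 x}.
  have := ae_and u0M u0_ge0; apply: ae_imp => x [+ x0].
  rewrite ler_norml => /andP[_ xM].
  by rewrite /f0 min_r ?max_r// (le_trans xM)// lerDl.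
pose f1 x := Num.min (f0 x) 1.
have bf1 : bm f1 by apply: bm_min => //; exact: bm_cst.
have f1M x : 0 <= f1 x <= 1.
  have /andP[x0 _] := f0M x.
  by rewrite /f1 le_min x0 ler01/= ge_min lexx orbT.
have u0f1 : {ae @lebesgue_measure R, forall x, Num.min (u0 x) 1 = f1 x}.
  by move: u0f0; apply: ae_imp => x; rewrite /f1 => ->.
have mu1 : measurable_fun setT (fun x => Num.min (u0 x) 1) by exact: measurable_minr.
have [sol_oo cont_oo] := uoo_sol.
have [v [fv subv superv inv uv]] : exists v, [/\ flow 1 v, subsol m (fun=> 0) v,
    supersol m (fun=> 0) v, initial_value v f1 &
    forall t, 0 < t -> {ae @lebesgue_measure R, forall x, uoo (x, t) = v t x}].
  apply: (kruzkov_representative m_gt1 ltr01 _ _ _ _ _ _ _ sol_oo cont_oo mu1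
    bf1 f1M u0f1) => //.
  - by move=> y; rewrite oppr0.
  - by move=> k y _ _; rewrite mul0r.
have rep p : 1 < p -> exists w, [/\ flow M w, subsol m (fun k => k `^ (p - 1)) w,
    supersol m (fun k => k `^ p) w, initial_value w f0 &
    forall t, 0 < t -> {ae @lebesgue_measure R, forall x, u_ p (x, t) = w t x}].
  move=> p1; have [sol cont] := u_sol p p1.
  have p0 : 0 < p by exact: lt_trans p1.
  have p10 : 0 <= p - 1 by rewrite subr_ge0 ltW.
  apply: (kruzkov_representative m_gt1 M_gt0 _ _ _ _ _ _ _ sol cont mu0 bf0 f0M u0f0) => //.
  - by apply: measurable_funN; exact: (measurable_powR p).
  - by rewrite powR0// gt_eqF.
  - by move=> *; exact: powR_ge0.
  - move=> y z y0 yz; apply: ge0_ler_powR; rewrite ?nnegrE// ?(ltW p0)//.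
    exact: le_trans yz.
  - by move=> *; exact: powR_ge0.
  - move=> k y k0 ky; have y0 : 0 <= y by exact: le_trans ky.
    rewrite -(mulr_powRB1 y0 p0) mulrC; apply: ler_pM; rewrite ?subr_ge0 ?powR_ge0//.
      by rewrite gerBl.
    by apply: ge0_ler_powR.
apply: cvge0_of_near_le.
  move=> p; apply: ereal_sup_ge; exists (L1dist r (fun x => u_ p (x, t0)) (fun x => uoo (x, t0))).
    by exists t0 => //=; rewrite lexx ltW.
  exact: L1dist_ge0.
move=> e e0.
have e2 : 0 < e / 2 by rewrite divr_gt0.
have [P1 H1] := lower_bound m_gt1 M2 bf0 f0M t0_gt0 t0T r_gt0 fv subv inv e2.
have [P2 H2] := upper_bound r m_gt1 M2 bf0 f0M t0_gt0 t0T fv superv inv e2.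
near=> p.
have p1 : 1 < p by near: p; apply: nbhs_pinfty_gt; rewrite num_real.
have pP1 : P1 <= p by near: p; apply: nbhs_pinfty_ge; rewrite num_real.
have pP2 : P2 <= p by near: p; apply: nbhs_pinfty_ge; rewrite num_real.
have [w [fw subw superw inw uw]] := rep p p1.
apply: ge_ereal_sup => _ /= [t tT <-].
have t_gt0 : 0 < t by have /andP[+ _] := tT; exact: lt_le_trans.
have [bw _ _] := fw; have [bv _ _] := fv.
have [sol cont] := u_sol p p1.
have mu_ : measurable_fun setT (fun x => u_ p (x, t)) by have [] := cont.1 t t_gt0.
have muoo : measurable_fun setT (fun x => uoo (x, t)) by have [] := cont_oo.1 t t_gt0.
have mw := (bw t).1; have mv := (bv t).1.
apply: (le_trans (L1dist_triangle r mu_ muoo mw)).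
rewrite (L1dist_ae0 r mu_ mw (uw t t_gt0)) add0e.
apply: (le_trans (L1dist_triangle r mw muoo mv)).
rewrite L1distC [X in (_ + X)%E]L1distC (L1dist_ae0 r muoo mv (uv t t_gt0)) adde0.
rewrite L1distE// lee_fin.
have L := H1 p w pP1 fw superw inw t tT; have U := H2 p w pP2 fw subw inw t tT.
have b (g g' : R -> R) : bm g -> bm g' -> bcs (fun x => pos (g x - g' x) * window r x).
  move=> bg bg'; apply: bcsMl; last exact: bcs_window.
  exact: (bm_pos (bmB bg bg')).
rewrite [e]splitr; apply: le_trans (lerD L U); rewrite /l1 -ID; [|exact: b..].
rewrite le_eqVlt; apply/orP; left; apply/eqP; congr I; apply/funext => x.
by rewrite -mulrDl norm_pos opprB.
Unshelve. all: by end_near.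
Qed.
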